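(* Let $p$ be a prime, $f \geq 1$ an integer, and $G = \operatorname{PSL}(2,p^f)$. Let $r$ be a prime different from $p$ and let $u$ be a torsion unit in $V(\mathbb{Z}G)$ of $r$-power order. Then $u$ is rationally conjugate to a group element, i.e. there exist a unit $x$ of $\mathbb{Q}G$ and an element $g \in G$ such that $x^{-1}ux = g$.
   Context: For a finite group $G$, $\mathbb{Z}G$ and $\mathbb{Q}G$ denote the integral and rational group rings of $G$. $V(\mathbb{Z}G)$ denotes the group of units of augmentation $1$ in $\mathbb{Z}G$, i.e. those units $\sum_{g \in G} a_g g$ of $\mathbb{Z}G$ with $\sum_{g\in G} a_g = 1$. $G$ is regarded as a subgroup of $V(\mathbb{Z}G)$ in the natural way. $\operatorname{PSL}(2,p^f)$ is the projective special linear group of degree $2$ over the field with $p^f$ elements. *)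

(* Defs.v *)
From HB Require Import structures.
From mathcomp Require Import all_boot all_order all_fingroup all_algebra all_solvable.

Set Implicit Arguments.
Unset Strict Implicit.
Unset Printing Implicit Defensive.

Import GRing.Theory.
Local Open Scope ring_scope.

(* A wrapper around {ffun gT -> R} rather than an alias of it, so that the
   convolution product below cannot be confused with the pointwise one. *)
Record group_ring (R : nzRingType) (gT : finGroupType) : predArgType :=
  GroupRing { coeffs : {ffun gT -> R} }.

Section GroupRing.
Variables (R : nzRingType) (gT : finGroupType).
Local Notation RG := (group_ring R gT).

HB.instance Definition _ := [isNew for @coeffs R gT].
HB.instance Definition _ := [Choice of RG by <:].

Definition coeff (u : RG) (g : gT) : R := coeffs u g.

Definition gr_of_fun (a : gT -> R) : RG := GroupRing [ffun g => a g].

Lemma coeffE a g : coeff (gr_of_fun a) g = a g.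
Proof. by rewrite /coeff ffunE. Qed.

Lemma gr_ext (u v : RG) : coeff u =1 coeff v -> u = v.
Proof.
case: u v => [a] [b] eq_ab; congr GroupRing.
by apply/ffunP => g; apply: eq_ab.
Qed.

Definition gr_elt (h : gT) : RG := gr_of_fun (fun g => (g == h)%:R).

Definition gr_zero : RG := gr_of_fun (fun=> 0).
Definition gr_opp u : RG := gr_of_fun (fun g => - coeff u g).
Definition gr_add u v : RG := gr_of_fun (fun g => coeff u g + coeff v g).
(* The coefficient of g in u v is the sum of u_h v_k over the pairs with
   h k = g, i.e. k = h^-1 g. *)
Definition gr_mul u v : RG :=
  gr_of_fun (fun g => \sum_(h : gT) coeff u h * coeff v (h^-1 * g)%g).
Definition gr_one : RG := gr_elt 1%g.

Fact gr_addA : associative gr_add.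
Proof. by move=> u v w; apply: gr_ext => g; rewrite !coeffE addrA. Qed.

Fact gr_addC : commutative gr_add.
Proof. by move=> u v; apply: gr_ext => g; rewrite !coeffE addrC. Qed.

Fact gr_add0 : left_id gr_zero gr_add.
Proof. by move=> u; apply: gr_ext => g; rewrite !coeffE add0r. Qed.

Fact gr_addN : left_inverse gr_zero gr_opp gr_add.
Proof. by move=> u; apply: gr_ext => g; rewrite !coeffE addNr. Qed.

HB.instance Definition _ :=
  GRing.isZmodule.Build RG gr_addA gr_addC gr_add0 gr_addN.

Fact gr_mulA : associative gr_mul.
Proof.
move=> u v w; apply: gr_ext => g; rewrite !coeffE.
under eq_bigr do rewrite coeffE big_distrr /=.
under [RHS]eq_bigr do rewrite coeffE big_distrl /=.
rewrite [RHS]exchange_big /=; apply: eq_bigr => h _.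
rewrite [RHS](reindex_inj (mulgI h)) /=; apply: eq_bigr => k _.
by rewrite mulrA mulKg invMg mulgA.
Qed.

Fact gr_mul1l : left_id gr_one gr_mul.
Proof.
move=> u; apply: gr_ext => g; rewrite coeffE (bigD1 1%g) //= coeffE eqxx mul1r.
rewrite invg1 mul1g big1 ?addr0 // => h /negbTE h_neq1.
by rewrite coeffE h_neq1 mul0r.
Qed.

Fact gr_mul1r : right_id gr_one gr_mul.
Proof.
move=> u; apply: gr_ext => g; rewrite coeffE (bigD1 g) //= coeffE mulVg eqxx.
rewrite mulr1 big1 ?addr0 // => h /negbTE h_neqg.
by rewrite coeffE -eq_mulVg1 h_neqg mulr0.
Qed.

Fact gr_mulDl : left_distributive gr_mul gr_add.
Proof.
move=> u v w; apply: gr_ext => g; rewrite !coeffE -big_split /=.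
by apply: eq_bigr => h _; rewrite coeffE mulrDl.
Qed.

Fact gr_mulDr : right_distributive gr_mul gr_add.
Proof.
move=> u v w; apply: gr_ext => g; rewrite !coeffE -big_split /=.
by apply: eq_bigr => h _; rewrite coeffE mulrDr.
Qed.

Fact gr_one_neq0 : gr_one != gr_zero.
Proof.
apply/eqP => /(congr1 (coeff^~ 1%g)); rewrite !coeffE eqxx => /eqP.
by rewrite oner_eq0.
Qed.

HB.instance Definition _ := GRing.Zmodule_isNzRing.Build RG
  gr_mulA gr_mul1l gr_mul1r gr_mulDl gr_mulDr gr_one_neq0.

Lemma gr_elt1 : gr_elt 1%g = 1.
Proof. by []. Qed.

Lemma gr_eltM g h : gr_elt (g * h)%g = gr_elt g * gr_elt h.
Proof.
apply: gr_ext => k; rewrite !coeffE (bigD1 g) //= !coeffE eqxx mul1r.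
rewrite big1 ?addr0 => [|i /negbTE i_neqg]; last by rewrite !coeffE i_neqg mul0r.
by rewrite -(inj_eq (mulgI g) _ h) mulKVg.
Qed.

Definition augmentation (u : RG) : R := \sum_(g : gT) coeff u g.

End GroupRing.

Arguments gr_elt {R gT} h.

(* The ring ZG carries no decidable unit predicate in the library, hence
   units are expressed with explicit two-sided inverses. *)
Definition inverse_of (A : nzRingType) (x y : A) : Prop :=
  y * x = 1 /\ x * y = 1.

Definition normalized_unit (gT : finGroupType) (u : group_ring int gT) : Prop :=
  (exists v, inverse_of u v) /\ augmentation u = 1.

(* n.-primitive_root u makes sense in any ring, commutative or not: n is the
   least positive integer such that u ^+ n = 1. *)
Definition has_order (A : nzRingType) (u : A) (n : nat) : Prop :=
  n.-primitive_root u.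

Definition ZG_to_QG (gT : finGroupType) (u : group_ring int gT) :
  group_ring rat gT := gr_of_fun (fun g => (coeff u g)%:~R).

Section PSL2.
Variable F : finFieldType.

Definition SL2 : {set {'GL_2[F]}} := [set A : {'GL_2[F]} | \det (GLval A) == 1].

Fact SL2_group_set : group_set SL2.
Proof.
apply/group_setP; split=> [|A B]; rewrite !inE ?GL_1E ?det1 //.
by move=> /eqP detA /eqP detB; rewrite GL_ME det_mulmx detA detB mulr1.
Qed.

Canonical SL2_group := Group SL2_group_set.

(* The quotient SL2 / 'Z(SL2) is a subgroup of the type of all cosets of
   'Z(SL2) in its normaliser (inside GL2); [subg _] makes it a type. *)
Definition PSL2 : finGroupType := [subg (SL2 / 'Z(SL2))%G]%type.

End PSL2.

(* Main.v *)
(* Let u have order n = r^k.  The partial augmentation of u vanishes on g unless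
   g^n = 1: if a prime other than r divides the order of g, expand u^(s^N) into
   words and use rotation invariance; if the order of g is a larger power of r,
   compare ranks modulo r of w |-> u w g^-1.  The group PSL(2, p^f) acts on the
   even symmetric powers Sym^(2t) of the natural module; as n is prime to p, u
   has a diagonal image there, and lifting traces to characteristic 0 expresses
   the sums of powers of the lifted eigenvalues by the partial augmentations of
   the powers of u.  Collecting these augmentations along the eigenvalues of
   group elements gives even integer functions f_i on the n-th roots of unity,
   and the increments of the spectra of Sym^(2t) give multisets dual to them
   under the Fourier transform.  Nonnegativity of multiplicities, the induction
   hypothesis for u^r, the vanishing of the coefficient of u at 1 and a
   congruence modulo r leave only f_i = [b^i] + [b^-i] for a primitive n-th root
   b.  Elements of order prime to p with the same eigenvalues up to inversion are
   conjugate in PSL(2, p^f), so u^i has the class sums of x^i for some x in G.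
   Hence u and x are conjugate over algC, and then over Q. *)
From HB Require Import structures.
From mathcomp Require Import all_boot all_order all_fingroup all_algebra all_solvable all_field all_character.
From mathcomp Require Import ring zify.
Require Import Defs.

Set Implicit Arguments.
Unset Strict Implicit.
Unset Printing Implicit Defensive.

Import Order.TTheory GRing.Theory Num.Theory.
Local Open Scope ring_scope.
Local Notation rot := seq.rot.

(** * Sums over words and rotations *)

(** Partial augmentations may be negative, so positivity has to come from multiplicities of
    eigenvalues. The trace of u^i on Sym^(2t) less that on Sym^(2t-2) is the sum of f_i(z) z^t; as a
    function of i it is the transform of the increment of the spectrum at t. The pairing is
    symmetric in the power i and the level t, and Galois automorphisms act on both indices alike, so
    the levels t = r^j suffice. Even powers are taken because -1 acts trivially on them. Full
    spectra are nonnegative, increments need not be: at level r^j the lower increments are first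
    shown to vanish on the roots of unity of order dividing r^(k+1-j), where n = r^(k+1), which
    leaves a possible defect at 1 alone. The congruence modulo r removes that defect. Lifting works
    in Z[X] rather than in a p-adic field: the traces of p^N-th powers of arbitrary lifts are
    determined to precision p^(N+1), and u^(p^N) = u for infinitely many N. One device, sorting
    words by their rotation period, yields the congruences for s, r and p alike. *)

Lemma expr_sum_tuple (R : pzRingType) (T : finType) (y : T -> R) m :
  (\sum_t y t) ^+ m = \sum_(w : m.-tuple T) \prod_(t <- w) y t.
Proof.
rewrite -[m in LHS]card_ord -prodr_const.
rewrite (bigA_distr_bigA (fun _ => y)) /=.
have bij : bijective (fun w : m.-tuple T => [ffun i => tnth w i]).
  exists (fun f : {ffun 'I_m -> T} => [tuple f i | i < m]) => [w|f].
    by apply: eq_from_tnth => i; rewrite tnth_mktuple ffunE.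
  by apply/ffunP => i; rewrite ffunE tnth_mktuple.
rewrite (reindex _ (onW_bij _ bij)); apply: eq_bigr => w _.
by rewrite big_tuple; apply: eq_bigr => i _; rewrite ffunE.
Qed.

Lemma rot_fixed_flatten (T : Type) a c (v w : seq T) :
  size v = a -> size w = (a * c)%N -> w ++ v = v ++ w -> w = flatten (nseq c v).
Proof.
move=> sv; elim: c w => [|c IHc] w.
  by rewrite muln0 => /size0nil.
rewrite mulnS => sw eqwv.
have sav : (size v <= size w)%N by rewrite sw sv leq_addr.
have Ev : take (size v) w = v.
  by rewrite -(takel_cat v sav) eqwv take_size_cat.
have Ew : w = v ++ drop (size v) w by rewrite -{1}(cat_take_drop (size v) w) Ev.
rewrite Ew /=; congr (_ ++ _); apply: IHc.
  by rewrite size_drop sw sv addKn.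
by move: eqwv; rewrite {1 2}Ew -catA => /(congr1 (drop (size v))); rewrite !drop_size_cat.
Qed.

(* A rotation orbit has p^i elements for some i, all fixed by rot (p^i). *)
Lemma rotation_sum (T : finType) (V : zmodType) (J : V -> Prop) p N
    (phi : (p ^ N).-tuple T -> V) :
  prime p -> J 0 -> (forall x y, J x -> J y -> J (x + y)) ->
  (forall w : (p ^ N).-tuple T, phi [tuple of rot 1%N w] = phi w) ->
  (forall i (w : (p ^ N).-tuple T), (i <= N)%N -> rot (p ^ i) w = w -> J (phi w *+ p ^ i)) ->
  J (\sum_w phi w).
Proof.
move=> p_pr J0 JD phi_rot Jper.
pose rt (w : (p ^ N).-tuple T) := [tuple of rot 1%N w].
have rt_inj : injective rt by move=> w w' /(congr1 val) /= /rot_inj /val_inj.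
pose s := perm rt_inj.
have iter_rot i w : (i <= p ^ N)%N -> val (iter i s w) = rot i w.
  elim: i => [|i IHi] lei; first by rewrite rot0.
  by rewrite iterS permE /= IHi 1?ltnW // -(rotS (s := w)) ?size_tuple.
have phi_iter i w : phi (iter i s w) = phi w.
  by elim: i => //= i IHi; rewrite permE phi_rot.
have oN : (#[s]%g %| p ^ N)%N.
  rewrite order_dvdn; apply/eqP/permP => w; rewrite permX perm1; apply: val_inj.
  by rewrite iter_rot // rot_oversize ?size_tuple.
rewrite (partition_big (porbit s) (mem (porbits s))) => [|w _]; last exact: imset_f.
apply: (big_ind J) => // _ /imsetP[w _ ->].
rewrite (eq_bigl (mem (porbit s w))) => [|w']; last by rewrite /= eq_porbit_mem.
have /(dvdn_pfactor _ _ p_pr)[i leiN card_o] : (#|porbit s w| %| p ^ N)%N.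
  by apply: dvdn_trans oN; rewrite porbit.unlock; apply: (dvdn_orbit 'P <[s]>%G w).
rewrite (eq_bigr (fun=> phi w)) => [|w' /porbitP[j ->]]; last by rewrite permX phi_iter.
rewrite sumr_const card_o; apply: Jper => //.
have := iter_porbit s w; rewrite card_o => /(congr1 val).
by rewrite iter_rot // leq_exp2l // prime_gt1.
Qed.

Lemma rotation_fixed_power (T : Type) p N i (w : (p ^ N).-tuple T) :
    (0 < p)%N -> (i <= N)%N -> rot (p ^ i) w = w ->
  exists2 v, size v = (p ^ i)%N & val w = flatten (nseq (p ^ (N - i)) v).
Proof.
move=> p_gt0 leiN rotw; set v := take (p ^ i) w.
have sv : size v = (p ^ i)%N.
  by rewrite size_takel // size_tuple; case: p p_gt0 {w rotw v} => // p _; rewrite leq_pexp2l.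
have eqwv : val w ++ v = v ++ val w.
  by rewrite -[X in v ++ X]rotw /rot -/v catA cat_take_drop.
exists v => //; apply: (rot_fixed_flatten sv) => //.
by rewrite size_tuple -expnD subnKC.
Qed.

(** * Partial augmentations of torsion units *)

Section GroupRingFacts.
Variables (R : nzRingType) (gT : finGroupType).
Implicit Types (u v : group_ring R gT) (g h : gT).

Lemma coeff0 g : coeff (0 : group_ring R gT) g = 0. Proof. exact: coeffE. Qed.
Lemma coeffD u v g : coeff (u + v) g = coeff u g + coeff v g. Proof. exact: coeffE. Qed.
Lemma coeffN u g : coeff (- u) g = - coeff u g. Proof. exact: coeffE. Qed.
Lemma coeff_elt h g : coeff (gr_elt h : group_ring R gT) g = (g == h)%:R.
Proof. exact: coeffE. Qed.
Lemma coeff1 g : coeff (1 : group_ring R gT) g = (g == 1%g)%:R. Proof. exact: coeffE. Qed.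
Lemma coeffM u v g : coeff (u * v) g = \sum_h coeff u h * coeff v (h^-1 * g)%g.
Proof. exact: coeffE. Qed.

Lemma coeff_sum (I : Type) (s : seq I) (P : pred I) (F : I -> group_ring R gT) g :
  coeff (\sum_(i <- s | P i) F i) g = \sum_(i <- s | P i) coeff (F i) g.
Proof.
by apply: (big_morph (fun u => coeff u g)) => [u v|]; rewrite ?coeffD ?coeff0.
Qed.

Lemma gr_eltX h m : gr_elt (h ^+ m)%g = (gr_elt h : group_ring R gT) ^+ m.
Proof. by elim: m => [|m IHm]; rewrite ?expgS ?exprS ?gr_eltM ?IHm. Qed.

Lemma coeffM_eltr h u g : coeff (u * gr_elt h) g = coeff u (g * h^-1)%g.
Proof.
rewrite coeffM (bigD1 (g * h^-1)%g) //= coeff_elt invMg invgK mulgKV eqxx mulr1.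
rewrite big1 ?addr0 // => k nk; rewrite coeff_elt.
case: eqP => [E|]; last by rewrite mulr0.
by case/eqP: nk; rewrite -E invMg invgK mulKVg.
Qed.

End GroupRingFacts.

Section IntegralGroupRing.
Variable gT : finGroupType.
Implicit Types (u v : group_ring int gT) (g h : gT).

Lemma coeff_mulrz u (a : int) g : coeff (u *~ a) g = a * coeff u g.
Proof.
have Hn n : coeff (u *+ n) g = n%:Z * coeff u g.
  elim: n => [|n IHn]; first by rewrite mulr0n coeff0 mul0r.
  by rewrite mulrS coeffD IHn intS mulrDl mul1r.
by case: a => n; rewrite ?NegzE ?mulrNz ?coeffN -?pmulrn Hn // mulNr.
Qed.

Lemma gr_sum_coeff u : u = \sum_g gr_elt g *~ coeff u g.
Proof.
apply: gr_ext => g; rewrite coeff_sum (bigD1 g) //= coeff_mulrz coeff_elt eqxx mulr1.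
rewrite big1 ?addr0 // => h /negbTE nhg.
by rewrite coeff_mulrz coeff_elt eq_sym nhg mulr0.
Qed.

Lemma prod_gr_elt u (w : seq gT) :
  \prod_(g <- w) (gr_elt g *~ coeff u g : group_ring int gT) =
  gr_elt (\prod_(g <- w) g)%g *~ \prod_(g <- w) coeff u g.
Proof.
elim: w => [|g w IHw]; first by rewrite !big_nil.
by rewrite !big_cons IHw gr_eltM mulrzAl mulrzAr -mulrzA mulrC.
Qed.

Lemma coeff_expr u m g :
  coeff (u ^+ m) g = \sum_(w : m.-tuple gT)
     (\prod_(h <- w) coeff u h) *+ ((\prod_(h <- w) h)%g == g).
Proof.
rewrite {1}(gr_sum_coeff u) expr_sum_tuple coeff_sum; apply: eq_bigr => w _.
by rewrite prod_gr_elt coeff_mulrz coeff_elt eq_sym mulr_natr.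
Qed.

Lemma sum_expr_class (V : zmodType) (psi : gT -> V) u m :
  \sum_g psi g *~ coeff (u ^+ m) g =
  \sum_(w : m.-tuple gT) psi (\prod_(h <- w) h)%g *~ \prod_(h <- w) coeff u h.
Proof.
under eq_bigr do rewrite coeff_expr mulrz_sumr.
rewrite exchange_big /=; apply: eq_bigr => w _.
set x := (\prod_(h <- w) h)%g.
rewrite (bigD1 x) //= eqxx mulr1n [X in _ + X]big1 ?addr0 // => g /negbTE ng.
by rewrite eq_sym ng.
Qed.

End IntegralGroupRing.

Lemma prodg_rot1 (gT : finGroupType) (w : seq gT) :
  (\prod_(h <- rot 1%N w) h = (\prod_(h <- w) h) ^ head 1 w)%g.
Proof.
case: w => [|g w]; first by rewrite !big_nil conj1g.
by rewrite rot1_cons big_cons -cats1 big_cat big_seq1 /= conjgE mulgA mulKg.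
Qed.

Lemma prodg_flatten_nseq (gT : finGroupType) c (v : seq gT) :
  (\prod_(h <- flatten (nseq c v)) h = (\prod_(h <- v) h) ^+ c)%g.
Proof.
elim: c => [|c IHc]; first by rewrite big_nil.
by rewrite /= big_cat /= IHc expgS.
Qed.

Lemma prod_rot1 (R : comNzRingType) (T : Type) (F : T -> R) (w : seq T) :
  \prod_(h <- rot 1%N w) F h = \prod_(h <- w) F h.
Proof.
case: w => [|g w]; first by rewrite !big_nil.
by rewrite rot1_cons big_cons -cats1 big_cat big_seq1 /= mulrC.
Qed.

Lemma prod_flatten_nseq (R : pzRingType) (T : Type) (F : T -> R) c (v : seq T) :
  \prod_(h <- flatten (nseq c v)) F h = (\prod_(h <- v) F h) ^+ c.
Proof.
elim: c => [|c IHc]; first by rewrite big_nil.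
by rewrite /= big_cat /= IHc exprS.
Qed.

Section ClassSums.
Variable gT : finGroupType.
Implicit Types (u : group_ring int gT) (C : {set gT}).

Definition class_stable (T : Type) (psi : gT -> T) := forall g h, psi (g ^ h)%g = psi g.

Lemma dvdz_eq0 (p : nat) (z : int) : (1 < p)%N -> (forall j, ((p ^ j)%N%:Z %| z)%Z) -> z = 0.
Proof.
move=> p_gt1 dvz; apply/eqP; rewrite -absz_eq0; apply/eqP.
case E: `|z|%N => [//|m]; have := dvz m.+1; rewrite dvdzE /= E => /(dvdn_leq (ltn0Sn m)).
by rewrite leqNgt (ltn_expl _ p_gt1).
Qed.

(** The sum is divisible by every s^j. Expand u = u^(s^N): a rotation orbit of size s^i with i >= j
    contributes a multiple of s^j, and for i < j the product of the word is an s^(N-i)-th power, of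
    order prime to s, where [psi] fails. *)
Lemma class_sum_singular (psi : pred gT) u n s :
  prime s -> (0 < n)%N -> coprime s n -> u ^+ n = 1 -> class_stable psi ->
  (forall x, psi x -> s %| #[x]%g)%N -> \sum_(g | psi g) coeff u g = 0.
Proof.
move=> s_pr n_gt0 cop un1 psiJ psi_sing; apply: (dvdz_eq0 (prime_gt1 s_pr)) => j.
(* The factor [totient n] gives u^(s^N) = u; the summand [logn s #|gT|] is what an s^(N-i)-th power
   needs to lose the s-part of its order. *)
pose M := (logn s #|gT| + j)%N; pose N := (totient n * M)%N.
have leMN : (M <= N)%N by rewrite leq_pmull ?totient_gt0.
have uN : u ^+ (s ^ N) = u.
  have: (s ^ N = 1 %[mod n])%N.
    by rewrite expnM -modnXm Euler_exp_totient // modnXm exp1n.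
  by move=> E; rewrite -(expr_mod _ un1) E expr_mod.
have -> : \sum_(g | psi g) coeff u g = \sum_g (psi g : int) *~ coeff u g.
  rewrite big_mkcond; apply: eq_bigr => g _; rewrite mulrzz.
  by case: (psi g); rewrite ?mul1r ?mul0r.
rewrite -{1}uN sum_expr_class.
apply: (rotation_sum (J := fun z => (((s ^ j)%N%:Z) %| z)%Z) s_pr) => //.
- by move=> x y; apply: rpredD.
- move=> w /=; rewrite prod_rot1 prodg_rot1; congr (_ *~ _).
  by congr (_ %:Z); congr nat_of_bool; apply: psiJ.
move=> i w leiN rotw.
have [lji|ltij] := leqP j i.
  by rewrite -mulr_natr dvdz_mull // natz dvdzE /= dvdn_exp2l.
have [v sv ->] := rotation_fixed_power (prime_gt0 s_pr) leiN rotw.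
rewrite prodg_flatten_nseq; set x := (\prod_(h <- v) h)%g.
suff -> : psi (x ^+ (s ^ (N - i)))%g = false by rewrite mul0rz mul0rn dvdz0.
apply: contraTF isT => /psi_sing sx; move: (s_pr).
suff : (#[x ^+ (s ^ (N - i))]%g %| #|gT|`_s^')%N.
  move/(dvdn_trans sx) => /(pnat_dvd)/(_ (part_pnat _ _)).
  by rewrite pnatE // inE /= inE eqxx.
rewrite order_dvdn -expgM.
have : (#|gT| %| s ^ (N - i) * #|gT|`_s^')%N.
  rewrite -{1}(@partnC s #|gT|) ?cardG_gt0 //; last by rewrite -cardsT cardG_gt0.
  rewrite dvdn_pmul2r ?part_gt0 // p_part dvdn_exp2l // leq_subRL //.
  by rewrite addnC; apply: leq_trans leMN; rewrite leq_add2l ltnW.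
rewrite -cardsT -order_dvdn; apply: dvdn_trans; apply: order_dvdG.
by rewrite inE.
Qed.

Lemma fermat_int r (a : int) : prime r -> (r %| a ^+ r - a)%Z.
Proof.
move=> r_pr; rewrite (dvdz_pcharf (pchar_Fp r_pr)) rmorphB rmorphXn /= subr_eq0.
by have := expf_card (a%:~R : 'F_r); rewrite card_Fp // => ->.
Qed.

Lemma fermat_int_pow r (a : int) j : prime r -> (r %| a ^+ (r ^ j) - a)%Z.
Proof.
move=> r_pr; elim: j => [|j IHj]; first by rewrite subrr dvdz0.
rewrite expnSr exprM -(subrK (a ^+ (r ^ j)) ((a ^+ (r ^ j)) ^+ r)) -addrA.
by rewrite rpredD ?fermat_int.
Qed.

(** Both terms are sums over words of length r^j, the first carried by the constant words. Orbits of
    more than one word count a multiple of r times; a constant word compares u_g with u_g^(r^j),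
    which agree modulo r by Fermat. *)
Lemma sum_torsion_coeff_mod u r j : prime r ->
  (r %| \sum_(g | (g ^+ (r ^ j) == 1)%g) coeff u g - coeff (u ^+ (r ^ j)) 1%g)%Z.
Proof.
move=> r_pr; pose q := (r ^ j)%N.
have -> : \sum_(g | (g ^+ (r ^ j) == 1)%g) coeff u g =
    \sum_(w : q.-tuple gT) \sum_(g | (w == nseq_tuple q g) && (g ^+ q == 1)%g) coeff u g.
  rewrite (exchange_big_dep (fun g => g ^+ q == 1)%g) /=; last by move=> w g _ /andP[].
  by apply: eq_bigr => g gq; under eq_bigl do rewrite gq andbT; rewrite big_pred1_eq.
rewrite coeff_expr -sumrB.
apply: (rotation_sum (J := fun z => (r %| z)%Z) r_pr); first exact: dvdz0.
- by move=> x y; apply: rpredD.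
- move=> w /=; rewrite prod_rot1 prodg_rot1.
  congr (_ - _ *+ nat_of_bool _); last first.
    by rewrite conjg_eq1.
  apply: eq_bigl => g; congr (_ && _); rewrite -!val_eqE /=.
  have rot_nseq : rot 1%N (nseq q g) = nseq q g.
    by case: (q) => //= m; rewrite rot1_cons; elim: m => //= m ->.
  by rewrite -{1}rot_nseq (inj_eq (@rot_inj _ _)).
case=> [|i] w leiN rotw; last first.
  by rewrite -[X in (_ %| X)%Z]mulr_natr dvdz_mull // natz dvdzE /= dvdn_exp.
have [[|g [|//]] // _ Ew] := rotation_fixed_power (prime_gt0 r_pr) leiN rotw.
rewrite subn0 -/q in Ew.
have {Ew} Ew : w = nseq_tuple q g.
  by apply: val_inj; rewrite Ew /=; elim: (q) => //= m ->.
have prodg1 : (\prod_(h <- w) h = g ^+ q)%g.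
  by rewrite Ew /=; elim: {1 2}(q) => [|m IHm]; rewrite /= ?big_nil // big_cons IHm expgS.
have prodc : \prod_(h <- w) coeff u h = coeff u g ^+ q.
  by rewrite Ew /=; elim: {1 2}(q) => [|m IHm]; rewrite /= ?big_nil // big_cons IHm exprS.
have -> : \sum_(h | (w == nseq_tuple q h) && (h ^+ q == 1)%g) coeff u h =
    coeff u g *+ (g ^+ q == 1)%g.
  have q_gt0 : (0 < q)%N by rewrite expn_gt0 prime_gt0.
  have eqw h : (w == nseq_tuple q h) = (h == g).
    rewrite Ew eq_sym; apply/eqP/eqP => [/(congr1 val)|-> //] /=.
    by case: (q) q_gt0 => // m _ [].
  under eq_bigl do rewrite eqw; case: eqP => gq; last first.
    by rewrite big_pred0 // => h; case: (eqVneq h g) => // ->; apply/eqP.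
  rewrite (big_pred1 g) // => h; rewrite -[RHS](andbT (h == g)).
  by case: eqVneq => // ->; apply/eqP.
rewrite prodg1 prodc expn0 mulr1n; case: eqP => _; rewrite ?subrr ?dvdz0 //.
by rewrite -opprB rpredN fermat_int_pow.
Qed.

End ClassSums.

(** * Diagonalisation, and ranks under reduction modulo r *)

Lemma finite_order_diag (F : fieldType) N (z : F) n (A : 'M[F]_n) :
  N.-primitive_root z -> A ^+ N = 1 ->
  exists2 P : 'M[F]_n, P \in unitmx &
    exists2 d : 'rV[F]_n, P *m A = diag_mx d *m P & forall i, d 0 i ^+ N = 1.
Proof.
move=> prim_z; case: n A => [|n] A AN.
  by exists 1%:M; rewrite ?unitmx1 //; exists 0 => [|[]//]; rewrite !(thinmx0, flatmx0).
have /diagonalizableP[P Pu /(diagonalizable_forLR Pu)[d Ad]] :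
    exists2 rs, uniq rs & mxminpoly A %| \prod_(x <- rs) ('X - x%:P).
  (* All N-th roots of unity: X^N - 1 annihilates [A] and splits into distinct linear factors. *)
  exists [seq z ^+ i | i <- index_iota 0 N].
    rewrite map_inj_in_uniq ?iota_uniq // => i j; rewrite !mem_index_iota => /= iN jN.
    by move/eqP; rewrite (eq_prim_root_expr prim_z) !modn_small // => /eqP.
  rewrite big_map big_mkord; have := factor_Xn_sub_1 prim_z.
  rewrite big_mkord => ->; apply: mxminpoly_min.
  by rewrite rmorphB rmorphXn rmorph1 /= horner_mx_X AN subrr.
rewrite mxpoly.conjVmx // in Ad.
have PA : P *m A = diag_mx d *m P by rewrite Ad !mulmxA mulmxV // mul1mx.
have PAk k : P *m A ^+ k = diag_mx d ^+ k *m P.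
  elim: k => [|k IHk]; first by rewrite !expr0 mulmx1 mul1mx.
  by rewrite exprSr -mulmxE mulmxA IHk -mulmxA PA mulmxA mulmxE -exprSr.
exists P => //; exists d => // i.
have : diag_mx d ^+ N = 1.
  by apply: (can_inj (mulmxK Pu)); rewrite -PAk AN mulmx1 mul1mx.
have -> : diag_mx d ^+ N = diag_mx (\row_j d 0 j ^+ N).
  elim: {AN PAk prim_z} N => [|k IHk].
    by apply/matrixP => a b; rewrite !mxE expr0.
  rewrite exprS IHk -mulmxE mulmx_diag; congr diag_mx.
  by apply/rowP => j; rewrite !mxE exprS.
by move/matrixP/(_ i i); rewrite !mxE eqxx.
Qed.

Section DiagTraces.
Variables (F : fieldType) (n : nat) (P A : 'M[F]_n) (d : 'rV[F]_n).
Hypotheses (Pu : P \in unitmx) (PA : P *m A = diag_mx d *m P).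

Lemma conj_diagX k : P *m A ^+ k = diag_mx (\row_j d 0 j ^+ k) *m P.
Proof.
elim: k => [|k IHk].
  rewrite expr0 mulmx1 (_ : diag_mx _ = 1%:M) ?mul1mx //.
  by apply/matrixP => a b; rewrite !mxE expr0.
rewrite exprSr -mulmxE mulmxA IHk -mulmxA PA mulmxA mulmx_diag; congr (diag_mx _ *m _).
by apply/rowP => j; rewrite !mxE exprSr.
Qed.

Lemma mxtrace_conj_diagX k : \tr (A ^+ k) = \sum_i d 0 i ^+ k.
Proof.
have -> : A ^+ k = invmx P *m (diag_mx (\row_j d 0 j ^+ k) *m P).
  by rewrite -conj_diagX mulKmx.
rewrite mxtrace_mulC -mulmxA mulmxV // mulmx1 mxtrace_diag.
by apply: eq_bigr => i _; rewrite mxE.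
Qed.

Lemma mxrank_sim (B D : 'M[F]_n) : P *m B = D *m P -> \rank B = \rank D.
Proof.
move=> PB; have -> : B = invmx P *m (D *m P) by rewrite -PB mulKmx.
have iPfull : row_full (invmx P) by rewrite row_full_unit unitmx_inv.
by rewrite (eqmxMfull _ iPfull) mxrankMfree ?row_free_unit.
Qed.

End DiagTraces.

Lemma mxrank_diag_le (F : fieldType) n (d : 'rV[F]_n) :
  (\rank (diag_mx d) <= #|[pred i | d 0%R i != 0%R]|)%N.
Proof.
set S := [pred i | d 0 i != 0].
suff -> : diag_mx d = (\matrix_(i < n, j < #|S|) (i == enum_val j)%:R)
    *m (\matrix_(j < #|S|, i < n) (d 0 i *+ (i == enum_val j))) by exact: mulmx_max_rank.
apply/matrixP => a b; rewrite !mxE.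
have [Sb|nSb] := boolP (b \in S); last first.
  have db0 : d 0 b = 0 by apply/eqP; rewrite inE negbK in nSb.
  rewrite big1 => [|j _]; first by case: eqP => // ->; rewrite db0.
  rewrite !mxE; case: (eqVneq b (enum_val j)) => [Eb|]; last by rewrite mulr0n mulr0.
  by rewrite Eb enum_valP in nSb.
rewrite (bigD1 (enum_rank_in Sb b)) //= !mxE enum_rankK_in // eqxx.
rewrite big1 => [|j nj]; first by rewrite addr0 mulr1n mulr_natl; case: eqP => // ->.
rewrite !mxE; case: (eqVneq b (enum_val j)) => [Eb|]; last by rewrite mulr0n mulr0.
by case/eqP: nj; apply: enum_val_inj; rewrite enum_rankK_in // -Eb.
Qed.

Lemma mxrank_mxsub (F : fieldType) m n k l (f : 'I_k -> 'I_m) (g : 'I_l -> 'I_n)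
  (B : 'M[F]_(m, n)) : (\rank (mxsub f g B) <= \rank B)%N.
Proof.
rewrite (_ : mxsub f g B = rowsub f (colsub g B)); last by apply/matrixP => i j; rewrite !mxE.
apply: leq_trans (mxrankS (rowsub_sub _ _)) _.
rewrite -mxrank_tr -[X in (_ <= X)%N]mxrank_tr.
rewrite (_ : (colsub g B)^T = rowsub g B^T); last by apply/matrixP => i j; rewrite !mxE.
exact: mxrankS (rowsub_sub _ _).
Qed.

Lemma mxsub_rank_unit (F : fieldType) m n (B : 'M[F]_(m, n)) :
  exists f g, mxsub f g B \in @unitmx F (\rank B).
Proof.
set f := maxrankfun B; have rf : row_free (rowsub f B) by apply: maxrowsub_free.
have rf' : row_full (rowsub f B)^T by rewrite /row_full mxrank_tr.
exists f, (fullrankfun rf'); have := fullrowsub_unit rf'.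
rewrite -unitmx_tr; congr (_ \in unitmx).
by apply/matrixP => i j; rewrite !mxE.
Qed.

(** A maximal minor that is invertible modulo r is a nonzero integer, hence also invertible in
    characteristic 0. *)
Lemma mxrank_intr_Fp r m n (B : 'M[int]_(m, n)) (F : numFieldType) :
  (\rank (map_mx (intr : int -> 'F_r) B) <= \rank (map_mx (intr : int -> F) B))%N.
Proof.
have [f [g]] := mxsub_rank_unit (map_mx (intr : int -> 'F_r) B).
rewrite -map_mxsub unitmxE det_map_mx unitfE => nz.
have : mxsub f g (map_mx (intr : int -> F) B) \in unitmx.
  rewrite -map_mxsub unitmxE det_map_mx unitfE intr_eq0.
  by apply: contraNneq nz => ->.
by rewrite -row_free_unit => /eqP {1}<-; apply: mxrank_mxsub.
Qed.

(** * Traces of integral matrices of prime power order *)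

Lemma convex_interpolation (a : nat -> int) m i j k :
  (forall l, (l.+2 <= m)%N -> a l.+1 *+ 2 <= a l + a l.+2) ->
  (i <= j <= k)%N -> (k <= m)%N ->
  a j * (k - i)%N%:Z <= a i * (k - j)%N%:Z + a k * (j - i)%N%:Z.
Proof.
move=> cvx /andP[leij lejk] lekm.
(* Convexity makes the decrements nonincreasing, so their averages over [i, j) and [j, k) compare
   through [D j]. *)
pose D l := a l - a l.+1.
have Dmono l l' : (l <= l')%N -> (l'.+1 <= m)%N -> D l' <= D l.
  move=> /subnKC <-; elim: (l' - l)%N => [|t IHt]; first by rewrite addn0.
  rewrite addnS => lem; apply: le_trans (IHt (ltnW lem)).
  by have := cvx _ lem; rewrite /D; lia.
have tele l l' : (l <= l')%N -> a l - a l' = \sum_(l <= t < l') D t.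
  by move=> le; rewrite -opprB -(telescope_sumr _ le) -sumrN; apply: eq_bigr => t _; rewrite opprB.
have [ltjk|] := ltnP j k; last by move=> lekj; have -> : k = j; [lia|]; lia.
have H1 : D j *+ (j - i) <= a i - a j.
  rewrite tele // -sumr_const_nat; apply: ler_sum_nat => t /andP[_ tj].
  by apply: Dmono; lia.
have H2 : a j - a k <= D j *+ (k - j).
  rewrite tele // -sumr_const_nat; apply: ler_sum_nat => t /andP[jt tk].
  by apply: Dmono; lia.
have -> : (k - i)%N = ((k - j) + (j - i))%N by lia.
rewrite -mulr_natr natz in H1; rewrite -mulr_natr natz in H2; rewrite PoszD.
have: 0 <= (k - j)%N%:Z by []; have: 0 <= (j - i)%N%:Z by [].
by move: H1 H2; set x := (k - j)%N%:Z; set y := (j - i)%N%:Z; nia.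
Qed.

(** Here [a1], [aq], [al] are the ranks of (A - 1)^i at i = 1, q, rq - 1, and [phi] is the
    multiplicity of the eigenvalue 1. The chords from 1 to rq and from 0 to rq - 1 turn the bound on
    [aq] into a1 >= n(rq - 1)/(rq) and al >= n/(rq), which squeezes [phi] from both sides. *)
Lemma convex_tight_arith n r q a1 aq al phi : (1 < r)%N -> (0 < q)%N ->
  (r.-1 * n <= r * aq)%N ->
  (aq * (r * q - 1) <= a1 * (r * q - q))%N ->
  (aq * (r * q - 1) <= n * (r * q - 1 - q) + al * q)%N ->
  (a1 <= n - phi)%N -> (al <= phi)%N -> (phi <= n)%N -> (r * q * phi)%N = n.
Proof.
case: r => [|[|s]] // _; case: q => [//|t] _ /=.
have -> : (s.+2 * t.+1 - 1 = s.+1 * t.+1 + t)%N by lia.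
have -> : (s.+2 * t.+1 - t.+1 = s.+1 * t.+1)%N by lia.
have -> : (s.+1 * t.+1 + t - t.+1 = s * t.+1 + t)%N by lia.
move=> Haq H1 H2 Ha1 Hal Hphi.
have le1 : (n * (s.+1 * t.+1 + t) <= s.+2 * t.+1 * a1)%N.
  rewrite -(leq_pmul2l (ltn0Sn s)).
  have := leq_mul Haq (leqnn (s.+1 * t.+1 + t)).
  have := leq_mul (leqnn s.+2) H1; rewrite !mulnA => K1 K2.
  have := leq_trans K2 K1; congr (_ <= _)%N; ring.
have le2 : (n <= s.+2 * t.+1 * al)%N.
  have := leq_mul Haq (leqnn (s.+1 * t.+1 + t)).
  have := leq_mul (leqnn s.+2) H2; rewrite !mulnA => K1 K2.
  have := leq_trans K2 K1.
  have -> : (s.+1 * n * (s.+1 * t.+1 + t) = n * (s.+2 * (s * t.+1 + t)) + n)%N by ring.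
  have -> : (s.+2 * (n * (s * t.+1 + t) + al * t.+1) =
             n * (s.+2 * (s * t.+1 + t)) + s.+2 * t.+1 * al)%N by ring.
  by rewrite leq_add2l.
apply/eqP; rewrite eqn_leq (leq_trans le2) ?leq_mul // andbT.
have := leq_trans le1 (leq_mul (leqnn _) Ha1).
have -> : (s.+2 * t.+1 * (n - phi) = s.+2 * t.+1 * n - s.+2 * t.+1 * phi)%N by rewrite mulnBr.
have -> : (n * (s.+1 * t.+1 + t) = s.+2 * t.+1 * n - n)%N.
  have -> : (s.+2 * t.+1 * n = n * (s.+1 * t.+1 + t) + n)%N by ring.
  by rewrite addnK.
have : (s.+2 * t.+1 * phi <= s.+2 * t.+1 * n)%N by rewrite leq_mul.
have : (n <= s.+2 * t.+1 * n)%N by rewrite leq_pmull.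
lia.
Qed.

Section TraceOfPowers.
Variables (n r l : nat) (A : 'M[int]_n).
Hypotheses (r_pr : prime r) (AQ : A ^+ (r ^ l.+1) = 1).
Let Q := (r ^ l.+1)%N.
Let Ar : 'M['F_r]_n := map_mx intr A.
Hypothesis rkA : (r.-1 * n <= r * \rank (Ar ^+ (r ^ l) - 1)%R)%N.

Let rk i := \rank ((Ar - 1) ^+ i).

Lemma subr1X_pchar m : (Ar - 1) ^+ (r ^ m) = Ar ^+ (r ^ m) - 1.
Proof.
case: (n) Ar => [|k] B; first by rewrite !thinmx0.
have E : ('X - 1 : {poly 'F_r}) ^+ (r ^ m) = 'X ^+ (r ^ m) - 1.
  have ch : [pchar {poly 'F_r}].-nat (r ^ m)%N.
    rewrite pnatX; apply/orP; left; rewrite pnatE // pchar_poly.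
    exact: pchar_Fp.
  by rewrite exprDn_pchar // exprNn_pchar // expr1n.
have := congr1 (horner_mx B) E.
by rewrite rmorphXn !rmorphB !rmorphXn !rmorph1 /= horner_mx_X.
Qed.

(** In characteristic r, X^Q - 1 = (X - 1)^Q; cancelling X - 1 turns the geometric sum into a
    power. *)
Lemma sum_powers_pchar : \sum_(t < Q) Ar ^+ t = (Ar - 1) ^+ Q.-1.
Proof.
case: (n) Ar => [|k] B; first by rewrite !thinmx0.
have Q_gt0 : (0 < Q)%N by rewrite expn_gt0 prime_gt0.
have E : \sum_(t < Q) 'X ^+ t = ('X - 1 : {poly 'F_r}) ^+ Q.-1.
  have nz : ('X - 1 : {poly 'F_r}) != 0 by rewrite polyXsubC_eq0.
  apply: (mulfI nz); rewrite -subrX1 -exprS prednK //.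
  have ch : [pchar {poly 'F_r}].-nat Q.
    rewrite pnatX; apply/orP; left; rewrite pnatE // pchar_poly.
    exact: pchar_Fp.
  by rewrite exprDn_pchar // exprNn_pchar // expr1n.
have := congr1 (horner_mx B) E.
rewrite rmorph_sum rmorphXn rmorphB rmorph1 /= horner_mx_X => <-.
by apply: eq_bigr => i _; rewrite rmorphXn /= horner_mx_X.
Qed.

(** The Frobenius rank inequality for the product (A - 1)(A - 1)^i(A - 1). *)
Lemma rk_convex i : (rk i.+1).*2%:Z <= rk i + rk i.+2.
Proof.
have := mxrank_Frobenius (Ar - 1) ((Ar - 1) ^+ i) (Ar - 1).
by rewrite !mulmxE -exprS -!exprSr -/(rk _) -/(rk _) -/(rk _); lia.
Qed.

(* The rank of (A - 1)^i modulo r is convex in i, so its value at r^l bounds the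
   values at 1 and r^l.+1 - 1, which control the multiplicity of the eigenvalue
   1 of A from both sides. *)
Lemma sum_trace_powers : \sum_(t < Q) \tr (A ^+ t) = n%:Z.
Proof.
have r_gt1 := prime_gt1 r_pr.
have Q_gt0 : (0 < Q)%N by rewrite expn_gt0 ltnW.
have AQr : Ar ^+ Q = 1 by rewrite -rmorphXn /= AQ map_mx1.
have rk0 : rk 0 = n by rewrite /rk expr0 mxrank1.
have rkQ : rk Q = 0%N by rewrite /rk subr1X_pchar AQr subrr mxrank0.
have cvx m : forall l0, (l0.+2 <= m)%N -> (rk l0.+1)%:Z *+ 2 <= (rk l0)%:Z + (rk l0.+2)%:Z.
  by move=> l0 _; have := rk_convex l0; lia.
have rkq : (r.-1 * n <= r * rk (r ^ l))%N by rewrite /rk subr1X_pchar.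
pose q := (r ^ l)%N; have Eq : Q = (r * q)%N by rewrite /Q expnS.
have q_gt0 : (0 < q)%N by rewrite expn_gt0 ltnW.
have leqQ : (q < Q)%N by rewrite /Q ltn_exp2l.
have := @convex_interpolation (fun i => (rk i)%:Z) Q 1 q Q (cvx Q).
rewrite q_gt0 (ltnW leqQ) leqnn => /(_ isT isT) /=.
rewrite rkQ mul0r addr0 -!PoszM lez_nat Eq => H1.
have := @convex_interpolation (fun i => (rk i)%:Z) Q 0 q (Q - 1) (cvx Q).
rewrite leq_subr leq_subRL // add1n leqQ => /(_ isT isT) /=.
rewrite rk0 !subn0 -!PoszM -PoszD lez_nat Eq => H2.
have [z prim_z] := C_prim_root_exists Q_gt0.
pose Ac : 'M[algC]_n := map_mx intr A.
have AcQ : Ac ^+ Q = 1 by rewrite -rmorphXn /= AQ map_mx1.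
have [P Pu [d PA dQ]] := finite_order_diag prim_z AcQ.
have tr_t t : (\tr (A ^+ t))%:~R = \sum_i d 0 i ^+ t :> algC.
  by rewrite -(mxtrace_conj_diagX Pu PA) -rmorphXn /= trace_map_mx.
have sum_d i : \sum_(t < Q) d 0 i ^+ t = Q%:R *+ (d 0 i == 1).
  have := subrX1 (d 0 i) Q; rewrite dQ subrr.
  have [->|nd1] := eqVneq (d 0 i) 1.
    by move=> _; rewrite (eq_bigr (fun=> 1)) ?sumr_const ?card_ord // => t _; rewrite expr1n.
  by move/esym/eqP; rewrite mulf_eq0 subr_eq0 (negbTE nd1) /= => /eqP.
pose phi := #|[pred i | d 0 i == 1]|.
(* Rank can only drop modulo r, and A - 1 has rank n - phi in characteristic 0. *)
have le3 : (rk 1 <= n - phi)%N.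
  apply: leq_trans (_ : \rank (Ac - 1)%R <= _)%N.
    have := mxrank_intr_Fp r (A - 1) algC; rewrite /rk expr1.
    by rewrite !raddfB /= !map_mx1.
  have -> : \rank (Ac - 1) = \rank (diag_mx (\row_i (d 0 i - 1))).
    apply: (mxrank_sim Pu); rewrite mulmxBr mulmx1 PA.
    rewrite (_ : diag_mx (\row_i _) = diag_mx d - 1) ?mulmxBl ?mul1mx //.
    by apply/matrixP => i j; rewrite !mxE; case: eqP; rewrite ?subr0.
  apply: leq_trans (mxrank_diag_le _) _.
  rewrite -[n in (n - _)%N]card_ord -(cardC [pred i | d 0 i == 1]) addKn.
  by apply: subset_leq_card; apply/subsetP => i; rewrite !inE mxE subr_eq0.
(* The sum of the powers of A is Q times the projection onto the eigenvalue 1, of rank phi; modulo r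
   it is (A - 1)^(Q-1). *)
have le4 : (rk Q.-1 <= phi)%N.
  apply: leq_trans (_ : \rank (\sum_(t < Q) Ac ^+ t)%R <= _)%N.
    have := mxrank_intr_Fp r (\sum_(t < Q) A ^+ t) algC.
    rewrite /rk -sum_powers_pchar !raddf_sum /=.
    by congr (_ <= _)%N; congr (\rank _); apply: eq_bigr => t _; rewrite rmorphXn.
  rewrite (_ : \rank _ = \rank (diag_mx (\row_i (\sum_(t < Q) d 0 i ^+ t)))); last first.
    apply: (mxrank_sim Pu); rewrite mulmx_sumr.
    under eq_bigr do rewrite (conj_diagX PA).
    rewrite -mulmx_suml; congr (_ *m _); apply/matrixP => i j.
    rewrite summxE !mxE; have [<-|/negbTE neij] := eqVneq i j; last first.
      by rewrite big1 // => t _; rewrite !mxE neij.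
    by rewrite mulr1n; apply: eq_bigr => t _; rewrite !mxE eqxx.
  apply: leq_trans (mxrank_diag_le _) _.
  apply: subset_leq_card; apply/subsetP => i; rewrite !inE mxE sum_d.
  by case: (d 0 i == 1) => //=; rewrite eqxx.
have lephi : (phi <= n)%N by rewrite -[n]card_ord; apply: max_card.
have Qphi : (Q * phi)%N = n.
  rewrite Eq; apply: (convex_tight_arith r_gt1 q_gt0 rkq H1 H2 le3) => //.
  by rewrite -Eq subn1.
apply: (@intr_inj algC); rewrite rmorph_sum /=.
under eq_bigr do rewrite tr_t.
rewrite exchange_big /= -Eq (eq_bigr _ (fun i _ => sum_d i)).
rewrite -[n in RHS]Qphi -pmulrn natrM mulr_natr.
by rewrite -sumr_const [RHS]big_mkcond /=; apply: eq_bigr => i _; rewrite inE; case: eqP.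
Qed.

End TraceOfPowers.

Lemma sum_split_multiples (V : nmodType) r m (G : nat -> V) : (0 < r)%N ->
  \sum_(t < r * m) G t = \sum_(t < m) G (r * t)%N + \sum_(t < r * m | ~~ (r %| t)%N) G t.
Proof.
move=> r_gt0; rewrite (bigID (fun t : 'I__ => r %| t)%N) /=; congr (_ + _).
have ltr (t : 'I_m) : (r * t < r * m)%N by rewrite ltn_pmul2l.
have ltd (t : 'I_(r * m)) : (t %/ r < m)%N by rewrite ltn_divLR // [X in (_ < X)%N]mulnC.
rewrite (reindex_onto (fun t => Ordinal (ltr t)) (fun t => Ordinal (ltd t))) /=.
  apply: eq_bigl => t; rewrite dvdn_mulr //=.
  by apply/eqP/val_inj; rewrite /= mulKn.
by move=> t rt; apply: val_inj; rewrite /= mulnC divnK.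
Qed.

(** A Galois automorphism raising Q-th roots of unity to the power t sends the trace of A to that of
    A^t, and fixes integers. *)
Lemma mxtrace_int_coprime_power n Q t (A : 'M[int]_n) :
  (0 < Q)%N -> A ^+ Q = 1 -> coprime t Q -> \tr (A ^+ t) = \tr A.
Proof.
move=> Q_gt0 AQ cop; have [z prim_z] := C_prim_root_exists Q_gt0.
pose Ac : 'M[algC]_n := map_mx intr A.
have AcQ : Ac ^+ Q = 1 by rewrite -rmorphXn /= AQ map_mx1.
have [P Pu [d PA dQ]] := finite_order_diag prim_z AcQ.
have tr_t k : (\tr (A ^+ k))%:~R = \sum_i d 0 i ^+ k :> algC.
  by rewrite -(mxtrace_conj_diagX Pu PA) -rmorphXn /= trace_map_mx.
have [s sP] := Qn_aut_exists cop.
apply: (@intr_inj algC); rewrite -[A in RHS]expr1 tr_t -[RHS](rmorph_int s) tr_t rmorph_sum.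
by apply: eq_bigr => i _; rewrite expr1 sP.
Qed.

(** * Matrices of the two-sided action on the group ring *)

Section RegularMatrices.
Variables (R : comNzRingType) (gT : finGroupType).
Implicit Types (u v w : group_ring R gT) (g h k : gT).

Definition gr_vec w : 'rV[R]_#|gT| := \row_a coeff w (enum_val a).

(* The matrix, acting on row vectors, of w |-> u w h. *)
Definition act_mx u h : 'M[R]_#|gT| :=
  \matrix_(a, b) coeff u (enum_val b * h^-1 * (enum_val a)^-1)%g.

Lemma gr_vec_inj : injective gr_vec.
Proof.
move=> u v /rowP E; apply: gr_ext => g.
by have := E (enum_rank g); rewrite !mxE enum_rankK.
Qed.

Lemma gr_vec_act u h w : gr_vec w *m act_mx u h = gr_vec (u * w * gr_elt h).
Proof.
apply/rowP => b; rewrite !mxE coeffM_eltr coeffM.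
rewrite (reindex_inj (inj_comp (mulgI (enum_val b * h^-1)%g) invg_inj)) /=.
rewrite (reindex (@enum_val gT predT)) /=; last first.
  by exists enum_rank => x _; rewrite ?enum_rankK ?enum_valK.
by apply: eq_bigr => a _; rewrite !mxE mulrC invMg invgK mulgKV.
Qed.

Lemma gr_vec_elt a : gr_vec (gr_elt (enum_val a)) = delta_mx 0 a.
Proof.
apply/rowP => b; rewrite !mxE coeff_elt eqxx /=.
by rewrite (inj_eq enum_val_inj).
Qed.

Lemma act_mxM u h v k : act_mx u h *m act_mx v k = act_mx (v * u) (h * k).
Proof.
apply/row_matrixP => a.
rewrite row_mul !rowE -gr_vec_elt !gr_vec_act gr_eltM.
by rewrite !mulrA.
Qed.

Lemma act_mx1 : act_mx 1 1%g = 1%:M.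
Proof.
apply/row_matrixP => a; rewrite !rowE -gr_vec_elt gr_vec_act mulmx1.
by rewrite mul1r gr_elt1 mulr1.
Qed.

Lemma act_mxX u h m : act_mx u h ^+ m = act_mx (u ^+ m) (h ^+ m)%g.
Proof.
elim: m => [|m IHm]; first by rewrite !expr0 expg0 act_mx1.
by rewrite exprSr -mulmxE IHm act_mxM -exprS expgSr.
Qed.

Lemma mxtrace_act u h : \tr (act_mx u h) = \sum_g coeff u (h^-1 ^ g)%g.
Proof.
rewrite (reindex_inj invg_inj) (reindex (@enum_val gT predT)) /=; last first.
  by exists enum_rank => x _; rewrite ?enum_rankK ?enum_valK.
by apply: eq_bigr => a _; rewrite !mxE conjgE invgK mulgA.
Qed.

End RegularMatrices.

(** A vector fixed by right translation by h is constant on the left cosets of the group generated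
    by h, so the fixed space has dimension at most |G| divided by the order of h, over any field. *)
Lemma rank_translation (gT : finGroupType) (F : fieldType) (h : gT) :
  ((#[h]%g).-1 * #|gT| <= #[h]%g * \rank (act_mx (1 : group_ring F gT) h - 1)%R)%N.
Proof.
set C := act_mx 1 h - 1; pose H := <[h]>%G.
pose S := lcosets H [set: gT].
have oS : (#|S| * #[h]%g = #|gT|)%N.
  by rewrite mulnC /S card_lcosets -cardsT Lagrange ?subsetT.
have in_ker (v : 'rV[F]_#|gT|) a b : v *m C = 0 ->
    enum_val b \in (enum_val a *: H)%g -> v 0 a = v 0 b.
  move=> vC /lcosetP[_ /cycleP[i ->]] Eb.
  have E1 c d : (enum_val d = enum_val c * h)%g -> v 0 c = v 0 d.
    move=> Ed; move: vC; rewrite mulmxBr mulmx1 => /eqP; rewrite subr_eq0 => /eqP/rowP/(_ d).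
    move=> <-; rewrite mxE (bigD1 c) //= mxE Ed mulgK mulgV coeff1 eqxx mulr1.
    rewrite big1 ?addr0 // => e nec; rewrite mxE Ed mulgK coeff1 -eq_mulgV1.
    by rewrite (inj_eq enum_val_inj) eq_sym (negbTE nec) mulr0.
  elim: i b Eb => [|i IHi] b Eb.
    by rewrite expg0 mulg1 in Eb; rewrite (enum_val_inj Eb).
  rewrite (IHi (enum_rank (enum_val a * h ^+ i)%g)) ?enum_rankK //.
  by apply: E1; rewrite enum_rankK -mulgA -expgSr.
have rk_ker : (\rank (kermx C) <= #|S|)%N.
  suff -> : kermx C = (\matrix_(i < #|gT|, j < #|S|) kermx C i (enum_rank (repr (enum_val j))))
      *m (\matrix_(j < #|S|, a < #|gT|) (enum_val a \in enum_val j)%:R) by exact: mulmx_max_rank.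
  apply/matrixP => i a; rewrite !mxE.
  have Sa : (enum_val a *: H)%g \in S by rewrite -lcosetE; apply: imset_f; rewrite inE.
  rewrite (bigD1 (enum_rank_in Sa (enum_val a *: H)%g)) //= !mxE enum_rankK_in //.
  rewrite lcoset_refl mulr1 [X in _ + X]big1 => [|j nj].
    rewrite addr0; have := @in_ker (row i (kermx C)) a (enum_rank (repr (enum_val a *: H)%g)).
    rewrite !mxE; apply; first by rewrite -row_mul mulmx_ker row0.
    by rewrite enum_rankK; apply: mem_repr (lcoset_refl _ _).
  rewrite !mxE; have [aj|] := boolP (enum_val a \in enum_val j); last by rewrite mulr0.
  case/negP: nj; rewrite -(inj_eq enum_val_inj) enum_rankK_in //.
  have /imsetP[x _ Ej] := enum_valP j; rewrite Ej lcosetE in aj *.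
  by rewrite eq_sym; apply/eqP/lcoset_eqP.
have := rk_ker; rewrite mxrank_ker leq_subLR => rk_le.
have ho := order_gt0 h.
have arith c m d k : (m * k = d -> 0 < k -> d <= c + m -> k.-1 * d <= k * c)%N.
  move=> <- k_gt0 lec; have := leq_mul (leqnn k) lec; rewrite mulnDr.
  have [j ->] : exists j, k = j.+1 by exists k.-1; rewrite prednK.
  by rewrite /= [(m * _)%N]mulnC [X in (X <= _)%N]mulSn addnC leq_add2r.
exact: arith oS ho rk_le.
Qed.

(** * Vanishing of partial augmentations *)

Section VanishingClassSums.
Variable gT : finGroupType.
Implicit Types (u : group_ring int gT) (g h : gT).

(* |C_G(g)| times the partial augmentation of u at g. *)
Definition class_coeff u g := \sum_h coeff u (g ^ h)%g.

Lemma class_coeffJ u g h : class_coeff u (g ^ h)%g = class_coeff u g.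
Proof.
rewrite /class_coeff [RHS](reindex_inj (mulgI h)).
by apply: eq_bigr => k _; rewrite conjgM.
Qed.

Lemma class_coeff_sum (V : zmodType) u (psi : gT -> V) :
  class_stable psi ->
  (\sum_g psi g *~ coeff u g) *+ #|gT| = \sum_g psi g *~ class_coeff u g.
Proof.
move=> psiJ; rewrite -cardsT -sumr_const.
under [RHS]eq_bigr do rewrite mulrz_sumr.
rewrite [RHS]exchange_big big_mkcond /=; apply: eq_bigr => h _; rewrite inE.
rewrite [LHS](reindex_inj (conjg_inj h)) /=.
by apply: eq_bigr => g _; rewrite psiJ.
Qed.

Lemma class_coeff_singular u n s g :
  prime s -> (0 < n)%N -> coprime s n -> u ^+ n = 1 -> (s %| #[g]%g)%N ->
  class_coeff u g = 0.
Proof.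
move=> s_pr n_gt0 cop un1 sg; pose psi x := x \in (g ^: [set: gT])%g.
have psiJ : class_stable psi.
  by move=> x h; rewrite /psi (class_sym [set: gT]%G (x ^ h)%g) classGidl ?inE // class_sym.
have psi_s x : psi x -> (s %| #[x]%g)%N by case/imsetP=> h _ ->; rewrite orderJ.
have S0 := class_sum_singular s_pr n_gt0 cop un1 psiJ psi_s.
have : class_coeff u g *+ #|psi| = 0.
  rewrite -sumr_const; transitivity (\sum_(x in psi) class_coeff u x).
    by apply: eq_bigr => x /imsetP[h _ ->]; rewrite class_coeffJ.
  rewrite exchange_big /= big1 // => h _.
  rewrite -[RHS]S0 [RHS](reindex_inj (conjg_inj h)) /=.
  by apply: eq_bigl => x; apply/esym/psiJ.
move/eqP; rewrite -mulr_natr mulf_eq0 pnatr_eq0 => /orP[/eqP//|].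
by rewrite (cardD1 g) [g \in psi](class_refl [set: gT]%G).
Qed.

(* Since u ^+ (r ^ k) = 1, the map w |-> u w g^-1 has a power which is a
   translation of order r, whose rank modulo r makes [sum_trace_powers] apply. *)
Lemma class_coeff_large u r k l g :
  prime r -> u ^+ (r ^ k) = 1 -> (k < l)%N -> #[g]%g = (r ^ l)%N -> class_coeff u g = 0.
Proof.
move=> r_pr un1; case: l => // l; rewrite ltnS => lekl og.
pose A := act_mx u g^-1%g.
have r_gt1 := prime_gt1 r_pr; have r_gt0 := prime_gt0 r_pr.
have upow m : (k <= m)%N -> u ^+ (r ^ m) = 1.
  by move=> /subnKC <-; rewrite expnD exprM un1 expr1n.
have gpow : (g ^+ (r ^ l.+1) = 1)%g by rewrite -og expg_order.
have AQ : A ^+ (r ^ l.+1) = 1.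
  by rewrite act_mxX upow ?leqW // expgVn gpow invg1 act_mx1.
have oh : #[(g^-1 ^+ (r ^ l))]%g = r.
  by rewrite expgVn orderV orderXdiv og ?dvdn_exp2l // expnS mulnK ?expn_gt0 ?r_gt0.
have rkA : (r.-1 * #|gT| <= r * \rank ((map_mx intr A : 'M['F_r]_#|gT|) ^+ (r ^ l) - 1)%R)%N.
  have := rank_translation 'F_r (g^-1 ^+ (r ^ l))%g; rewrite oh.
  congr (_ <= _ * \rank (_ - _)%R)%N; rewrite -rmorphXn /= act_mxX upow //.
  by apply/matrixP => a b; rewrite !mxE !coeff1 rmorph_nat.
have S0 := sum_trace_powers r_pr AQ rkA.
(* The exponents divisible by r: the powers of [A ^+ r] contain the same translation of order r, so
   the trace formula applies again, except for l = 0, where only the identity is summed. *)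
have S1 : \sum_(t < r ^ l) \tr (A ^+ (r * t)) = #|gT|%:Z.
  case: l => [|l'] in lekl og gpow AQ oh rkA S0 *.
    rewrite expn0 big_ord1 muln0 expr0 mxtrace1; by rewrite -[RHS]natz.
  have := @sum_trace_powers #|gT| r l' (A ^+ r) r_pr.
  rewrite -exprM -expnS => /(_ AQ); rewrite [map_mx _ _]rmorphXn /= -exprM -expnS => /(_ rkA) <-.
  by apply: eq_bigr => t _; rewrite -exprM.
(* Subtracting leaves the exponents prime to r, where every trace equals that of A. *)
have : \tr A *+ #|[pred t : 'I_(r * r ^ l) | ~~ (r %| t)%N]| = 0.
  rewrite -sumr_const; move: S0; rewrite [in X in X -> _]expnS (sum_split_multiples _ (fun t => \tr (A ^+ t))) // S1.
  move/eqP; rewrite -[X in _ == X]addr0 (inj_eq (addrI _)) => /eqP E.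
  rewrite -[RHS]E; apply: eq_bigr => t nrt; apply/esym.
  rewrite (mxtrace_int_coprime_power _ AQ) ?expn_gt0 ?r_gt0 //.
  by rewrite coprimeXr // coprime_sym prime_coprime.
move/eqP; rewrite -mulr_natr mulf_eq0 pnatr_eq0 => /orP[/eqP|].
  by rewrite mxtrace_act invgK.
have lt1 : (1 < r * r ^ l)%N by rewrite -expnS -{1}(expn0 r) ltn_exp2l.
by rewrite (cardD1 (Ordinal lt1)) inE /= dvdn1 neq_ltn r_gt1 orbT.
Qed.

Lemma class_coeff_vanish u r k g :
  prime r -> u ^+ (r ^ k) = 1 -> (g ^+ (r ^ k) != 1)%g -> class_coeff u g = 0.
Proof.
move=> r_pr un1 gn1; have rk_gt0 : (0 < r ^ k)%N by rewrite expn_gt0 prime_gt0.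
have [/p_natP[l og]|] := boolP (r.-nat #[g]%g).
  apply: (class_coeff_large r_pr un1 _ og); rewrite ltnNge; apply: contra gn1 => lelk.
  by rewrite -order_dvdn og dvdn_exp2l.
rewrite /pnat order_gt0 /= => /allPn[s]; rewrite mem_primes => /and3P[s_pr _ sg] sr.
apply: (class_coeff_singular s_pr rk_gt0 _ un1 sg).
rewrite prime_coprime // Euclid_dvdX // negb_and dvdn_prime2 //.
by rewrite inE /= in sr; rewrite sr.
Qed.

(** Averaging over conjugation writes the difference through [class_coeff], which vanishes off the
    r^k-torsion; the vanishing results enter most later sums in this form. *)
Lemma sum_class_fun_torsion u r k (psi : gT -> algC) :
  prime r -> u ^+ (r ^ k) = 1 -> class_stable psi ->
  \sum_g psi g *~ coeff u g = \sum_(g | (g ^+ (r ^ k) == 1)%g) psi g *~ coeff u g.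
Proof.
move=> r_pr un1 psiJ; pose psi' g := psi g *+ (g ^+ (r ^ k) != 1)%g.
have psiJ' : class_stable psi' by move=> g h; rewrite /psi' psiJ -conjXg conjg_eq1.
have := class_coeff_sum u psiJ'; rewrite [RHS]big1 => [|g _]; last first.
  rewrite /psi'; have [_|/(class_coeff_vanish r_pr un1)->] := eqVneq; last by rewrite mulr0z.
  by rewrite mulr0n mul0rz.
move/eqP; rewrite -mulr_natr mulf_eq0 pnatr_eq0 => /orP[/eqP S0|]; last first.
  by rewrite (cardD1 1%g).
rewrite (bigID (fun g => g ^+ (r ^ k) == 1)%g) /= -[RHS]addr0; congr (_ + _).
rewrite -[RHS]S0 big_mkcond; apply: eq_bigr => g _; rewrite /psi'.
by case: (_ != _); rewrite ?mulr1n // mulr0n mul0rz.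
Qed.

(** Left multiplication by u has |G| roots of unity as eigenvalues and trace |G| u_1. A nonzero
    integer u_1 makes this sum at least |G| in absolute value, so all eigenvalues coincide and u is
    a scalar, identified as 1 by its augmentation. *)
Lemma berman_higman u n :
  (0 < n)%N -> u ^+ n = 1 -> augmentation u = 1 -> coeff u 1%g != 0 -> u = 1.
Proof.
move=> n_gt0 un1 augu u1; pose A := act_mx u 1%g.
have An : A ^+ n = 1 by rewrite act_mxX un1 expg1n act_mx1.
have [z prim_z] := C_prim_root_exists n_gt0.
pose Ac : 'M[algC]_#|gT| := map_mx intr A.
have Acn : Ac ^+ n = 1 by rewrite -rmorphXn /= An map_mx1.
have [P Pu [d PA dn]] := finite_order_diag prim_z Acn.
have trA : \sum_i d 0 i = (coeff u 1%g *+ #|gT|)%:~R.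
  under eq_bigr do rewrite -[d 0 _]expr1.
  rewrite -(mxtrace_conj_diagX Pu PA) expr1 trace_map_mx mxtrace_act.
  by under eq_bigr do rewrite invg1 conj1g; rewrite sumr_const.
have d1 i : `|d 0 i| = 1.
  by apply/eqP; rewrite -(@pexpr_eq1 _ _ n) // -normrX dn normr1.
have : `|\sum_i d 0 i| = \sum_i `|d 0 i|.
  apply/eqP; rewrite eq_le ler_norm_sum /= (eq_bigr (fun=> 1)) => [|i _]; last exact: d1.
  rewrite sumr_const card_ord trA rmorphMn normrMn /= lerMn2r; apply/orP; right.
  rewrite -intr_norm -[1]/(1%:~R) ler_int.
  by rewrite -gtz0_ge1 normr_gt0.
case/normC_sum_eq => t t1 dt.
have Ac_t : Ac = t%:M.
  have dE : diag_mx d = t%:M.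
    by rewrite -diag_const_mx; congr diag_mx; apply/rowP => i; rewrite mxE dt // d1 mul1r.
  by rewrite -[Ac](mulKmx Pu) PA dE -scalar_mxC mulKmx.
have u0 g : g != 1%g -> coeff u g = 0.
  move=> g1; move/matrixP/(_ (enum_rank 1%g) (enum_rank g)): Ac_t.
  rewrite !mxE !enum_rankK !invg1 !mulg1 (inj_eq enum_rank_inj) eq_sym (negbTE g1) mulr0n.
  by move/eqP; rewrite intr_eq0 => /eqP.
apply: gr_ext => g; rewrite coeff1; have [->|/u0//] := eqVneq g 1%g.
by rewrite -augu /augmentation (bigD1 1%g) //= big1 ?addr0.
Qed.

End VanishingClassSums.

(** * Even functions on roots of unity *)

Lemma sum_root_powers (F : fieldType) m (w : F) : w ^+ m = 1 ->
  \sum_(s < m) w ^+ s = m%:R *+ (w == 1).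
Proof.
move=> wm; have := subrX1 w m; rewrite wm subrr.
have [->|nd1] := eqVneq w 1.
  by move=> _; rewrite (eq_bigr (fun=> 1)) ?sumr_const ?card_ord // => t _; rewrite expr1n.
by move/esym/eqP; rewrite mulf_eq0 subr_eq0 (negbTE nd1) /= => /eqP.
Qed.

(* The Ramanujan sum for the modulus r * m. *)
Lemma sum_coprime_powers (F : fieldType) r m (w : F) : (0 < r)%N -> w ^+ (r * m) = 1 ->
  \sum_(s < r * m | ~~ (r %| s)%N) w ^+ s = (r * m)%:R *+ (w == 1) - m%:R *+ (w ^+ r == 1).
Proof.
move=> r_gt0 wm; apply/eqP; rewrite eq_sym subr_eq addrC -sum_root_powers //.
rewrite (sum_split_multiples _ (fun s => w ^+ s)) //; apply/eqP; congr (_ + _).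
by rewrite -sum_root_powers -?exprM //; apply: eq_bigr => s _; rewrite exprM.
Qed.

Section RootsOfUnity.
Variables (n : nat) (zeta : algC).
Hypotheses (n_gt0 : (0 < n)%N) (prim_zeta : n.-primitive_root zeta).

Definition roots1 := [seq zeta ^+ i | i <- iota 0 n].
Local Notation mu := roots1.

Lemma roots1_uniq : uniq mu.
Proof.
rewrite map_inj_in_uniq ?iota_uniq // => i j; rewrite !mem_iota /= => iN jN.
by move/eqP; rewrite (eq_prim_root_expr prim_zeta) !modn_small // => /eqP.
Qed.

Lemma mem_roots1 z : (z \in mu) = (z ^+ n == 1).
Proof.
apply/mapP/eqP => [[i _ ->]|]; first by rewrite exprAC (prim_expr_order prim_zeta) expr1n.
by case/(prim_rootP prim_zeta) => i ->; exists (nat_of_ord i); rewrite // mem_iota /=.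
Qed.

Lemma roots1X z i : z \in mu -> z ^+ i \in mu.
Proof. by rewrite !mem_roots1 exprAC => /eqP->; rewrite expr1n. Qed.

Lemma roots1V z : (z^-1 \in mu) = (z \in mu).
Proof. by rewrite !mem_roots1 exprVn invr_eq1. Qed.

Lemma roots1_neq0 z : z \in mu -> z != 0.
Proof.
by rewrite mem_roots1; apply: contraTneq => ->; rewrite expr0n gtn_eqF // eq_sym oner_eq0.
Qed.

Lemma expr_mod_roots1 z i : z \in mu -> z ^+ (i %% n) = z ^+ i.
Proof. by rewrite mem_roots1 => /eqP zn; rewrite expr_mod. Qed.

Lemma sum_delta_roots1 (R : pzRingType) (F : algC -> R) c : c \in mu ->
  \sum_(z <- mu) (z == c)%:R * F z = F c.
Proof.
move=> c_mu; rewrite (bigD1_seq c) ?roots1_uniq //= eqxx mul1r big1 ?addr0 // => z.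
by move/negbTE->; rewrite mul0r.
Qed.

Lemma fourier_inversion (g : algC -> algC) y : y \in mu ->
  \sum_(i < n) (\sum_(z <- mu) g z * z ^+ i) * (y^-1) ^+ i = n%:R * g y.
Proof.
move=> y_mu; under eq_bigr do rewrite mulr_suml.
rewrite exchange_big /=.
rewrite (eq_big_seq (fun z => (z == y)%:R * (n%:R * g z))) => [|z z_mu].
  by rewrite sum_delta_roots1.
under eq_bigr do rewrite -mulrA -exprMn.
rewrite -mulr_sumr sum_root_powers; last first.
  move: z_mu y_mu; rewrite !mem_roots1 => /eqP zn /eqP yn.
  by rewrite exprMn exprVn zn yn invr1 mulr1.
have -> : (z / y == 1) = (z == y).
  by rewrite -(inj_eq (mulIf (roots1_neq0 y_mu))) divfK ?roots1_neq0 // mul1r.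
by case: eqP => _; rewrite ?mulr0n ?mulr0 ?mul0r // mul1r mulr1n mulrC.
Qed.

(** Identities between functions on [mu] are reduced below to equalities of power sums by this
    injectivity. *)
Lemma fourier_inj (g h : algC -> int) :
  (forall i, (i < n)%N -> \sum_(z <- mu) (g z)%:~R * z ^+ i = \sum_(z <- mu) (h z)%:~R * z ^+ i :> algC) ->
  {in mu, g =1 h}.
Proof.
move=> E y y_mu; apply: (@intr_inj algC).
have n0 : n%:R != 0 :> algC by rewrite pnatr_eq0 -lt0n.
apply: (mulfI n0); rewrite -(fourier_inversion (fun z => (g z)%:~R) y_mu).
rewrite -(fourier_inversion (fun z => (h z)%:~R) y_mu).
by apply: eq_bigr => i _; rewrite E.
Qed.

Lemma roots1X_inj s : coprime s n -> {in mu &, injective (fun z => z ^+ s)}.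
Proof.
move=> cop; have [t st] : exists t, (s * t = 1 %[mod n])%N.
  by exists (s ^ (totient n).-1)%N; rewrite -expnS prednK ?totient_gt0 // Euler_exp_totient.
move=> x y x_mu y_mu /= /(congr1 (fun z => z ^+ t)); rewrite -!exprM.
by rewrite -(expr_mod_roots1 _ x_mu) -(expr_mod_roots1 _ y_mu) st !expr_mod_roots1.
Qed.

Lemma perm_roots1X s : coprime s n -> perm_eq [seq z ^+ s | z <- mu] mu.
Proof.
move=> cop.
have Us : uniq [seq z ^+ s | z <- mu] by rewrite (map_inj_in_uniq (roots1X_inj cop)) roots1_uniq.
have sub : {subset [seq z ^+ s | z <- mu] <= mu} by move=> _ /mapP[z z_mu ->]; apply: roots1X.
apply: uniq_perm; rewrite ?roots1_uniq //.
by case: (uniq_min_size Us sub); rewrite ?size_map.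
Qed.

Lemma sum_roots1X (V : nmodType) (F : algC -> V) s : coprime s n ->
  \sum_(z <- mu) F (z ^+ s) = \sum_(z <- mu) F z.
Proof. by move=> cop; rewrite -[RHS](perm_big _ (perm_roots1X cop)) [RHS]big_map. Qed.

Lemma sum_roots1V (V : nmodType) (F : algC -> V) :
  \sum_(z <- mu) F z^-1 = \sum_(z <- mu) F z.
Proof.
rewrite -[RHS](@sum_roots1X _ _ n.-1); last by rewrite coprime_sym coprimenP.
apply: eq_big_seq => z; rewrite mem_roots1 => /eqP zn; congr F.
have zn' : z * z ^+ n.-1 = 1 by rewrite -exprS prednK.
have z0 : z != 0 by apply/eqP => z0; move/eqP: zn'; rewrite z0 mul0r eq_sym oner_eq0.
by apply: (mulfI z0); rewrite zn' divff.
Qed.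

(** An even integral function has a real transform, so squares stand for squared absolute values in
    the formula of Parseval. *)
Lemma parseval_even (g : algC -> int) : {in mu, forall z, g z^-1 = g z} ->
  \sum_(t < n) (\sum_(z <- mu) (g z)%:~R * z ^+ t) ^+ 2 =
  n%:R * (\sum_(z <- mu) g z ^+ 2)%:~R :> algC.
Proof.
move=> gV; rewrite rmorph_sum mulr_sumr.
transitivity (\sum_(t < n) \sum_(w <- mu) (g w)%:~R *
    ((\sum_(z <- mu) (g z)%:~R * z ^+ t) * w^-1 ^+ t) : algC).
  apply: eq_bigr => t _; rewrite expr2 -[X in _ * X]sum_roots1V mulr_sumr.
  by apply: eq_big_seq => w w_mu; rewrite gV // mulrCA.
rewrite exchange_big; apply: eq_big_seq => w w_mu /=.
by rewrite -mulr_sumr (fourier_inversion _ w_mu) rmorphXn /=; ring.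
Qed.

Lemma sum_count_roots1 (R : pzRingType) (F : algC -> R) (s : seq algC) :
  {subset s <= mu} -> \sum_(z <- s) F z = \sum_(z <- mu) (count_mem z s)%:R * F z.
Proof.
elim: s => [|x s IHs] sub; first by rewrite big_nil big1 // => z _; rewrite mul0r.
rewrite big_cons IHs => [|z zs]; last by apply: sub; rewrite inE zs orbT.
rewrite -[F x in LHS](sum_delta_roots1 F) ?sub ?mem_head // -big_split.
by apply: eq_bigr => z _; rewrite /= natrD mulrDl eq_sym.
Qed.

(** Apart from 1 the only self-inverse root is -1. A point of the support either shares the mass 2
    with its distinct inverse, or is -1 and carries all of it, since any other point would bring its
    inverse along and exceed 2. *)
Lemma even_two_mass (g : algC -> int) :
  {in mu, forall z, 0 <= g z} -> {in mu, forall z, g z^-1 = g z} ->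
  g 1 = 0 -> \sum_(z <- mu) g z = 2 ->
  exists2 c, c \in mu & c != 1 /\ {in mu, forall z, g z = (z == c)%:R + (z == c^-1)%:R}.
Proof.
move=> g0 gV g1 gs.
have mass c : c \in mu -> g c + \sum_(z <- mu | z != c) g z = 2.
  by move=> c_mu; rewrite -gs [RHS](bigD1_seq c) ?roots1_uniq.
have mass2 c c' : c \in mu -> c' \in mu -> c' != c ->
    g c + g c' + \sum_(z <- mu | (z != c) && (z != c')) g z = 2.
  move=> c_mu c'_mu nc; rewrite -(mass c c_mu) -addrA; congr (_ + _).
  rewrite -[RHS]big_filter [RHS](bigD1_seq c') ?filter_uniq ?roots1_uniq ?mem_filter ?nc //=.
  by rewrite big_filter_cond.
have rest0 (Q : pred algC) : 0 <= \sum_(z <- mu | Q z) g z.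
  by rewrite big_seq_cond sumr_ge0 // => z /andP[/g0].
have rest_eq0 (Q : pred algC) z : \sum_(z <- mu | Q z) g z = 0 -> z \in mu -> Q z -> g z = 0.
  move=> S0 z_mu Qz; move: S0; rewrite -big_filter (bigD1_seq z) ?filter_uniq ?roots1_uniq ?mem_filter ?Qz //=.
  rewrite big_filter_cond => S0; have := g0 z z_mu; have := rest0 (predI Q (fun x => x != z)).
  by move: S0; rewrite /=; set x := \sum_(_ <- _ | _) _; lia.
have pick_mass (Q : pred algC) : \sum_(z <- mu | Q z) g z != 0 ->
    exists c, [/\ c \in mu, Q c & 1 <= g c].
  move=> Sn0; have [/allP H|] := boolP (all (fun z => Q z ==> (g z == 0)) mu).
    case/eqP: Sn0; rewrite big_seq_cond big1 // => z /andP[z_mu Qz].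
    by have := H z z_mu; rewrite Qz => /eqP.
  case/allPn => c c_mu; rewrite negb_imply => /andP[Qc gc]; exists c; split=> //.
  by have := g0 c c_mu; move: gc; lia.
have [|c [c_mu _ gc]] := pick_mass predT; first by rewrite gs.
have c1 : c != 1 by apply: contraTneq gc => ->; rewrite g1.
exists c => //; split=> //.
have [cV|ncV] := eqVneq c^-1 c; last first.
  have := mass2 c c^-1 c_mu; rewrite roots1V gV // => /(_ c_mu ncV).
  set S := \sum_(_ <- _ | _) _ => ES z z_mu.
  have S0 : S = 0 by have := rest0 (fun z => (z != c) && (z != c^-1)); rewrite -/S; lia.
  have [->|nzc] := eqVneq z c; first by rewrite eq_sym (negbTE ncV) addr0; lia.
  have [->|nzcV] := eqVneq z c^-1; first by rewrite gV // add0r; lia.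
  by rewrite addr0 (rest_eq0 _ _ S0) // nzc nzcV.
move=> z z_mu; rewrite cV.
have sq1 x : x \in mu -> x^-1 = x -> x != 1 -> x = -1.
  move=> x_mu xV x1; have /eqP : x ^+ 2 = 1 by rewrite expr2 -{1}xV mulVf // roots1_neq0.
  by rewrite sqrf_eq1 (negbTE x1) => /eqP.
have other c' : c' \in mu -> c' != c -> g c' = 0.
  move=> c'_mu nc'; have [c'1|nc'1] := eqVneq c' 1; first by rewrite c'1.
  have nc'V : c'^-1 != c'.
    by apply: contraNneq nc' => /sq1-> //; rewrite (sq1 c).
  have nc'c : c'^-1 != c.
    by apply: contraNneq nc' => Ec; rewrite -Ec invrK in cV; rewrite -Ec -{1}cV.
  have := mass2 c' c'^-1 c'_mu; rewrite roots1V gV // => /(_ c'_mu nc'V).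
  have c_in : c \in [seq z <- mu | (z != c') && (z != c'^-1)].
    by rewrite mem_filter c_mu eq_sym nc' eq_sym nc'c.
  rewrite -big_filter (bigD1_seq c c_in) ?filter_uniq ?roots1_uniq //=.
  rewrite big_filter_cond => E; have := rest0 (fun z => (z != c') && (z != c'^-1) && (z != c)).
  have := g0 c' c'_mu; rewrite /=; move: E; set x := \sum_(_ <- _ | _) _; lia.
have [->|/other->//] := eqVneq z c.
have := mass c c_mu; rewrite big_seq_cond big1 => [|x /andP[x_mu /other->//]].
by rewrite addr0.
Qed.
End RootsOfUnity.

(** * Recovering the eigenvalue functions from the spectra *)

Section EigenvalueCombinatorics.
Variables (r k : nat) (zeta eta : algC).
Let n := (r ^ k.+1)%N.
Hypotheses (r_pr : prime r) (prim_zeta : n.-primitive_root zeta)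
  (prim_eta : (r ^ k)%N.-primitive_root eta).
Variables (f : nat -> algC -> int) (lam : nat -> seq algC).
Local Notation mu := (roots1 n zeta).

Definition pair_mass (c z : algC) : int := (z == c)%:R + (z == c^-1)%:R.
(** The trace of u^i on Sym^(2t) less that on Sym^(2t-2). It is the transform of [f i] at t and, by
    [sum_dmult], that of [dmult t] at i. *)
Let E i t : algC := \sum_(z <- mu) (f i z)%:~R * z ^+ t.

Hypotheses (fV : forall i, {in mu, forall z, f i z^-1 = f i z})
  (fsum : forall i, \sum_(z <- mu) f i z = 2)
  (f_at1 : forall i, ~~ (n %| i)%N -> f i 1 = 0)
  (fdiv : forall j, (j <= k)%N -> ((2 * r)%N %| (\sum_(z <- mu | z ^+ (r ^ j) == 1) f 1%N z)%R)%Z)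
  (f_eta : forall i, {in mu, f (r * i)%N =1 pair_mass (eta ^+ i)})
  (lam_mu : forall t, {subset lam t <= mu})
  (lamE : forall t i, \sum_(z <- lam t) z ^+ i = 1 + \sum_(1 <= s < t.+1) E i s).

Let r_gt1 : (1 < r)%N := prime_gt1 r_pr.
Let r_gt0 : (0 < r)%N := prime_gt0 r_pr.
Let n_gt0 : (0 < n)%N. Proof. by rewrite expn_gt0 r_gt0. Qed.
Let n_neq0 : n%:R != 0 :> algC. Proof. by rewrite pnatr_eq0 -lt0n. Qed.

Lemma sum_pair_mass (R : pzRingType) (F : algC -> R) c : c \in mu ->
  \sum_(z <- mu) (pair_mass c z)%:~R * F z = F c + F c^-1.
Proof.
move=> c_mu; have cV_mu : c^-1 \in mu by rewrite roots1V.
rewrite -(sum_delta_roots1 prim_zeta F c_mu) -(sum_delta_roots1 prim_zeta F cV_mu) -big_split.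
by apply: eq_bigr => z _; rewrite /pair_mass rmorphD /= mulrDl !rmorph_nat.
Qed.

(* [lam t] is to be the spectrum of u on the 2t-th symmetric power, which
   contains the one on the 2(t-1)-th; [dmult] counts the new eigenvalues. *)
Definition mult t z : int := (count_mem z (lam t))%:Z.
Definition dmult t z : int := mult t z - mult t.-1 z.

Lemma sum_mult t i : \sum_(z <- mu) (mult t z)%:~R * z ^+ i = \sum_(z <- lam t) z ^+ i.
Proof. by rewrite (sum_count_roots1 prim_zeta _ (@lam_mu t)). Qed.

Lemma sum_dmult t i : (0 < t)%N -> \sum_(z <- mu) (dmult t z)%:~R * z ^+ i = E i t.
Proof.
case: t => // t _; under eq_bigr do rewrite /dmult rmorphB mulrBl.
rewrite sumrB !sum_mult !lamE big_nat_recr //=.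
by rewrite addrA [_ + E _ _]addrC addrK.
Qed.

Lemma mult0 : {in mu, forall z, mult 0 z = (z == 1)%:R}.
Proof.
apply: (fourier_inj n_gt0 prim_zeta) => i _; rewrite sum_mult lamE big_geq // addr0.
have one_mu : 1 \in mu by rewrite (mem_roots1 prim_zeta) expr1n.
by rewrite -[LHS](expr1n _ i) -(sum_delta_roots1 prim_zeta (fun z => z ^+ i) one_mu);
   apply: eq_bigr => z _; rewrite rmorph_nat.
Qed.

Lemma aut_roots1 s : coprime s n ->
  exists sigma : {rmorphism algC -> algC}, {in mu, forall z, sigma z = z ^+ s}.
Proof.
move=> cop; have [sg sgP] := Qn_aut_exists cop; exists sg => z.
by rewrite (mem_roots1 prim_zeta) => /eqP/sgP.
Qed.

Lemma E_mod i t t' : t = t' %[mod n] -> E i t = E i t'.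
Proof.
move=> tt'; apply: eq_big_seq => z z_mu; congr (_ * _).
by rewrite -(expr_mod_roots1 prim_zeta t z_mu) tt' (expr_mod_roots1 prim_zeta).
Qed.

Lemma sum_aut sigma s (g : algC -> int) t :
  {in mu, forall z, (sigma : {rmorphism algC -> algC}) z = z ^+ s} ->
  sigma (\sum_(z <- mu) (g z)%:~R * z ^+ t) = \sum_(z <- mu) (g z)%:~R * z ^+ (s * t).
Proof.
move=> sP; rewrite rmorph_sum; apply: eq_big_seq => z z_mu.
by rewrite rmorphM rmorph_int rmorphXn /= sP // -exprM.
Qed.

(** An automorphism raising n-th roots of unity to the power s multiplies t by s in E i t, while on
    the spectral side it moves z to z^s. *)
Lemma dmult_push t s : (0 < t)%N -> (0 < s)%N -> coprime s n ->
  {in mu, forall z, dmult (t * s) (z ^+ s) = dmult t z}.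
Proof.
move=> t_gt0 s_gt0 cop; have [sg sgP] := aut_roots1 cop.
have ts_gt0 : (0 < t * s)%N by rewrite muln_gt0 t_gt0.
have [s' ss'] : exists s', (s * s' = 1 %[mod n])%N.
  by exists (s ^ (totient n).-1)%N; rewrite -expnS prednK ?totient_gt0 // Euler_exp_totient.
have expss' z i : z \in mu -> (z ^+ s) ^+ (s' * i) = z ^+ i.
  move=> z_mu; rewrite -exprM mulnA -(expr_mod_roots1 prim_zeta _ z_mu).
  by rewrite -modnMml ss' modnMml mul1n (expr_mod_roots1 prim_zeta).
have key : {in mu, dmult (t * s) =1 (fun y => dmult t (y ^+ s'))}.
  apply: (fourier_inj n_gt0 prim_zeta) => i _.
  rewrite sum_dmult // /E [(t * s)%N]mulnC -(sum_aut _ _ sgP) -/(E i t) -sum_dmult // (sum_aut _ _ sgP).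
  rewrite -[RHS](sum_roots1X n_gt0 prim_zeta _ cop); apply: eq_big_seq => z z_mu.
  by rewrite -[s']muln1 expss' // expr1 exprM.
move=> z z_mu; rewrite key ?(roots1X prim_zeta) //.
by rewrite -[s']muln1 expss' // expr1.
Qed.

Lemma dmult_mod t t' : (0 < t)%N -> (0 < t')%N -> t = t' %[mod n] ->
  {in mu, dmult t =1 dmult t'}.
Proof.
move=> t_gt0 t'_gt0 tt'; apply: (fourier_inj n_gt0 prim_zeta) => i _.
by rewrite !sum_dmult //; apply: E_mod.
Qed.

(** The same automorphism on the dual side. Its action on E i t goes through [dmult t], which asks
    for t > 0; at t = 0 the total mass [fsum] takes over. *)
Lemma f_push i s : coprime s n -> {in mu, forall z, f (i * s) (z ^+ s) = f i z}.
Proof.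
move=> cop; have [sg sgP] := aut_roots1 cop.
have [s' ss'] : exists s', (s * s' = 1 %[mod n])%N.
  by exists (s ^ (totient n).-1)%N; rewrite -expnS prednK ?totient_gt0 // Euler_exp_totient.
have expss' z j : z \in mu -> (z ^+ s) ^+ (s' * j) = z ^+ j.
  move=> z_mu; rewrite -exprM mulnA -(expr_mod_roots1 prim_zeta _ z_mu).
  by rewrite -modnMml ss' modnMml mul1n (expr_mod_roots1 prim_zeta).
have key : {in mu, f (i * s)%N =1 (fun y => f i (y ^+ s'))}.
  apply: (fourier_inj n_gt0 prim_zeta) => t _.
  rewrite -[RHS](sum_roots1X n_gt0 prim_zeta _ cop).
  transitivity (\sum_(z <- mu) (f i z)%:~R * z ^+ (s * t)); last first.
    apply: eq_big_seq => z z_mu.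
    by rewrite -[s']muln1 expss' // expr1 exprM.
  have [->|t_gt0] := posnP t.
    rewrite muln0; under eq_bigr do rewrite expr0 mulr1.
    under [RHS]eq_bigr do rewrite expr0 mulr1.
    by rewrite -!rmorph_sum /= !fsum.
  rewrite -(sum_aut _ _ sgP) -!/(E _ t) -!sum_dmult // (sum_aut _ _ sgP).
  by apply: eq_bigr => z _; rewrite mulnC.
move=> z z_mu; rewrite key ?(roots1X prim_zeta) //.
by rewrite -[s']muln1 expss' // expr1.
Qed.

(** The automorphism inverting n-th roots of unity fixes E i t because [f i] is even. *)
Lemma dmultV t : (0 < t)%N -> {in mu, forall z, dmult t z^-1 = dmult t z}.
Proof.
move=> t_gt0; have cop : coprime n.-1 n by rewrite coprime_sym coprimenP.
have pow z : z \in mu -> z ^+ n.-1 = z^-1.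
  move=> z_mu; have z0 := roots1_neq0 n_gt0 prim_zeta z_mu; apply: (mulfI z0).
  by move: z_mu; rewrite (mem_roots1 prim_zeta) => /eqP zn; rewrite -exprS prednK // zn divff.
have [sg sgP] := aut_roots1 cop.
apply: (fourier_inj n_gt0 prim_zeta) => i _.
rewrite sum_dmult // -(sum_roots1V n_gt0 prim_zeta).
transitivity (\sum_(z <- mu) (dmult t z)%:~R * z ^+ (n.-1 * i)).
  by apply: eq_big_seq => z z_mu; rewrite invrK exprM pow.
rewrite -(sum_aut _ _ sgP) sum_dmult // /E (sum_aut _ _ sgP) -[RHS](sum_roots1V n_gt0 prim_zeta).
by apply: eq_big_seq => z z_mu; rewrite fV // exprM pow.
Qed.

(** The push-forward of [dmult t] under z |-> z^r has the transform i |-> E (r i) t, which the known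
    functions [f (r * i)] evaluate to eta^(it) + eta^(-it). *)
Lemma sum_fiber_dmult t w : (0 < t)%N -> w \in mu ->
  \sum_(z <- mu | z ^+ r == w) dmult t z = pair_mass (eta ^+ t) w.
Proof.
move=> t_gt0; move: w; apply: (fourier_inj n_gt0 prim_zeta) => i _.
have eta_mu : eta \in mu.
  by rewrite (mem_roots1 prim_zeta) /n expnS mulnC exprM (prim_expr_order prim_eta) expr1n.
rewrite (sum_pair_mass (fun z => z ^+ i)) ?(roots1X prim_zeta) //.
transitivity (E (r * i) t).
  rewrite -sum_dmult //; under eq_bigr do rewrite big_mkcond rmorph_sum mulr_suml.
  rewrite exchange_big; apply: eq_big_seq => z z_mu /=.
  rewrite -[RHS]mulr1 exprM -(sum_delta_roots1 prim_zeta (fun w => (dmult t z)%:~R * w ^+ i) (roots1X prim_zeta r z_mu)).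
  by rewrite mulr1; apply: eq_bigr => w _; rewrite eq_sym; case: eqP; rewrite ?mul1r ?mul0r.
rewrite /E (eq_big_seq (fun z => (pair_mass (eta ^+ i) z)%:~R * z ^+ t)) => [|z z_mu].
  by rewrite (sum_pair_mass (fun z => z ^+ t)) ?(roots1X prim_zeta) // !exprVn -!exprM mulnC.
by rewrite f_eta.
Qed.

(** The model is c = b^(r^j) for the root b to be found, whose r-th power is [eta]. *)
Definition level_pair j c :=
  [/\ c \in mu, c != 1, c ^+ (r ^ (k.+1 - j)) = 1, c ^+ r = eta ^+ (r ^ j)
    & {in mu, dmult (r ^ j) =1 pair_mass c}].

Lemma eta_expr_eq1 i : (eta ^+ i == 1) = (r ^ k %| i)%N.
Proof. by rewrite (prim_order_dvd prim_eta). Qed.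

Lemma coprime_rn s : ~~ (r %| s)%N -> coprime s n.
Proof. by move=> rs; rewrite coprimeXr // coprime_sym prime_coprime. Qed.

Section Level.
Variable j : nat.
Hypothesis le_jk : (j <= k)%N.
Hypothesis IH : forall v, (v < j)%N -> exists c, level_pair v c.
Let m := (r ^ (k.+1 - j))%N.

Let rj_gt0 : (0 < r ^ j)%N. Proof. by rewrite expn_gt0 r_gt0. Qed.
Let mE : m = (r * r ^ (k - j))%N. Proof. by rewrite /m subSn // expnS. Qed.
Let nE : n = (r ^ j * m)%N. Proof. by rewrite /m -expnD subnKC // ltnW. Qed.

(** Write t = t' r^v with t' prime to r, so that v < j. The induction hypothesis puts [dmult t] on
    c^t' and its inverse, and (c^t')^m = eta^(t r^(k-j)) differs from 1 as 0 < t < r^j. *)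
Lemma dmult_lower t z : (0 < t < r ^ j)%N -> z \in mu -> z ^+ m = 1 -> dmult t z = 0.
Proof.
case/andP=> t_gt0 tj z_mu zm.
have [v [t' rt' Et]] : exists v, exists2 t', ~~ (r %| t')%N & t = (t' * r ^ v)%N.
  by have := pfactor_coprime r_pr t_gt0 => -[t' cop ->]; exists (logn r t), t' => //; rewrite -prime_coprime.
have t'_gt0 : (0 < t')%N by move: t_gt0; rewrite Et muln_gt0 => /andP[].
have ltvj : (v < j)%N.
  rewrite -(ltn_exp2l _ _ r_gt1); apply: leq_ltn_trans tj.
  by rewrite Et leq_pmull.
have [c [c_mu _ _ cr cM]] := IH ltvj.
have cop := coprime_rn rt'.
have [y y_mu Ez] : exists2 y, y \in mu & z = y ^+ t'.
  by have := z_mu; rewrite -(perm_mem (perm_roots1X n_gt0 prim_zeta cop)) => /mapP[y]; exists y.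
rewrite Et mulnC Ez dmult_push ?expn_gt0 ?r_gt0 // cM // /pair_mass.
have cne : (c ^+ t') ^+ m != 1.
  rewrite mE -exprM mulnCA exprM cr -exprM eta_expr_eq1.
  have -> : (r ^ v * (t' * r ^ (k - j)) = t * r ^ (k - j))%N by rewrite Et; ring.
  have {1}-> : (r ^ k = r ^ j * r ^ (k - j))%N by rewrite -expnD subnKC.
  rewrite dvdn_pmul2r ?expn_gt0 ?r_gt0 //.
  by apply: contraL tj => /(dvdn_leq t_gt0); rewrite leqNgt.
have [yc|_] := eqVneq y c; first by move: cne; rewrite -yc -Ez zm eqxx.
have [yc|_] := eqVneq y c^-1; last by rewrite addr0.
by move: cne; rewrite -[c]invrK -yc exprVn exprVn -Ez zm invr1 eqxx.
Qed.

(** On m-th roots of unity nothing is added below level r^j, so the spectrum there is still that of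
    the trivial representation. *)
Lemma mult_lower z : z \in mu -> z ^+ m = 1 -> mult (r ^ j).-1 z = (z == 1)%:R.
Proof.
move=> z_mu zm; rewrite -mult0 //.
have : ((r ^ j).-1 < r ^ j)%N by rewrite prednK.
elim: (_.-1) => // t IHt ltt.
have := dmult_lower (t := t.+1) (z := z); rewrite ltt => /(_ isT z_mu zm).
by rewrite /dmult /= => /eqP; rewrite subr_eq0 => /eqP->; apply/IHt/ltnW.
Qed.

(* Off the m-th roots of unity [dmult] is constant on the fibers of z |-> z ^+ r,
   whose sums vanish. *)
Lemma dmult_support z : z \in mu -> z ^+ m != 1 -> dmult (r ^ j) z = 0.
Proof.
move=> z_mu zm.
have zn : z ^+ n = 1 by apply/eqP; rewrite -(mem_roots1 prim_zeta).
(* Points of one fiber differ by an r-th root of unity, a power of z^m, so y = z^(1 + m a). As r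
   divides m this exponent is prime to n, and r^j (1 + m a) is r^j modulo n, so [dmult_push] does
   not change the level. *)
have inv y : y \in mu -> y ^+ r = z ^+ r -> dmult (r ^ j) y = dmult (r ^ j) z.
  move=> y_mu yr; have z0 := roots1_neq0 n_gt0 prim_zeta z_mu.
  pose x := z ^+ m; have xrj : x ^+ (r ^ j) = 1 by rewrite -exprM mulnC -nE.
  have [d prim_x d_j] := prim_order_exists rj_gt0 xrj.
  have rd : (r %| d)%N.
    have /(dvdn_pfactor _ _ r_pr)[[|e] _ Ed] := d_j; last by rewrite Ed dvdn_exp.
    by case/eqP: zm; have := prim_expr_order prim_x; rewrite Ed expn0 expr1.
  have prim_rho := dvdn_prim_root prim_x rd.
  have [a Ea] : exists a, y = z ^+ (1 + m * a).
    have wr : (y / z) ^+ r = 1 by rewrite expr_div_n yr divff // expf_neq0.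
    have [a Ea] := prim_rootP prim_rho wr; exists (d %/ r * a)%N.
    by rewrite exprD expr1 mulnA exprM exprM -/x -Ea mulrC divfK.
  have cop : coprime (1 + m * a) n.
    by apply: coprime_rn; rewrite mE -mulnA mulnC dvdn_addl ?dvdn_mull // dvdn1 neq_ltn r_gt1 orbT.
  rewrite Ea -[RHS](dmult_push rj_gt0 _ cop) //.
  apply: dmult_mod; rewrite ?muln_gt0 ?rj_gt0 //; last exact: roots1X.
  by rewrite mulnDr muln1 mulnA -nE -modnDmr modnMr addn0.
have := sum_fiber_dmult rj_gt0 (roots1X prim_zeta r z_mu).
rewrite big_seq_cond (eq_bigr (fun=> dmult (r ^ j) z * 1)); last first.
  by move=> y /andP[y_mu /eqP yr]; rewrite mulr1 inv.
rewrite -mulr_sumr -big_seq_cond -big_filter (bigD1_seq z) ?filter_uniq ?(roots1_uniq prim_zeta) //=;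
  last by rewrite mem_filter eqxx.
have -> : pair_mass (eta ^+ (r ^ j)) (z ^+ r) = 0.
  have ne : (z ^+ r) ^+ (r ^ (k - j)) != 1 by rewrite -exprM -mE.
  have eta1 : (eta ^+ (r ^ j)) ^+ (r ^ (k - j)) = 1.
    by apply/eqP; rewrite -exprM -expnD subnKC // eta_expr_eq1.
  rewrite /pair_mass; have [E1|_] := eqVneq; first by rewrite E1 eta1 eqxx in ne.
  have [E1|_] := eqVneq; last by rewrite addr0.
  by rewrite E1 exprVn eta1 invr1 eqxx in ne.
move/eqP; rewrite mulf_eq0 => /orP[/eqP//|]; rewrite paddr_eq0 ?ler01 ?oner_eq0 //.
by apply: sumr_ge0.
Qed.

(** Positivity enters here: at an m-th root of unity other than 1 the increment is itself a
    multiplicity. *)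
Lemma dmult_ge0 z : z \in mu -> z != 1 -> 0 <= dmult (r ^ j) z.
Proof.
move=> z_mu z1; have [zm|/(dmult_support z_mu)-> //] := eqVneq (z ^+ m) 1.
by rewrite /dmult mult_lower // (negbTE z1) subr0.
Qed.

Lemma one_roots1 : 1 \in mu.
Proof. by rewrite (mem_roots1 prim_zeta) expr1n. Qed.

Lemma dmult1_geN1 : -1 <= dmult (r ^ j) 1.
Proof.
by rewrite /dmult mult_lower ?one_roots1 ?expr1n // eqxx lerDr.
Qed.

Lemma dmult1_le_fiber :
  dmult (r ^ j) 1 <= \sum_(z <- mu | z ^+ r == 1) dmult (r ^ j) z.
Proof.
rewrite -big_filter (bigD1_seq 1) ?filter_uniq ?(roots1_uniq prim_zeta) //=; last first.
  by rewrite mem_filter expr1n eqxx one_roots1.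
rewrite lerDl big_seq_cond sumr_ge0 // => z /andP[]; rewrite mem_filter => /andP[_ z_mu].
exact: dmult_ge0.
Qed.

Lemma E1_level s : ~~ (r %| s)%N ->
  E 1 (r ^ j * s) = \sum_(z <- mu) (dmult (r ^ j) z)%:~R * z ^+ s.
Proof.
move=> rs; have cop := coprime_rn rs.
have s_gt0 : (0 < s)%N by case: s rs {cop} => //; rewrite dvdn0.
rewrite -sum_dmult ?muln_gt0 ?rj_gt0 // -(sum_roots1X n_gt0 prim_zeta _ cop).
by apply: eq_big_seq => z z_mu; rewrite dmult_push // expr1.
Qed.

Let F i := \sum_(z <- mu | z ^+ (r ^ i) == 1) f 1%N z.

(** The sum of E 1 (r^j s) over s < r m' prime to r is computed twice by Ramanujan sums, from [f 1]
    and from [dmult (r ^ j)]; the common factor m' cancels. *)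
Lemma dmult1_torsion :
  F j * r%:R - F j.+1 =
  dmult (r ^ j) 1 * r%:R - \sum_(z <- mu | z ^+ r == 1) dmult (r ^ j) z.
Proof.
pose m' := (r ^ (k - j))%N.
have m'_neq0 : m'%:R != 0 :> algC by rewrite pnatr_eq0 -lt0n expn_gt0 r_gt0.
have sum_if (g : algC -> int) (P : pred algC) :
    (\sum_(z <- mu | P z) g z)%:~R = \sum_(z <- mu) (g z)%:~R * (P z)%:R :> algC.
  rewrite rmorph_sum big_mkcond; apply: eq_bigr => z _ /=.
  by case: (P z); rewrite ?mulr1 ?mulr0.
apply: (@intr_inj algC); apply: (mulfI m'_neq0).
transitivity (\sum_(s < r * m' | ~~ (r %| s)%N) E 1 (r ^ j * s)).
  rewrite rmorphB rmorphM rmorph_nat /= /F !sum_if mulr_suml -sumrB mulr_sumr.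
  rewrite /E exchange_big /=; apply: eq_big_seq => z z_mu; rewrite -mulr_sumr.
  have zm : (z ^+ (r ^ j)) ^+ (r * m') = 1.
    by rewrite -exprM -mE -nE; apply/eqP; rewrite -(mem_roots1 prim_zeta).
  under [in RHS]eq_bigr do rewrite exprM.
  rewrite (sum_coprime_powers r_gt0 zm) -exprM -expnSr natrM -[r%:R * _ *+ _]mulr_natr -[m'%:R *+ _]mulr_natr.
  by ring.
rewrite (eq_bigr _ (fun s : 'I_(r * m') => @E1_level s)) exchange_big /=.
rewrite rmorphB rmorphM rmorph_nat /= sum_if mulrBr mulr_sumr.
have -> : m'%:R * ((dmult (r ^ j) 1)%:~R * r%:R) =
    \sum_(z <- mu) (z == 1)%:R * (m'%:R * ((dmult (r ^ j) z)%:~R * r%:R)) :> algC.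
  by rewrite (sum_delta_roots1 prim_zeta (fun z => _ * ((dmult _ z)%:~R * _)) one_roots1).
rewrite -sumrB; apply: eq_big_seq => z z_mu; rewrite -mulr_sumr.
have [zm|/(dmult_support z_mu)->] := eqVneq (z ^+ m) 1; last first.
  by rewrite rmorph0 !mul0r !mulr0 subr0.
rewrite mE in zm; rewrite (sum_coprime_powers r_gt0 zm) natrM -[_ * _ *+ _]mulr_natr -[m'%:R *+ _]mulr_natr.
by ring.
Qed.

(* The divisibility by 2r of [F j] leaves 0 as the only possible value. *)
Lemma dmult1_eq0 : dmult (r ^ j) 1 = 0.
Proof.
have := dmult1_torsion; have := dmult1_le_fiber; have := dmult1_geN1.
rewrite (sum_fiber_dmult rj_gt0 one_roots1).
have /dvdzP[a Fj] := fdiv le_jk; rewrite -/(F j) in Fj.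
have eta_pair : pair_mass (eta ^+ (r ^ j)) 1 = (r ^ k %| r ^ j)%N%:R *+ 2.
  by rewrite /pair_mass eq_sym [1 == _^-1]eq_sym invr_eq1 eta_expr_eq1 mulr2n.
rewrite eta_pair dvdn_Pexp2l //.
have [lejk'|ltjk] := leqP k j.
  (* At the top level the identity reduces to dmult = F k, a multiple of 2r lying between -1 and
     2. *)
  have Ejk : j = k by apply/eqP; rewrite eqn_leq le_jk.
  have -> : F j.+1 = 2.
    rewrite /F Ejk -[RHS](fsum 1%N) big_seq_cond [RHS]big_seq; apply: eq_bigl => z.
    by case: (boolP (z \in mu)) => //=; rewrite (mem_roots1 prim_zeta) => /eqP->; rewrite eqxx.
  rewrite /= => H1 H2; rewrite Fj => H3.
  have : dmult (r ^ j) 1 * r%:R = (a * (2 * r)%N%:Z) * r%:R by lia.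
  have r0 : r%:R != 0 :> int by rewrite pnatr_eq0 -lt0n.
  move/(mulIf r0) => E4; rewrite E4 in H1 H2 *.
  have r2 : (1 < r)%N := r_gt1.
  have : a = 0 by nia.
  by move->; rewrite mul0r.
(* Below the top the fiber over 1 has sum 0, so the value is -1 or 0; it is even because both F j
   and F (j+1) are multiples of 2r. *)
have /dvdzP[b Fj1] := fdiv ltjk; rewrite -/(F _) in Fj1.
rewrite mul0rn => H1 H2; rewrite Fj Fj1 subr0 PoszM => H3.
have r0 : r%:R != 0 :> int by rewrite pnatr_eq0 -lt0n.
have : dmult (r ^ j) 1 = a * 2 * r%:R - b * 2.
  by apply: (mulIf r0); rewrite -H3 natz; ring.
by move: H1 H2; lia.
Qed.

(** Now [dmult (r ^ j)] is even, nonnegative and zero at 1, of mass E 0 (r^j) = 2 by the known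
    [f 0], so [even_two_mass] applies; its fiber sums then select between c and its inverse. *)
Lemma level_pair_exists : exists c, level_pair j c.
Proof.
have g0 : {in mu, forall z, 0 <= dmult (r ^ j) z}.
  by move=> z z_mu; have [->|z1] := eqVneq z 1; [rewrite dmult1_eq0 | apply: dmult_ge0].
have gs : \sum_(z <- mu) dmult (r ^ j) z = 2.
  apply: (@intr_inj algC); transitivity (E 0 (r ^ j)).
    by rewrite -sum_dmult // rmorph_sum; apply: eq_bigr => z _; rewrite expr0 mulr1.
  rewrite /E (eq_big_seq (fun z => (pair_mass 1 z)%:~R * z ^+ (r ^ j))) => [|z z_mu].
    by rewrite (sum_pair_mass (fun z => z ^+ (r ^ j)) one_roots1) invr1 expr1n.
  by rewrite -(expr0 eta) -f_eta // muln0.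
have [c c_mu [c1 cM]] := even_two_mass n_gt0 prim_zeta g0 (dmultV rj_gt0) dmult1_eq0 gs.
have Mc : 0 < dmult (r ^ j) c by rewrite cM // eqxx; case: (_ == _).
have cm : c ^+ m = 1.
  by apply/eqP; apply: contraLR Mc => /(dmult_support c_mu)->.
have : 0 < pair_mass (eta ^+ (r ^ j)) (c ^+ r).
  rewrite -(sum_fiber_dmult rj_gt0) ?(roots1X prim_zeta) //.
  rewrite -big_filter (bigD1_seq c) ?filter_uniq ?(roots1_uniq prim_zeta) //=; last first.
    by rewrite mem_filter eqxx.
  rewrite ltr_wpDr // big_seq_cond sumr_ge0 // => z /andP[]; rewrite mem_filter => /andP[_ z_mu] _.
  exact: g0.
rewrite /pair_mass; have [cr _|_] := eqVneq; first by exists c; split.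
have [cr _|//] := eqVneq; exists c^-1; split; rewrite ?(roots1V prim_zeta) ?invr_eq1 //.
- by rewrite exprVn cm invr1.
- by rewrite exprVn cr invrK.
by move=> z z_mu; rewrite cM // /pair_mass invrK addrC.
Qed.

End Level.

Lemma level_pair_all j : (j <= k)%N -> exists c, level_pair j c.
Proof.
elim/ltn_ind: j => j IHj le_jk; apply: level_pair_exists => // v ltvj.
exact: IHj ltvj (ltnW (leq_trans ltvj le_jk)).
Qed.

Lemma pair_mass_inv b z : pair_mass b z^-1 = pair_mass b z.
Proof. by rewrite /pair_mass (inj_eq invr_inj) -{1}[b]invrK (inj_eq invr_inj) addrC. Qed.

Lemma expr2_odd_eq1 (x : algC) d : odd d -> x ^+ d = 1 -> (x ^+ 2 == 1) = (x == 1).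
Proof.
move=> od xd; apply/eqP/eqP => [x2|->]; last by rewrite expr1n.
by rewrite -xd -(odd_double_half d) od addSn add0n exprS -muln2 mulnC exprM x2 expr1n mulr1.
Qed.

(** Expanding the square leaves Ramanujan sums of x^2 and its inverse, which depend only on whether
    x^2 and x^(2r) are 1. *)
Lemma sum_coprime_sq (d : nat) (x y : algC) : x ^+ (r * d) = 1 -> y ^+ r = x ^+ r ->
  (x ^+ 2 == 1) = (y ^+ 2 == 1) ->
  \sum_(s < r * d | ~~ (r %| s)%N) (x ^+ s + x ^- s) ^+ 2 =
  \sum_(s < r * d | ~~ (r %| s)%N) (y ^+ s + y ^- s) ^+ 2.
Proof.
have expand (w : algC) : w ^+ (r * d) = 1 ->
    \sum_(s < r * d | ~~ (r %| s)%N) (w ^+ s + w ^- s) ^+ 2 =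
    \sum_(s < r * d | ~~ (r %| s)%N) 2 +
    ((r * d)%:R *+ (w ^+ 2 == 1) - d%:R *+ (w ^+ r ^+ 2 == 1)) *+ 2.
  case: (posnP d) => [d0 _|d_gt0 wd].
    by rewrite !big1 ?add0r => [|[s]|[s]]; rewrite ?d0 ?muln0 // mul0rn mul0rn subrr mul0rn.
  have w0 : w != 0.
    by apply: contraTneq isT => w0; move/eqP: wd; rewrite w0 expr0n muln_eq0 !gtn_eqF // eq_sym oner_eq0.
  have w2 : (w ^+ 2) ^+ (r * d) = 1 by rewrite exprAC wd expr1n.
  have w2V : (w ^- 2) ^+ (r * d) = 1 by rewrite exprVn w2 invr1.
  have := sum_coprime_powers r_gt0 w2V; have := sum_coprime_powers r_gt0 w2.
  rewrite exprVn !invr_eq1 [(w ^+ 2) ^+ r]exprAC mulr2n => <- E2.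
  rewrite -[X in _ = _ + (_ + X)]E2 -!big_split; apply: eq_bigr => s _ /=.
  have a0 : w ^+ s != 0 by rewrite expf_neq0.
  rewrite exprVn [(w ^+ 2) ^+ s]exprAC; move: (w ^+ s) a0 => a a0.
  by field.
move=> xd yr x2; rewrite !expand ?yr ?x2 //.
by rewrite exprM yr -exprM.
Qed.

(* Parseval turns this into the sum of the squares of [f 1], which equals 2 and
   thus determines [f 1]. *)
Lemma sum_E1_sq b : level_pair 0 b ->
  \sum_(t < n) E 1 t ^+ 2 = \sum_(t < n) (b ^+ t + b ^- t) ^+ 2.
Proof.
case=> b_mu b1 bn br _; rewrite expn0 expr1 in br.
suff H d : (d <= k.+1)%N ->
    \sum_(s < r ^ d) E 1 (r ^ (k.+1 - d) * s) ^+ 2 =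
    \sum_(s < r ^ d) (b ^+ (r ^ (k.+1 - d) * s) + b ^- (r ^ (k.+1 - d) * s)) ^+ 2.
  have := H _ (leqnn _); rewrite subnn expn0.
  by under eq_bigr do rewrite mul1n; under [in RHS]eq_bigr do rewrite mul1n.
(* Exponents are sorted by their r-part: multiples of r come from the previous [d], the others from
   level j = k - d. *)
elim: d => [|d IHd] ledk.
  rewrite expn0 !big_ord1 muln0 expr0 invr1 /E.
  under eq_bigr do rewrite expr0 mulr1.
  by rewrite -rmorph_sum fsum.
rewrite expnS subSS.
pose j := (k - d)%N; have le_jk : (j <= k)%N by rewrite leq_subr.
have Ej : (k.+1 - j = d.+1)%N by rewrite /j subSn ?leq_subr // subKn.
rewrite -/j (sum_split_multiples _ (fun s => E 1 (r ^ j * s) ^+ 2)) //.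
rewrite (sum_split_multiples _ (fun s => (b ^+ (r ^ j * s) + b ^- (r ^ j * s)) ^+ 2)) //.
have EdS s : (r ^ j * (r * s) = r ^ (k.+1 - d) * s)%N.
  by rewrite mulnA -expnSr /j subSn.
congr (_ + _).
  under eq_bigr do rewrite EdS; under [in RHS]eq_bigr do rewrite EdS.
  by apply: IHd; apply: ltnW.
have [c [c_mu c1 cm cr cM]] := level_pair_all le_jk; rewrite Ej expnS in cm.
transitivity (\sum_(s < r * r ^ d | ~~ (r %| s)%N) (c ^+ s + c ^- s) ^+ 2).
  apply: eq_bigr => s rs; rewrite (E1_level j rs).
  rewrite (eq_big_seq (fun z => (pair_mass c z)%:~R * z ^+ s)) => [|z z_mu].
    by rewrite (sum_pair_mass (fun z => z ^+ s)) // exprVn.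
  by rewrite cM.
under [RHS]eq_bigr do rewrite !exprM.
have yr : (b ^+ (r ^ j)) ^+ r = c ^+ r by rewrite cr exprAC br.
apply: sum_coprime_sq => //.
(* For r = 2 the squares are the r-th powers, already equal; for odd r neither root is 1, hence
   neither square is. *)
have [r2|r_neq2] := eqVneq r 2%N.
  have E2 (x y : algC) : x ^+ r = y ^+ r -> (y ^+ 2 == 1) = (x ^+ 2 == 1) by rewrite r2 => ->.
  exact: E2 yr.
have r_odd : odd (r * r ^ d) by rewrite -expnS oddX; case: (even_prime r_pr) => [E2|->] //; rewrite E2 in r_neq2.
rewrite (expr2_odd_eq1 r_odd cm) (negbTE c1).
have yd : (b ^+ (r ^ j)) ^+ (r * r ^ d) = 1 by rewrite exprM yr -exprM.
rewrite (expr2_odd_eq1 r_odd yd); apply/esym/negbTE.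
case: (j) le_jk => [|i] le_ik; first by rewrite expn0 expr1.
by rewrite expnS exprM br eta_expr_eq1 dvdn_Pexp2l // -ltnNge.
Qed.

Lemma f1_pair : exists2 b, n.-primitive_root b & b ^+ r = eta /\ {in mu, f 1%N =1 pair_mass b}.
Proof.
have [b lb] := level_pair_all (leq0n k); have := lb.
case=> b_mu b1 bn br bM; rewrite expn0 expr1 in br.
have f11 : f 1%N 1 = 0.
  by apply: f_at1; rewrite dvdn1 /n expnS muln_eq1 negb_and neq_ltn r_gt1 orbT.
have b_ne j : (j <= k)%N -> b ^+ (r ^ j) != 1.
  case: j => [|j] lejk; first by rewrite expn0 expr1.
  by rewrite expnS exprM br eta_expr_eq1 dvdn_Pexp2l // -ltnNge.
have sqs : \sum_(z <- mu) f 1%N z ^+ 2 = \sum_(z <- mu) pair_mass b z ^+ 2.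
  apply: (@intr_inj algC); apply: (mulfI n_neq0).
  rewrite -(parseval_even n_gt0 prim_zeta (fV 1)).
  rewrite -(parseval_even n_gt0 prim_zeta (fun z _ => pair_mass_inv b z)).
  rewrite -/(E 1 _) [LHS](sum_E1_sq lb); apply: eq_bigr => t _.
  by rewrite (sum_pair_mass (fun z => z ^+ t)) // exprVn.
(* If b is not self-inverse, the sum of f^2 - f is 0 with nonnegative terms, so f takes only the
   values 0 and 1. If it is, then n = 2 and the whole mass sits at -1. *)
have f0 : {in mu, forall z, 0 <= f 1%N z}.
  have [bV|nbV] := eqVneq b b^-1.
    have b2 : b ^+ 2 = 1 by rewrite expr2 {1}bV mulVf // (roots1_neq0 n_gt0 prim_zeta).
    have r2 : r = 2%N.
      case: (even_prime r_pr) => // r_odd; have n_odd : odd n by rewrite oddX r_odd orbT.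
      by case/negP: b1; rewrite -(expr2_odd_eq1 n_odd bn) b2.
    have k0 : k = 0%N.
      have := prim_eta; rewrite -br r2 b2 => /prim_order_dvd/(_ 1%N).
      rewrite expr1n eqxx dvdn1 => /esym/eqP.
      by case: k => // k'; rewrite expnS => /eqP; rewrite muln_eq1.
    move=> z z_mu; have [->|z1] := eqVneq z 1; first by rewrite f11.
    have mu2 x : x \in mu -> x != 1 -> x = z.
      have root_m1 y : y \in mu -> y != 1 -> y = -1.
        rewrite (mem_roots1 prim_zeta) /n k0 r2 expn1 sqrf_eq1 => /orP[->//|/eqP//].
      by move=> x_mu x1; rewrite (root_m1 x) // (root_m1 z).
    have := fsum 1; rewrite (bigD1_seq z) ?(roots1_uniq prim_zeta) //= big_seq_cond big1 ?addr0.
      by move->.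
    move=> x /andP[x_mu xz]; have [->//|x1] := eqVneq x 1.
    by rewrite (mu2 x) ?eqxx in xz.
  have Z0 : \sum_(z <- mu) (f 1%N z ^+ 2 - f 1%N z) = 0.
    rewrite sumrB fsum sqs; apply/eqP; rewrite subr_eq0; apply/eqP.
    transitivity (\sum_(z <- mu) pair_mass b z * 1).
      apply: eq_bigr => z _; rewrite mulr1 /pair_mass.
      by case: (eqVneq z b) => [->|_]; [rewrite (negbTE nbV) | case: eqP].
    by rewrite -[RHS]/(1 + 1); rewrite -(sum_pair_mass (fun=> 1) b_mu); apply: eq_bigr => z _; rewrite intz.
  move=> z z_mu; move: Z0; rewrite (bigD1_seq z) ?(roots1_uniq prim_zeta) //=.
  have sq_ge (a : int) : 0 <= a ^+ 2 - a by rewrite expr2; nia.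
  move/eqP; rewrite paddr_eq0 ?sumr_ge0 // => /andP[/eqP + _].
  by rewrite expr2; nia.
have [c c_mu [c1 cM]] := even_two_mass n_gt0 prim_zeta f0 (fV 1) f11 (fsum 1).
have cV_mu : c^-1 \in mu by rewrite (roots1V prim_zeta).
(* E 1 1 ties the two roots together: c comes from [f 1], b from level 0. *)
have EE : c + c^-1 = b + b^-1.
  transitivity (E 1 1).
    rewrite -(sum_pair_mass id c_mu); apply: eq_big_seq => z z_mu.
    by rewrite expr1 cM.
  have r1 : ~~ (r %| 1)%N by rewrite dvdn1 neq_ltn r_gt1 orbT.
  rewrite -(sum_pair_mass id b_mu) [LHS](E1_level 0 r1).
  by apply: eq_big_seq => z z_mu; rewrite bM ?expr1.
have [b0 c0] := (roots1_neq0 n_gt0 prim_zeta b_mu, roots1_neq0 n_gt0 prim_zeta c_mu).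
exists b.
  have [d prim_b] := prim_order_exists n_gt0 bn.
  case/(dvdn_pfactor _ _ r_pr) => e le_ek Ed; move: prim_b; rewrite Ed => prim_b.
  have [ek|ne] := eqVneq e k.+1; first by rewrite /n -ek.
  have lek : (e <= k)%N by rewrite -ltnS ltn_neqAle ne.
  by case/negP: (b_ne e lek); rewrite (prim_expr_order prim_b).
split=> // z z_mu; rewrite cM //.
have : (c - b) * (c - b^-1) == 0.
  have -> : (c - b) * (c - b^-1) = c * c - c * (b + b^-1) + b * b^-1.
    by move: (b^-1) => b'; ring.
  by rewrite -EE mulrDr !mulfV // opprD addrA subrr sub0r addNr.
rewrite mulf_eq0 !subr_eq0 => /orP[/eqP->|/eqP->]; first by [].
by rewrite /pair_mass invrK addrC.
Qed.

(** Exponents divisible by r are governed by [eta]; the others are Galois conjugate to the exponent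
    1. *)
Theorem eigenvalue_combinatorics :
  exists2 b, n.-primitive_root b & forall i, {in mu, f i =1 pair_mass (b ^+ i)}.
Proof.
have [b prim_b [br f1b]] := f1_pair; exists b => // i.
have b_mu : b \in mu by rewrite (mem_roots1 prim_zeta) (prim_expr_order prim_b).
have [/dvdnP[i' ->]|ri] := boolP (r %| i)%N.
  by rewrite mulnC exprM br; apply: f_eta.
have cop := coprime_rn ri.
move=> z; rewrite -(perm_mem (perm_roots1X n_gt0 prim_zeta cop)) => /mapP[y y_mu ->].
rewrite -{1}[i]mul1n f_push // f1b //.
have inj x : x \in mu -> (y ^+ i == x ^+ i) = (y == x).
  by move=> x_mu; apply: (inj_in_eq (roots1X_inj n_gt0 prim_zeta cop)).
by rewrite /pair_mass -exprVn !inj ?(roots1V prim_zeta).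
Qed.

End EigenvalueCombinatorics.

(** * Lifting traces from characteristic p *)

Section FilteredRing.
Variables (S : comNzRingType) (p : nat) (I : nat -> S -> Prop).
Hypotheses (p_pr : prime p)
  (I_add : forall j x y, I j x -> I j y -> I j (x + y))
  (I_top : forall x, I 0 x)
  (I_prod : forall i j x y, I i x -> I j y -> I (i + j) (x * y))
  (I_mono : forall j x, I j.+1 x -> I j x)
  (I_p : I 1 p%:R).

Lemma filt_mul j a x : I j x -> I j (a * x).
Proof. by move=> Ix; rewrite -[j]add0n; apply: I_prod. Qed.

Lemma filt_pX i : I i (p%:R ^+ i).
Proof.
elim: i => [|i IHi]; first exact: I_top.
by rewrite exprS -add1n; apply: I_prod.
Qed.

Lemma filt0 j : I j 0.
Proof. by rewrite -(mul0r (p%:R ^+ j)); apply/filt_mul/filt_pX. Qed.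

Lemma filt_opp j x : I j x -> I j (- x).
Proof. by move=> Ix; rewrite -mulN1r; apply: filt_mul. Qed.

Lemma filt_sub_trans j x y z : I j (x - y) -> I j (y - z) -> I j (x - z).
Proof. by move=> H1 H2; have := I_add H1 H2; rewrite addrA subrK. Qed.

Lemma filt_sub_sym j x y : I j (x - y) -> I j (y - x).
Proof. by move=> H; rewrite -opprB; apply: filt_opp. Qed.

Lemma filt_sum j (T : Type) (s : seq T) (P : pred T) (F : T -> S) :
  (forall t, P t -> I j (F t)) -> I j (\sum_(t <- s | P t) F t).
Proof. by move=> H; apply: (big_ind (I j)) => //; [apply: filt0 | apply: I_add]. Qed.

Lemma filt_le i j x : (i <= j)%N -> I j x -> I i x.
Proof. by move=> /subnKC <-; elim: (j - i)%N => [|d IHd]; rewrite ?addn0 // addnS => /I_mono. Qed.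

Lemma filt_mulrz j x a : I j x -> I j (x *~ a).
Proof. by move=> H; rewrite -mulrzl; apply: filt_mul. Qed.

Lemma filt_natmul_p N i x : (i <= N)%N -> I (N - i) x -> I N (x *+ p ^ i).
Proof.
move=> leiN Ix; rewrite -mulr_natl natrX -(subnKC leiN).
by apply: I_prod => //; apply: filt_pX.
Qed.

Definition mx_filt j m n (A : 'M[S]_(m, n)) := forall a b, I j (A a b).

Lemma mx_filtM i j m n l (A : 'M[S]_(m, n)) (B : 'M[S]_(n, l)) :
  mx_filt i A -> mx_filt j B -> mx_filt (i + j) (A *m B).
Proof. by move=> HA HB a b; rewrite mxE; apply: filt_sum => c _; apply: I_prod. Qed.

Lemma mx_filtMl j m n l (A : 'M[S]_(m, n)) (B : 'M[S]_(n, l)) :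
  mx_filt j B -> mx_filt j (A *m B).
Proof. by move=> HB; rewrite -[j]add0n; apply: mx_filtM => // a b; apply: I_top. Qed.

Lemma mx_filtMr j m n l (A : 'M[S]_(m, n)) (B : 'M[S]_(n, l)) :
  mx_filt j A -> mx_filt j (A *m B).
Proof. by move=> HA; rewrite -[j]addn0; apply: mx_filtM => // a b; apply: I_top. Qed.

Lemma mx_filtX n (A : 'M[S]_n) c : mx_filt 1 A -> mx_filt c (A ^+ c).
Proof.
move=> HA; elim: c => [|c IHc]; first by move=> a b; apply: I_top.
by rewrite exprS -mulmxE -add1n; apply: mx_filtM.
Qed.

Lemma mxtrace_filt j n (A : 'M[S]_n) : mx_filt j A -> I j (\tr A).
Proof. by move=> HA; apply: filt_sum. Qed.

Lemma mxtrace_prod_rot1 n (T : Type) (y : T -> 'M[S]_n) (w : seq T) :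
  \tr (\prod_(t <- rot 1%N w) y t) = \tr (\prod_(t <- w) y t).
Proof.
case: w => [|t w]; first by rewrite !big_nil.
by rewrite rot1_cons big_cons -cats1 big_cat big_seq1 /= -!mulmxE mxtrace_mulC.
Qed.

Lemma ltn_subn_expn N i : (i <= N)%N -> (N.+1 - i <= p ^ (N - i))%N.
Proof. by move=> leiN; rewrite subSn // ltn_expl // prime_gt1. Qed.

(** For numbers: a = b modulo p gives equal p^N-th powers modulo p^(N+1). In the expansion of ((A -
    B) + B)^(p^N), an orbit of p^i words counts p^i times the trace of a p^(N-i)-th power involving
    A - B, which lies in level p^(N-i) >= N + 1 - i. *)
Lemma trace_power_congr n (A B : 'M[S]_n) N :
  mx_filt 1 (A - B) -> I N.+1 (\tr (A ^+ (p ^ N)) - \tr (B ^+ (p ^ N))).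
Proof.
move=> HAB; pose y (t : bool) := if t then A - B else B.
have -> : A = \sum_t y t by rewrite big_bool /= subrK.
pose w0 : (p ^ N).-tuple bool := nseq_tuple _ false.
have -> : B ^+ (p ^ N) = \prod_(t <- w0) y t.
  by rewrite /= big_nseq; elim: (p ^ N)%N => //= m <-; rewrite exprS.
rewrite expr_sum_tuple raddf_sum /= (bigD1 w0) //= addrAC subrr add0r.
pose phi (w : (p ^ N).-tuple bool) := \tr (\prod_(t <- w) y t) *+ (w != w0).
have -> : \sum_(w : (p ^ N).-tuple bool | w != w0) \tr (\prod_(t <- w) y t) = \sum_w phi w.
  by rewrite big_mkcond; apply: eq_bigr => w _; rewrite /phi; case: (w != w0).
have rot_w0 (w : (p ^ N).-tuple bool) : ([tuple of rot 1%N w] == w0) = (w == w0).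
  rewrite -!val_eqE /=; have rot_nseq : rot 1%N (nseq (p ^ N) false) = nseq (p ^ N) false.
    by case: (p ^ N)%N => //= m; rewrite rot1_cons; elim: m => //= m ->.
  by rewrite -{1}rot_nseq (inj_eq (@rot_inj _ _)).
apply: (rotation_sum (J := I N.+1) p_pr); [exact: filt0 | exact: I_add | |].
  by move=> w; rewrite /phi rot_w0 mxtrace_prod_rot1.
move=> i w leiN rotw; rewrite /phi; have [_|w_w0] := eqVneq w w0.
  by rewrite mulr0n mul0rn; apply: filt0.
have [v sv Ew] := rotation_fixed_power (prime_gt0 p_pr) leiN rotw.
rewrite mulr1n Ew prod_flatten_nseq; apply: filt_natmul_p; first exact: leqW.
apply: filt_le (ltn_subn_expn leiN) _; apply/mxtrace_filt/mx_filtX.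
have v_true : true \in v.
  apply: contraNT w_w0 => nv; rewrite -val_eqE /= Ew.
  have -> : v = nseq (p ^ i) false.
    rewrite -sv; apply/all_pred1P/allP => -[] //= vt; by rewrite vt in nv.
  have -> : (p ^ N = p ^ (N - i) * p ^ i)%N by rewrite -expnD subnK.
  by apply/eqP; elim: (p ^ (N - i))%N => //= c ->; rewrite cat_nseq mulSn nseqD cat_nseq.
case/splitPr: v_true => v1 v2.
by rewrite big_cat big_cons /= -!mulmxE; apply/mx_filtMl/mx_filtMr.
Qed.

Lemma mxtrace_conjX n (A B : 'M[S]_n) m : \tr ((A *m B) ^+ m) = \tr ((B *m A) ^+ m).
Proof.
case: m => [|m]; first by rewrite !expr0.
have E : (A *m B) ^+ m.+1 = A *m ((B *m A) ^+ m *m B).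
  elim: m => [|m IHm]; first by rewrite expr1 expr0 mul1mx.
  by rewrite exprS IHm -mulmxE !mulmxA; congr (_ *m _); rewrite exprS -mulmxE !mulmxA.
by rewrite E mxtrace_mulC -mulmxA mulmxE -exprSr.
Qed.

Lemma trig_mxX n (T : 'M[S]_n) m : is_trig_mx T ->
  is_trig_mx (T ^+ m) /\ forall i, (T ^+ m) i i = T i i ^+ m.
Proof.
move=> /is_trig_mxP trT; elim: m => [|m [/is_trig_mxP trTm dTm]].
  split=> [|i]; last by rewrite !expr0 mxE eqxx.
  by apply/is_trig_mxP => i j ij; rewrite expr0 mxE -val_eqE /= ltn_eqF.
rewrite exprS -mulmxE; split=> [|i].
  apply/is_trig_mxP => i j ij; rewrite mxE big1 // => a _.
  have [ia|ai] := ltnP i a; first by rewrite trT ?mul0r.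
  by rewrite trTm ?mulr0 // (leq_ltn_trans ai).
rewrite mxE (bigD1 i) //= dTm exprS big1 ?addr0 // => a ai.
have [ia|ia] := ltnP i a; first by rewrite trT ?mul0r.
by rewrite trTm ?mulr0 // ltn_neqAle ia andbT.
Qed.

Variables (L : fieldType) (pi : {rmorphism S -> L}) (s : L -> S).
Hypotheses (ker_pi : forall x, pi x = 0 -> I 1 x) (pi_s : cancel s pi) (s0 : s 0 = 0).

Lemma pi_congr n m (A B : 'M[S]_(n, m)) : map_mx pi A = map_mx pi B -> mx_filt 1 (A - B).
Proof.
move=> /matrixP E a b; apply: ker_pi; have := E a b.
by rewrite !mxE rmorphB /= => ->; rewrite subrr.
Qed.

Lemma map_pi_s n m (B : 'M[L]_(n, m)) : map_mx pi (map_mx s B) = B.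
Proof. by apply/matrixP => i j; rewrite !mxE pi_s. Qed.

(** The lifts of P and Q are not inverse to each other, but a cyclic shift under the trace brings
    them together into a matrix congruent to 1. *)
Lemma trace_power_trig n (A : 'M[S]_n) (P T Q : 'M[L]_n) N :
  map_mx pi A = P *m T *m Q -> Q *m P = 1%:M -> is_trig_mx T ->
  I N.+1 (\tr (A ^+ (p ^ N)) - \sum_i s (T i i) ^+ (p ^ N)).
Proof.
move=> EA QP trT; pose T' := map_mx s T.
have trT' : is_trig_mx T'.
  by apply/is_trig_mxP => i j ij; rewrite mxE (is_trig_mxP trT) ?s0.
apply: (filt_sub_trans (y := \tr ((map_mx s P *m (T' *m map_mx s Q)) ^+ (p ^ N)))).
  by apply/trace_power_congr/pi_congr; rewrite EA !map_mxM !map_pi_s mulmxA.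
rewrite mxtrace_conjX.
have -> : \sum_i s (T i i) ^+ (p ^ N) = \tr (T' ^+ (p ^ N)).
  by apply: eq_bigr => i _; rewrite (trig_mxX _ trT').2 mxE.
apply/trace_power_congr/pi_congr.
by rewrite !map_mxM !map_pi_s -mulmxA QP mulmx1.
Qed.

Variables (gT : finGroupType) (n : nat) (D : gT -> 'M[L]_n) (beta : gT -> S).
Hypotheses (D1 : D 1%g = 1) (DM : forall g h, D (g * h)%g = D g *m D h)
  (betaJ : class_stable beta)
  (D_beta : forall h N (A : 'M[S]_n), map_mx pi A = D h ->
     I N.+1 (\tr (A ^+ (p ^ N)) - beta (h ^+ (p ^ N))%g)).

Lemma map_pi_prod (w : seq gT) :
  map_mx pi (\prod_(g <- w) map_mx s (D g)) = D (\prod_(g <- w) g)%g.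
Proof.
elim: w => [|g w IHw]; first by rewrite !big_nil map_mx1 D1.
by rewrite !big_cons -mulmxE map_mxM map_pi_s IHw DM.
Qed.

(** [beta] is a candidate lift of the Brauer character. A word of period p^i pairs the trace of a
    p^(N-i)-th power with [beta] at the same power; [D_beta] applies with N - i, and the factor p^i
    restores the lost precision. *)
Lemma trace_power_group_ring (u : group_ring int gT) N :
  I N.+1 (\tr ((\sum_g map_mx s (D g) *~ coeff u g) ^+ (p ^ N)) -
          \sum_g beta g *~ coeff (u ^+ (p ^ N)) g).
Proof.
rewrite sum_expr_class expr_sum_tuple raddf_sum -sumrB /=.
have prodE (w : seq gT) : \prod_(g <- w) (map_mx s (D g) *~ coeff u g) =
    (\prod_(g <- w) map_mx s (D g)) *~ \prod_(g <- w) coeff u g.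
  elim: w => [|g w IHw]; first by rewrite !big_nil.
  by rewrite !big_cons IHw mulrzAl mulrzAr -mulrzA mulrC.
under eq_bigr do rewrite prodE raddfMz /= -mulrzBl.
apply: (rotation_sum (J := I N.+1) p_pr); [exact: filt0 | exact: I_add | |].
  by move=> w; rewrite mxtrace_prod_rot1 prodg_rot1 betaJ prod_rot1.
move=> i w leiN rotw.
have [v sv Ew] := rotation_fixed_power (prime_gt0 p_pr) leiN rotw.
apply: filt_natmul_p; first exact: leqW.
apply: filt_mulrz; rewrite Ew prod_flatten_nseq prodg_flatten_nseq subSn //.
exact/D_beta/map_pi_prod.
Qed.

End FilteredRing.

(** * Z[X] as a substitute for p-adic integers, and Teichmueller lifts *)

Lemma cofactor_neq0_at_root (R : idomainType) (d k : {poly R}) e (w : R) :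
  d * k = 'X^e - 1 -> e%:R != 0 :> R -> w != 0 -> d.[w] = 0 -> k.[w] != 0.
Proof.
move=> E e0 w0 dw; apply/eqP => kw.
have := congr1 (fun q => (deriv q).[w]) E.
rewrite derivM !hornerE dw kw !mul0r !mulr0 addr0 derivB derivXn derivC subr0.
rewrite hornerMn hornerXn => /esym/eqP; rewrite -mulr_natl mulf_eq0 (negbTE e0) /=.
by rewrite expf_eq0 (negbTE w0) andbF.
Qed.

Lemma poly_int_lift_Fp p : exists lift : {poly 'F_p} -> {poly int},
  forall q, map_poly intr (lift q) = q.
Proof.
exists (fun q => map_poly (fun a : 'F_p => (a : nat)%:Z) q) => q.
rewrite -map_poly_comp_id0 //; apply/polyP => i; rewrite coef_map_id0 /=; last by [].
by rewrite -pmulrn natr_Zp.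
Qed.

Lemma poly_int_Fp_eq0 p (z : {poly int}) : prime p ->
  map_poly (intr : int -> 'F_p) z = 0 -> exists a, z = p%:R * a.
Proof.
move=> p_pr /polyP z0; exists (map_poly (fun c => (c %/ p)%Z) z).
apply/polyP => i; rewrite -polyC_natr coefCM coef_map_id0 ?div0z //.
have := z0 i; rewrite coef_map coef0 /= => /eqP.
by rewrite -(dvdz_pcharf (pchar_Fp p_pr)) => /divzK {1}<-; rewrite mulrC natz.
Qed.

Lemma map_intr_phi (A B : nzRingType) (phi : {rmorphism A -> B}) (z : {poly int}) :
  map_poly phi (map_poly intr z) = map_poly intr z.
Proof.
by rewrite -map_poly_comp_id0 ?rmorph0 //; apply: eq_map_poly => a /=; rewrite rmorph_int.
Qed.

Section ResidueKernel.
Variables (L : fieldType) (p e : nat) (phi : {rmorphism 'F_p -> L}) (w : L).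
Hypotheses (p_pr : prime p) (e0 : e%:R != 0 :> L) (we : w ^+ e = 1).

(* X^e - 1 is separable modulo p, so a polynomial coprime to its factor
   vanishing at w sends the whole kernel of evaluation at w to (p, X^e - 1). *)
Lemma residue_kernel_phi (z : {poly int}) : (map_poly intr z).[w] = 0 ->
  exists y a b, (map_poly intr y).[w] != 0 /\ y * z = p%:R * a + ('X^e - 1) * b.
Proof.
move=> zw; have e_gt0 : (0 < e)%N by case: e e0 => //; rewrite eqxx.
have w0 : w != 0.
  by apply: contra_eq_neq we => ->; rewrite expr0n gtn_eqF // eq_sym oner_eq0.
have [lift liftP] := poly_int_lift_Fp p.
pose zb := map_poly (intr : int -> 'F_p) z; pose Q : {poly 'F_p} := 'X^e - 1.
pose d := gcdp zb Q.
have dw : (map_poly phi d).[w] = 0.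
  have [[u v] /= Euv] := Bezoutp zb Q.
  apply/eqP; rewrite -/(root _ _) -(eqp_root (_ : map_poly phi (u * zb + v * Q) %= _)).
    rewrite rootE rmorphD !rmorphM /= map_intr_phi hornerD !hornerM zw mulr0 add0r.
    by rewrite /Q rmorphB /= map_polyXn rmorph1 !hornerE we subrr mulr0.
  by rewrite eqp_map.
have /dvdpP[k Ek] : d %| Q by apply: dvdp_gcdr.
have /dvdpP[z' Ez'] : d %| zb by apply: dvdp_gcdl.
have kw : (map_poly phi k).[w] != 0.
  apply: (cofactor_neq0_at_root (e := e) (d := map_poly phi d)) => //.
  by rewrite -rmorphM mulrC -Ek /Q rmorphB /= map_polyXn rmorph1.
exists (lift k).
have : map_poly (intr : int -> 'F_p) (lift k * z - ('X^e - 1) * lift z') = 0.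
  rewrite rmorphB !rmorphM rmorphB /= !liftP map_polyXn rmorph1 -/zb -/Q Ek Ez'.
  by apply/eqP; rewrite subr_eq0; apply/eqP; ring.
case/(poly_int_Fp_eq0 p_pr) => a Ea; exists a, (lift z'); split.
  by rewrite -(map_intr_phi phi) liftP.
by rewrite -Ea subrK.
Qed.
End ResidueKernel.

Lemma Fp_rmorphism (L : fieldType) p : p \in [pchar L] -> exists phi : {rmorphism 'F_p -> L}, True.
Proof.
move=> ch; have p_pr := pcharf_prime ch.
pose f (a : 'F_p) : L := (a : nat)%:R.
have fn n : f n%:R = n%:R by rewrite /f val_Fp_nat // GRing.natr_mod_pchar.
have fD a b : f (a + b) = f a + f b by rewrite -(natr_Zp a) -(natr_Zp b) -natrD !fn natrD.
have fB : zmod_morphism f by move=> a b; rewrite -[in RHS](subrK b a) (fD (a - b)) addrK.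
have fM : monoid_morphism f.
  split=> [|a b]; first exact: (fn 1%N).
  by rewrite -(natr_Zp a) -(natr_Zp b) -natrM !fn natrM.
pose fA := GRing.isZmodMorphism.Build _ _ f fB.
pose fMM := GRing.isMonoidMorphism.Build _ _ f fM.
by exists (HB.pack f fA fMM : {rmorphism _ -> _}).
Qed.

Lemma residue_kernel (L : fieldType) p e (w : L) (z : {poly int}) : p \in [pchar L] ->
  e%:R != 0 :> L -> w ^+ e = 1 -> (map_poly intr z).[w] = 0 ->
  exists y a b, (map_poly intr y).[w] != 0 /\ y * z = p%:R * a + ('X^e - 1) * b.
Proof.
move=> ch; have [phi _] := Fp_rmorphism ch.
move=> e0 we zw; exact: (residue_kernel_phi phi (pcharf_prime ch) e0 we zw).
Qed.

Lemma Cyclotomic_root (L : fieldType) e (w : L) : e.-primitive_root w ->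
  (map_poly intr 'Phi_e).[w] = 0.
Proof.
move=> prim_w; have e_gt0 := prim_order_gt0 prim_w.
have : \prod_(d <- divisors e) (map_poly (intr : int -> L) 'Phi_d).[w] = 0.
  rewrite -horner_prod -rmorph_prod prod_Cyclotomic // rmorphB /= map_polyXn rmorph1.
  by rewrite !hornerE (prim_expr_order prim_w) subrr.
move/eqP; rewrite prodf_seq_eq0 => /hasP[d]; rewrite -dvdn_divisors // => de /= /eqP dw.
suff ed : (e %| d)%N by have -> : e = d by apply/eqP; rewrite eqn_dvd ed de.
have d_gt0 := dvdn_gt0 e_gt0 de.
rewrite (prim_order_dvd prim_w) -subr_eq0.
have := congr1 (fun q => (map_poly (intr : int -> L) q).[w]) (prod_Cyclotomic d_gt0).
rewrite /= rmorphB /= map_polyXn rmorph1 !hornerE => <-.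
rewrite rmorph_prod horner_prod prodf_seq_eq0; apply/hasP; exists d => //=.
  by rewrite -dvdn_divisors.
by rewrite dw.
Qed.

(* Elimination between z and the cyclotomic polynomial. *)
Lemma Cyclotomic_bezout e (omega : algC) (z : {poly int}) : e.-primitive_root omega ->
  (map_poly intr z).[omega] != 0 ->
  exists u v (c : int), c != 0 /\ u * z + v * 'Phi_e = c%:P.
Proof.
move=> prim_om zom.
pose Phi : {poly rat} := map_poly intr 'Phi_e; pose zq : {poly rat} := map_poly intr z.
have ratr_intr (q : {poly int}) : map_poly (ratr : rat -> algC) (map_poly intr q) = map_poly intr q.
  exact: map_intr_phi.
have Phi_min q : root (map_poly (ratr : rat -> algC) q) omega = (Phi %| q).
  have [m [minE _] minP] := minCpolyP omega.
  rewrite minP; congr (_ %| _); apply: (map_poly_inj (ratr : {rmorphism rat -> algC})).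
  by rewrite -minE (minCpoly_cyclotomic prim_om) -Cintr_Cyclotomic // ratr_intr.
have Phi0 : Phi != 0.
  by rewrite monic_neq0 // monic_map ?Cyclotomic_monic.
have cop : coprimep zq Phi.
  rewrite coprimep_def; set g := gcdp zq Phi.
  have /dvdpP[h Eh] : g %| Phi by apply: dvdp_gcdr.
  have h0 : h != 0 by apply: contraNneq Phi0 => h0; rewrite Eh h0 mul0r.
  have g0 : g != 0 by apply: contraNneq Phi0 => g0; rewrite Eh g0 mulr0.
  have : root (map_poly (ratr : rat -> algC) (h * g)) omega by rewrite Phi_min -Eh dvdpp.
  rewrite rmorphM rootM !Phi_min => /orP[/dvdp_leq|Pg].
    move/(_ h0); rewrite Eh size_mul // -subn1 leq_subLR add1n.
    have : (0 < size g)%N by rewrite size_poly_gt0.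
    by move: (size h) (size g) => a b; lia.
  case/negP: zom; rewrite -rootE -ratr_intr Phi_min; apply: dvdp_trans Pg (dvdp_gcdl _ _).
have [[u v] /= Euv] := Bezout_eq1_coprimepP _ _ cop.
have [u1 [a a0 Eu]] := rat_poly_scale u; have [v1 [b b0 Ev]] := rat_poly_scale v.
exists (b *: u1), (a *: v1), (a * b); split; first by rewrite mulf_neq0.
apply: (map_inj_poly (f := intr : int -> rat) (@intr_inj _)) => //.
have a0' : a%:~R != 0 :> rat by rewrite intr_eq0.
have b0' : b%:~R != 0 :> rat by rewrite intr_eq0.
have Eu1 : map_poly intr u1 = a%:~R *: u by rewrite Eu scalerA divff // scale1r.
have Ev1 : map_poly intr v1 = b%:~R *: v by rewrite Ev scalerA divff // scale1r.
rewrite rmorphD !rmorphM /= !map_polyZ map_polyC /= -/zq -/Phi Eu1 Ev1.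
rewrite map_polyC /= -polyCM -[RHS]mulr1 -Euv mul_polyC scalerDr -!scalerAl !scalerA.
by rewrite [b%:~R * _]mulrC.
Qed.

Lemma primitive_root_expr_neq0 (F : fieldType) n (z : F) i :
  n.-primitive_root z -> z ^+ i != 0.
Proof.
move=> prim_z; rewrite expf_neq0 //.
apply: contra_eq_neq (prim_expr_order prim_z) => ->.
by rewrite expr0n gtn_eqF ?(prim_order_gt0 prim_z) // eq_sym oner_eq0.
Qed.

Section Teichmuller.
Variables (L : finFieldType) (p : nat) (w : L) (omega : algC).
Hypothesis ch : p \in [pchar L].
Let e := #|L|.-1.
Hypotheses (prim_w : e.-primitive_root w) (prim_om : e.-primitive_root omega).

Let e_gt0 : (0 < e)%N := prim_order_gt0 prim_w.

Definition resid (z : {poly int}) : L := (horner_eval w \o map_poly intr) z.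

Lemma resid_is_zmod_morphism : zmod_morphism resid.
Proof. by move=> x y; rewrite /resid rmorphB. Qed.
Lemma resid_is_monoid_morphism : monoid_morphism resid.
Proof. by split=> [|x y]; rewrite /resid ?rmorph1 ?rmorphM. Qed.
HB.instance Definition _ := GRing.isZmodMorphism.Build _ _ resid resid_is_zmod_morphism.
HB.instance Definition _ := GRing.isMonoidMorphism.Build _ _ resid resid_is_monoid_morphism.

Lemma resid_horner z : resid z = (map_poly intr z).[w]. Proof. by []. Qed.

(* Membership in p^j Z[X]/(X^e - 1), after localisation at the kernel of the
   evaluation at w. *)
Definition padic_filt j (z : {poly int}) :=
  exists y a b, resid y != 0 /\ y * z = p%:R ^+ j * a + ('X^e - 1) * b.

Lemma padic_filt_add j x y : padic_filt j x -> padic_filt j y -> padic_filt j (x + y).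
Proof.
move=> [y1 [a1 [b1 [n1 E1]]]] [y2 [a2 [b2 [n2 E2]]]].
exists (y1 * y2), (y2 * a1 + y1 * a2), (y2 * b1 + y1 * b2).
rewrite rmorphM mulf_neq0 //; split=> //.
transitivity (y2 * (y1 * x) + y1 * (y2 * y)); first by ring.
by rewrite E1 E2; ring.
Qed.

Lemma padic_filt_top x : padic_filt 0 x.
Proof. by exists 1, x, 0; rewrite rmorph1 oner_neq0; split=> //; ring. Qed.

Lemma padic_filt_prod i j x y : padic_filt i x -> padic_filt j y -> padic_filt (i + j) (x * y).
Proof.
move=> [y1 [a1 [b1 [n1 E1]]]] [y2 [a2 [b2 [n2 E2]]]].
exists (y1 * y2), (a1 * a2), (p%:R ^+ i * a1 * b2 + b1 * (p%:R ^+ j * a2 + ('X^e - 1) * b2)).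
rewrite rmorphM mulf_neq0 //; split=> //.
transitivity ((y1 * x) * (y2 * y)); first by ring.
by rewrite E1 E2 exprD; ring.
Qed.

Lemma padic_filt_mono j x : padic_filt j.+1 x -> padic_filt j x.
Proof.
move=> [y [a [b [n E]]]]; exists y, (p%:R * a), b; split=> //.
by rewrite E exprSr mulrA.
Qed.

Lemma padic_filt_p : padic_filt 1 p%:R.
Proof. by exists 1, 1, 0; rewrite rmorph1 oner_neq0; split=> //; ring. Qed.

Lemma card_pred_neq0 : e%:R != 0 :> L.
Proof.
have E : #|L| = (p ^ logn p #|L|)%N := card_pprimeChar ch.
have L1 : (1 < #|L|)%N by apply: finNzRing_gt1.
have L0 : #|L|%:R = 0 :> L.
  move: L1; rewrite E; case: (logn _ _) => // m _.
  by rewrite expnS natrM (pcharf0 ch) mul0r.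
apply: contra_eq_neq L0 => e0.
by rewrite -[#|L|]prednK ?(ltnW L1) // -addn1 natrD e0 add0r oner_neq0.
Qed.

Lemma padic_filt_ker z : resid z = 0 -> padic_filt 1 z.
Proof.
move=> rz; have we := prim_expr_order prim_w.
have [y [a [b [yw E]]]] := residue_kernel ch card_pred_neq0 we rz.
by exists y, a, b.
Qed.

(** Otherwise u z + v Phi_e = c for a nonzero integer c. Multiplying by y and taking remainders
    modulo Phi_e gives c y0 = p^j a0; with j >= |c| the power p^j exceeds |c|, so p divides every
    coefficient of y0, against [resid y != 0]. *)
Lemma padic_filt_inter z : (forall N, exists j, (N <= j)%N /\ padic_filt j z) ->
  (map_poly intr z).[omega] = 0.
Proof.
move=> zI; apply/eqP; apply: contraT => zom.
have [u [v [c [c0 Euv]]]] := Cyclotomic_bezout prim_om zom.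
have [j [lecj [y [a [b [yw E]]]]]] := zI `|c|%N.
have [Q EQ] : exists Q, 'X^e - 1 = 'Phi_e * Q.
  rewrite -prod_Cyclotomic //; exists (\prod_(d <- divisors e | d != e) 'Phi_d).
  by rewrite (bigD1_seq e) ?divisors_uniq //= -dvdn_divisors.
have monP := Cyclotomic_monic e.
pose y0 := Pdiv.Ring.rmodp y 'Phi_e; pose a0 := Pdiv.Ring.rmodp (u * a) 'Phi_e.
have Ey := Pdiv.RingMonic.rdivp_eq monP y; have Ea := Pdiv.RingMonic.rdivp_eq monP (u * a).
rewrite -/y0 in Ey; rewrite -/a0 in Ea.
set y1 := Pdiv.Ring.rdivp y _ in Ey; set a1 := Pdiv.Ring.rdivp _ _ in Ea.
have Phi0 : 'Phi_e != 0 by apply: monic_neq0.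
have Ecy : c%:P * y0 - p%:R ^+ j * a0 =
    'Phi_e * (v * y + p%:R ^+ j * a1 + Q * b * u - c%:P * y1).
  have E3 : c%:P * y = p%:R ^+ j * (u * a) + 'Phi_e * (Q * b * u + v * y).
    rewrite -Euv; transitivity (u * (y * z) + 'Phi_e * (v * y)); first by ring.
    by rewrite E EQ; ring.
  transitivity (c%:P * (y1 * 'Phi_e + y0) - p%:R ^+ j * (a1 * 'Phi_e + a0)
     - 'Phi_e * (c%:P * y1 - p%:R ^+ j * a1)); first by ring.
  by rewrite -Ey -Ea E3; ring.
have Ecy0 : c%:P * y0 = p%:R ^+ j * a0.
  apply/eqP; rewrite -subr_eq0 Ecy; apply: contraT => ne0.
  have : (size (c%:P * y0 - p%:R ^+ j * a0)%R < size 'Phi_e)%N.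
    rewrite -polyC_natr -polyC_exp !mul_polyC.
    apply: leq_ltn_trans (size_polyD _ _) _; rewrite gtn_max size_polyN.
    by rewrite !(leq_ltn_trans (size_scale_leq _ _)) // Pdiv.Ring.ltn_rmodp.
  rewrite Ecy size_monicM //; last by apply: contraNneq ne0 => ->; rewrite mulr0.
  have : (0 < size (v * y + p%:R ^+ j * a1 + Q * b * u - c%:P * y1)%R)%N.
    by rewrite size_poly_gt0; apply: contraNneq ne0 => ->; rewrite mulr0.
  by move: (size _) (size _) => m1 m2; lia.
have p_pr := pcharf_prime ch.
have coef_y0 i : (p %| y0`_i)%Z.
  apply: contraT => np.
  have : ((p ^ j)%N %| c * y0`_i)%Z.
    rewrite -coefCM Ecy0 -polyC_natr -polyC_exp coefCM -natrX natz.
    exact: dvdz_mulr.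
  rewrite !dvdzE abszM /= Gauss_dvdl; last first.
    by rewrite coprimeXl // prime_coprime // -dvdzE.
  move/dvdn_leq; rewrite absz_gt0 c0 => /(_ isT); rewrite leqNgt; case/negP.
  by apply: leq_ltn_trans lecj _; apply/ltn_expl/prime_gt1.
case/negP: yw; rewrite Ey rmorphD rmorphM /= [resid 'Phi_e]Cyclotomic_root // mulr0 add0r.
have -> : y0 = p%:R * map_poly (fun c => (c %/ p)%Z) y0.
  apply/polyP => i; rewrite -polyC_natr coefCM coef_map_id0 ?div0z //.
  by rewrite natz mulrC divzK.
by rewrite rmorphM rmorph_nat (pcharf0 ch) mul0r.
Qed.

(** The Teichmueller lift written on exponents: w^i goes to X^i, to be evaluated at [omega]. It is
    multiplicative only modulo X^e - 1. *)
Definition teich (x : L) : {poly int} :=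
  if [pick i : 'I_e | w ^+ i == x] is Some i then 'X^i else 0.

Lemma expr_card_pred (x : L) : x != 0 -> x ^+ e = 1.
Proof.
move=> x0; apply: (mulfI x0); rewrite -exprS prednK ?expf_card ?mulr1 //.
exact/ltnW/finNzRing_gt1.
Qed.

Lemma teich_unit (x : L) : x != 0 -> exists2 i : nat, x = w ^+ i & teich x = 'X^i :> {poly int}.
Proof.
move=> x0; rewrite /teich; case: pickP => [i /eqP <-|none]; first by exists i.
have [i Ei] := prim_rootP prim_w (expr_card_pred x0).
by have := none i; rewrite Ei eqxx.
Qed.

Lemma teich0 : teich 0 = 0.
Proof.
rewrite /teich; case: pickP => // i; by rewrite (negbTE (primitive_root_expr_neq0 i prim_w)).
Qed.

Lemma teichK : cancel teich resid.
Proof.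
move=> x; have [->|x0] := eqVneq x 0; first by rewrite teich0 rmorph0.
have [i Ex ->] := teich_unit x0.
by rewrite resid_horner map_polyXn hornerXn Ex.
Qed.

Lemma Xn_congr i j k : i = j %[mod e] -> padic_filt k ('X^i - 'X^j : {poly int}).
Proof.
wlog leij : i j / (i <= j)%N.
  move=> H ij; have [lij|/ltnW lji] := leqP i j; first exact: H.
  have [y [a [b [yn E]]]] := H _ _ lji (esym ij).
  by exists y, (- a), (- b); split=> //; rewrite -opprB mulrN E; ring.
move/esym/eqP; rewrite eqn_mod_dvd // => /dvdnP[m Em].
exists 1, 0, (- ('X^i * \sum_(t < m) ('X^e) ^+ t)); rewrite rmorph1 oner_neq0; split=> //.
rewrite mulr0 add0r mul1r mulrN mulrCA -subrX1 -exprM [(e * m)%N]mulnC -Em mulrBr mulr1.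
by rewrite -exprD subnKC // opprB.
Qed.

Lemma teich_expr (x : L) q k : x != 0 -> padic_filt k (teich x ^+ q - teich (x ^+ q)).
Proof.
move=> x0; have [i Ex ->] := teich_unit x0.
have [j Exq ->] := teich_unit (expf_neq0 q x0).
rewrite -exprM; apply: Xn_congr; apply/eqP.
by rewrite -(eq_prim_root_expr prim_w) -Exq exprM -Ex.
Qed.

Definition teichC x : algC := (map_poly intr (teich x)).[omega].

Lemma teichC_root i : teichC (w ^+ i) = omega ^+ i.
Proof.
have [j Ej Et] := teich_unit (primitive_root_expr_neq0 i prim_w); rewrite /teichC Et map_polyXn hornerXn.
by apply/eqP; rewrite (eq_prim_root_expr prim_om) -(eq_prim_root_expr prim_w) Ej.
Qed.

Lemma root_power (x : L) : x != 0 -> exists i, x = w ^+ i.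
Proof. by move=> /teich_unit[i]; exists i. Qed.

Lemma teichCM (x y : L) : x != 0 -> y != 0 -> teichC (x * y) = teichC x * teichC y.
Proof.
by move=> /root_power[i ->] /root_power[j ->]; rewrite -exprD !teichC_root exprD.
Qed.

Lemma teichC1 : teichC 1 = 1.
Proof. by rewrite -(expr0 w) teichC_root. Qed.

Lemma teichCX (x : L) m : x != 0 -> teichC (x ^+ m) = teichC x ^+ m.
Proof. by move=> /root_power[i ->]; rewrite -exprM !teichC_root exprM. Qed.

Lemma teichC_inj (x y : L) : x != 0 -> y != 0 -> teichC x = teichC y -> x = y.
Proof.
move=> /root_power[i ->] /root_power[j ->]; rewrite !teichC_root => /eqP.
by rewrite (eq_prim_root_expr prim_om) -(eq_prim_root_expr prim_w) => /eqP.
Qed.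

Lemma teichC_neq0 (x : L) : x != 0 -> teichC x != 0.
Proof.
by move=> /root_power[i ->]; rewrite teichC_root (primitive_root_expr_neq0 i prim_om).
Qed.

Lemma teichCV (x : L) : x != 0 -> teichC x^-1 = (teichC x)^-1.
Proof.
move=> x0; apply: (mulfI (teichC_neq0 x0)).
by rewrite -teichCM ?invr_eq0 // divff // teichC1 divff // teichC_neq0.
Qed.

End Teichmuller.

(** * Symmetric powers and conjugacy in PSL(2, q) *)

Section SymmetricPower.
Variable K : comNzRingType.
Implicit Types (A B : 'M[K]_2) (al de P Q : {poly K}).

Definition linear_poly (a b : K) : {poly K} := a *: 'X + b%:P.

(** P stands for the form of degree m that becomes P at Y = 1; [al] and [de] are substituted for X
    and Y. *)
Definition homog_subst m al de P : {poly K} :=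
  \sum_(i < m.+1) P`_i *: (al ^+ i * de ^+ (m - i)).

Lemma homog_substD m al de P Q :
  homog_subst m al de (P + Q) = homog_subst m al de P + homog_subst m al de Q.
Proof. by rewrite -big_split; apply: eq_bigr => i _; rewrite coefD scalerDl. Qed.

Lemma homog_substZ m al de c P : homog_subst m al de (c *: P) = c *: homog_subst m al de P.
Proof. by rewrite scaler_sumr; apply: eq_bigr => i _; rewrite coefZ scalerA. Qed.

Lemma homog_subst_sum m al de (T : Type) (s : seq T) (F : T -> {poly K}) :
  homog_subst m al de (\sum_(t <- s) F t) = \sum_(t <- s) homog_subst m al de (F t).
Proof.
apply: (big_morph (homog_subst m al de)) => [x y|]; first exact: homog_substD.
by rewrite /homog_subst big1 // => i _; rewrite coef0 scale0r.
Qed.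

Lemma homog_substXn m al de i : (i <= m)%N ->
  homog_subst m al de 'X^i = al ^+ i * de ^+ (m - i).
Proof.
rewrite -ltnS => im; rewrite /homog_subst (bigD1 (Ordinal im)) //= coefXn eqxx scale1r.
rewrite big1 ?addr0 // => j; rewrite -val_eqE /= => /negbTE ji.
by rewrite coefXn ji scale0r.
Qed.

Lemma poly_sum_coef a P : (size P <= a.+1)%N -> P = \sum_(i < a.+1) P`_i *: 'X^i.
Proof.
move=> sP; apply/polyP => j; rewrite coef_sum.
under eq_bigr do rewrite coefZ coefXn.
have [ja|ja] := ltnP j a.+1.
  rewrite (bigD1 (Ordinal ja)) //= eqxx mulr1 big1 ?addr0 // => i; rewrite -val_eqE /= eq_sym.
  by move/negbTE->; rewrite mulr0.
rewrite nth_default ?(leq_trans sP) // big1 // => i _.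
by rewrite gtn_eqF ?mulr0 // (leq_trans (ltn_ord i)).
Qed.

Lemma homog_substM a b al de P Q : (size P <= a.+1)%N -> (size Q <= b.+1)%N ->
  homog_subst (a + b) al de (P * Q) = homog_subst a al de P * homog_subst b al de Q.
Proof.
move=> sP sQ; rewrite {1}(poly_sum_coef sP) {1}(poly_sum_coef sQ) mulr_suml homog_subst_sum.
rewrite [homog_subst a _ _ _]/homog_subst mulr_suml; apply: eq_bigr => i _.
rewrite mulr_sumr homog_subst_sum [homog_subst b _ _ _]/homog_subst mulr_sumr.
apply: eq_bigr => j _.
have [ia jb] : (i <= a)%N /\ (j <= b)%N by split; rewrite -ltnS.
rewrite -scalerAl -scalerAr !homog_substZ -exprD homog_substXn ?leq_add //.
rewrite -scalerAl -scalerAr; congr (_ *: (_ *: _)).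
have -> : (a + b - (i + j) = (a - i) + (b - j))%N by lia.
by rewrite !exprD; ring.
Qed.

Lemma size_linear_poly a b : (size (linear_poly a b) <= 2)%N.
Proof.
apply: leq_trans (size_polyD _ _) _; rewrite geq_max (leq_trans (size_scale_leq _ _)) ?size_polyX //.
exact: leq_trans (size_polyC_leq1 _) _.
Qed.

Lemma size_linear_polyX a b i : (size (linear_poly a b ^+ i) <= i.+1)%N.
Proof.
apply: leq_trans (size_poly_exp_leq _ _) _; rewrite ltnS.
by have := size_linear_poly a b; case: (size _) => [|[|[|]]] //= _; rewrite ?mul0n ?mul1n.
Qed.

Lemma homog_subst_linear al de a b : homog_subst 1 al de (linear_poly a b) = a *: al + b *: de.
Proof.
have EX : homog_subst 1 al de 'X = al.
  by have := @homog_substXn 1 al de 1 isT; rewrite !expr1 subnn expr0 mulr1.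
have E1 : homog_subst 1 al de 1 = de.
  by have := @homog_substXn 1 al de 0 isT; rewrite !expr0 subn0 mul1r.
by rewrite /linear_poly homog_substD homog_substZ EX -[b%:P]mulr1 mul_polyC homog_substZ E1.
Qed.

Lemma homog_subst_linearX al de a b i :
  homog_subst i al de (linear_poly a b ^+ i) = (a *: al + b *: de) ^+ i.
Proof.
elim: i => [|i IHi].
  by have := @homog_substXn 0 al de 0 isT; rewrite !expr0 mul1r.
rewrite exprS -[i.+1]add1n homog_substM ?size_linear_poly ?size_linear_polyX //.
by rewrite IHi homog_subst_linear exprS.
Qed.

Definition sym_row m A i : {poly K} :=
  linear_poly (A 0 0) (A 0 1) ^+ i * linear_poly (A 1 0) (A 1 1) ^+ (m - i).

(* Row i holds the coefficients of the image of X^i Y^(m - i), at Y = 1. *)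
Definition sym_mx m A : 'M[K]_m.+1 := \matrix_(i, j) (sym_row m A i)`_j.

Lemma mulmx2E A B i j : (A *m B) i j = A i 0 * B 0 j + A i 1 * B 1 j.
Proof. by rewrite mxE big_ord_recl big_ord1; congr (_ + A i _ * B _ _); apply: val_inj. Qed.

Lemma homog_subst_sym_row m A B i : (i <= m)%N ->
  homog_subst m (linear_poly (B 0 0) (B 0 1)) (linear_poly (B 1 0) (B 1 1)) (sym_row m A i)
  = sym_row m (A *m B) i.
Proof.
move=> im; rewrite /sym_row -{1}(subnKC im) homog_substM ?size_linear_polyX //.
rewrite !homog_subst_linearX; congr (_ ^+ _ * _ ^+ _).
  by rewrite /linear_poly !mulmx2E !scalerDr !scalerDl polyCD !polyCM -!mul_polyC; ring.
by rewrite /linear_poly !mulmx2E !scalerDr !scalerDl polyCD !polyCM -!mul_polyC; ring.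
Qed.

(** Substituting the two linear forms of B into row i for A gives row i for A B; on coefficients
    this substitution is the matrix product. *)
Lemma sym_mxM m A B : sym_mx m (A *m B) = sym_mx m A *m sym_mx m B.
Proof.
apply/matrixP => i j; have im : (i <= m)%N by rewrite -ltnS.
rewrite mxE -homog_subst_sym_row // coef_sum mxE.
by apply: eq_bigr => l _; rewrite !mxE coefZ.
Qed.

Lemma sym_mx1 m : sym_mx m 1%:M = 1%:M.
Proof.
apply/matrixP => i j; rewrite !mxE /sym_row !mxE /linear_poly /=.
rewrite !(mulr1n, mulr0n) scale1r scale0r addr0 add0r expr1n mulr1 coefXn.
by rewrite eq_sym val_eqE; case: eqP.
Qed.

Lemma sym_mxN m A : ~~ odd m -> sym_mx m (- A) = sym_mx m A.
Proof.
move=> om; apply/matrixP => i j; rewrite !mxE /sym_row !mxE /linear_poly.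
have linN a b : - a *: 'X + (- b)%:P = - (a *: 'X + b%:P) :> {poly K}.
  by rewrite scaleNr polyCN opprD.
have im : (i <= m)%N by rewrite -ltnS.
rewrite !linN (exprNn _ i) (exprNn _ (m - i)) mulrACA -exprD subnKC // -signr_odd (negbTE om) expr0 mul1r.
by [].
Qed.

Lemma sym_mx_trig m A : A 1 0 = 0 ->
  is_trig_mx (sym_mx m A) /\ forall i : 'I_m.+1, sym_mx m A i i = A 0 0 ^+ i * A 1 1 ^+ (m - i).
Proof.
move=> A10.
have rowE i : sym_row m A i = A 1 1 ^+ (m - i) *: linear_poly (A 0 0) (A 0 1) ^+ i.
  by rewrite /sym_row A10 {2}/linear_poly scale0r add0r -polyC_exp mulrC mul_polyC.
split=> [|i].
  apply/is_trig_mxP => i j ij; rewrite mxE rowE coefZ nth_default ?mulr0 //.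
  exact: leq_trans (size_linear_polyX _ _ _) ij.
rewrite mxE rowE coefZ mulrC; congr (_ * _).
elim: (i : nat) => [|k IHk]; first by rewrite !expr0 coef1.
rewrite exprS /linear_poly mulrDl coefD mul_polyC coefZ -scalerAl coefZ coefXM /=.
rewrite -/(linear_poly _ _) IHk [X in _ + _ * X]nth_default ?size_linear_polyX //.
by rewrite mulr0 addr0 exprS.
Qed.

End SymmetricPower.

Section MatrixTwo.
Variable K : comNzRingType.
Implicit Type A : 'M[K]_2.

Definition pair_mx (a b c d : K) : 'M[K]_2 :=
  \matrix_(i, j) (if i == 0 then if j == 0 then a else b else if j == 0 then c else d).

Lemma I2P (i : 'I_2) : i = 0 \/ i = 1.
Proof. by case: i => [[|[|]]] // p; [left | right]; apply: val_inj. Qed.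

Lemma mx2P (A B : 'M[K]_2) : A 0 0 = B 0 0 -> A 0 1 = B 0 1 -> A 1 0 = B 1 0 -> A 1 1 = B 1 1 -> A = B.
Proof. by move=> *; apply/matrixP => i j; case: (I2P i) => ->; case: (I2P j) => ->. Qed.

Lemma det_mx2 A : \det A = A 0 0 * A 1 1 - A 0 1 * A 1 0.
Proof.
rewrite (expand_det_row _ 0) big_ord_recl big_ord1 /cofactor !det_mx11 !mxE /=.
have -> : lift 0 0 = 1 :> 'I_2 by apply: val_inj.
have -> : lift 1 0 = 0 :> 'I_2 by apply: val_inj.
by rewrite expr0 mul1r expr1 mulN1r mulrN.
Qed.

Lemma trace_mx2 A : \tr A = A 0 0 + A 1 1.
Proof.
rewrite /mxtrace big_ord_recl big_ord1; congr (_ + A _ _); exact: val_inj.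
Qed.

Lemma cayley_hamilton2 A : \det A = 1 -> A *m A = \tr A *: A - 1%:M.
Proof.
rewrite det_mx2 trace_mx2 => dA; apply: mx2P; rewrite mulmx2E !mxE /= -?dA; ring.
Qed.

End MatrixTwo.

(** * PSL(2, q) as matrices of determinant 1 up to sign *)

Section ProjectiveSpecialLinear.
Variable F : finFieldType.
Local Notation GL := {'GL_2[F]}.
Local Notation G := (PSL2 F).
Implicit Types (g h : G) (A B : 'M[F]_2).

Lemma GLvalM (x y : GL) : GLval (x * y)%g = GLval x *m GLval y.
Proof. by []. Qed.

Lemma mem_SL2 (x : GL) : (x \in SL2 F) = (\det (GLval x) == 1).
Proof. by rewrite inE. Qed.

Lemma exists_SL2 A : \det A = 1 -> exists2 x : GL, x \in SL2 F & GLval x = A.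
Proof.
move=> dA; have uA : A \is a GRing.unit by rewrite -[_ \is a _]/(A \in unitmx) unitmxE dA unitr1.
by exists (FinRing.unit _ uA); rewrite // mem_SL2 /= dA.
Qed.

(** Commuting with the two elementary matrices forces a scalar matrix, and determinant 1 makes its
    entry a square root of 1. *)
Lemma center_SL2 (z : GL) : (z \in 'Z(SL2 F)%g) = (GLval z == 1%:M) || (GLval z == - 1%:M).
Proof.
apply/idP/orP => [/centerP[zS zC]|].
  have dx : \det (pair_mx (1 : F) 1 0 1) = 1 by rewrite det_mx2 !mxE /=; ring.
  have dy : \det (pair_mx (1 : F) 0 1 1) = 1 by rewrite det_mx2 !mxE /=; ring.
  have [[x xS xE] [y yS yE]] := (exists_SL2 dx, exists_SL2 dy).
  have /matrixP Ex := congr1 (@GLval _ _) (zC _ xS); have /matrixP Ey := congr1 (@GLval _ _) (zC _ yS).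
  rewrite !GLvalM xE yE in Ex Ey.
  have := Ex 0 0; have := Ex 0 1; have := Ey 0 0; have := Ey 1 0; rewrite !mulmx2E !mxE /=.
  rewrite !(mulr0, mul0r, mulr1, mul1r, addr0, add0r) => E1 E2 E3 E4.
  have c0 : GLval z 1 0 = 0.
    by apply: (@addrI _ (GLval z 0 0)); rewrite addr0 -E4.
  have b0 : GLval z 0 1 = 0.
    by apply: (@addrI _ (GLval z 0 0)); rewrite addr0 E2.
  have ad : GLval z 0 0 = GLval z 1 1.
    by move: E3; rewrite b0 addr0 add0r.
  move: zS; rewrite mem_SL2 det_mx2 c0 mulr0 subr0 ad -expr2 sqrf_eq1.
  by case/orP=> /eqP d1; [left | right]; apply/eqP/mx2P; rewrite !mxE /= ?ad ?b0 ?c0 ?d1 ?oppr0.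
move=> zE; have zc : exists c : F, GLval z = c%:M /\ c ^+ 2 = 1.
  case: zE => /eqP->; first by exists 1; rewrite expr1n.
  by exists (-1); rewrite sqrrN expr1n; split=> //; apply/matrixP => i j; rewrite !mxE mulNrn.
have [c [zEc c1]] := zc.
apply/centerP; split; first by rewrite mem_SL2 zEc det_scalar c1.
by move=> x _; apply/val_inj; rewrite /= [LHS]GLvalM [RHS]GLvalM zEc scalar_mxC.
Qed.

(** An arbitrary choice of matrix above g, hence multiplicative only up to sign; the lemmas below
    carry that sign as an alternative. *)
Definition sl_rep g : 'M[F]_2 := GLval (repr (sgval g)).

Definition pr_SL2 (x : GL) : G := subg (SL2 F / 'Z(SL2 F))%G (coset 'Z(SL2 F) x).

Lemma SL2_norm (x : GL) : x \in SL2 F -> x \in 'N('Z(SL2 F))%g.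
Proof. by apply/subsetP; rewrite normal_norm ?center_normal. Qed.

Lemma pr_SL2M : {in SL2 F &, {morph pr_SL2 : x y / (x * y)%g}}.
Proof.
move=> x y xS yS; rewrite /pr_SL2 morphM ?SL2_norm //.
by rewrite morphM ?mem_quotient.
Qed.

Lemma repr_SL2 g : repr (sgval g) \in SL2 F /\ pr_SL2 (repr (sgval g)) = g.
Proof.
have [x xN xS Eg] := morphimP (subgP g).
have rS : repr (sgval g) \in SL2 F.
  have : repr (coset 'Z(SL2 F) x : {set GL}) \in ('Z(SL2 F) :* x)%g.
    by rewrite val_coset // mem_repr_rcoset.
  rewrite Eg; case/rcosetP => z zZ ->; rewrite groupM //.
  by apply: subsetP zZ; apply: center_sub.
split=> //; rewrite /pr_SL2 coset_reprK; exact: sgvalK.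
Qed.

Lemma det_sl_rep g : \det (sl_rep g) = 1.
Proof. by apply/eqP; rewrite -mem_SL2; case: (repr_SL2 g). Qed.

Lemma pr_SL2_eq (x y : GL) : x \in SL2 F -> y \in SL2 F ->
  pr_SL2 x = pr_SL2 y <-> GLval x = GLval y \/ GLval x = - GLval y.
Proof.
move=> xS yS; have xyS : (x * y^-1)%g \in SL2 F by rewrite groupM ?groupV.
have -> : pr_SL2 x = pr_SL2 y <-> (x * y^-1)%g \in 'Z(SL2 F)%g.
  rewrite /pr_SL2; split=> [E|xyZ].
    have := congr1 sgval E; rewrite !subgK ?mem_quotient // -mem_rcoset.
    by move/(rcoset_kercosetP (SL2_norm xS) (SL2_norm yS)).
  congr (subg _ _); apply/(rcoset_kercosetP (SL2_norm xS) (SL2_norm yS)).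
  by rewrite mem_rcoset.
rewrite center_SL2; have yu : GLval y \in unitmx by apply: GL_unit.
have Exy : GLval x = GLval (x * y^-1)%g *m GLval y by rewrite -GLvalM mulgKV.
split=> [/orP[/eqP E|/eqP E]|].
- by left; rewrite Exy E mul1mx.
- by right; rewrite Exy E mulNmx mul1mx.
rewrite GLvalM GL_VxE => -[->|->]; first by rewrite mulmxV // eqxx.
by rewrite mulNmx mulmxV // eqxx orbT.
Qed.

Lemma sl_repM g h : sl_rep (g * h)%g = sl_rep g *m sl_rep h \/
   sl_rep (g * h)%g = - (sl_rep g *m sl_rep h).
Proof.
have [[gS gE] [hS hE]] := (repr_SL2 g, repr_SL2 h); have [ghS ghE] := repr_SL2 (g * h)%g.
rewrite /sl_rep -GLvalM; apply/pr_SL2_eq => //; first exact: groupM.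
by rewrite ghE pr_SL2M // gE hE.
Qed.

Lemma sl_rep1 : sl_rep 1%g = 1%:M \/ sl_rep 1%g = - 1%:M.
Proof.
have [rS rE] := repr_SL2 1%g; rewrite /sl_rep.
have -> : 1%:M = GLval (1%g : GL) by rewrite GL_1E.
by apply/pr_SL2_eq; rewrite ?group1 // rE /pr_SL2 morph1 morph1.
Qed.

Lemma expg_sl_rep g m : sl_rep (g ^+ m)%g = sl_rep g ^+ m \/ sl_rep (g ^+ m)%g = - sl_rep g ^+ m.
Proof.
elim: m => [|m IHm]; first exact: sl_rep1.
rewrite expgS exprS -mulmxE.
by case: (sl_repM g (g ^+ m)%g) => ->; case: IHm => ->; rewrite ?mulmxN ?opprK; [left|right|right|left].
Qed.

Lemma sl_repP A : \det A = 1 -> exists g, sl_rep g = A \/ sl_rep g = - A.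
Proof.
case/exists_SL2 => x xS <-; exists (pr_SL2 x); apply/pr_SL2_eq => //.
  by case: (repr_SL2 (pr_SL2 x)).
by case: (repr_SL2 (pr_SL2 x)).
Qed.

Lemma sl_rep_inj g h : sl_rep g = sl_rep h \/ sl_rep g = - sl_rep h -> g = h.
Proof.
have [[gS gE] [hS hE]] := (repr_SL2 g, repr_SL2 h); move=> E.
by rewrite -gE -hE; apply/(pr_SL2_eq gS hS).
Qed.

Lemma sl_rep_conj g h P : \det P = 1 ->
  P *m sl_rep g = sl_rep h *m P \/ P *m sl_rep g = - (sl_rep h *m P) ->
  exists x, h = (g ^ x)%g.
Proof.
move=> dP E; have [x xP] := sl_repP dP; exists x^-1%g.
suff Exg : (x * g = h * x)%g by rewrite conjgE invgK mulgA Exg mulgK.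
apply: sl_rep_inj.
case: (sl_repM x g) => ->; case: (sl_repM h x) => ->; case: xP => ->; case: E;
  rewrite ?mulNmx ?mulmxN ?opprK => ->; rewrite ?opprK; by [left | right].
Qed.

End ProjectiveSpecialLinear.

(** * Conjugacy from traces *)

Section ConjugacyInPSL2.
Variable F : finFieldType.
Local Notation GL := {'GL_2[F]}.
Local Notation G := (PSL2 F).
Implicit Types (g h : G) (A B : 'M[F]_2).

Lemma card_squares : (#|F| < #|[set x ^+ 2 | x : F]%R|.*2)%N.
Proof.
set S := [set _ | x : F].
have S0 : 0 \in S by apply/imsetP; exists 0; rewrite // expr0n.
have fiber0 : #|[pred x : F | x ^+ 2 == 0]| = 1%N.
  by rewrite (eq_card (B := pred1 (0 : F))) ?card1 // => x; rewrite !inE expf_eq0.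
have fiber s : (#|[pred x : F | x ^+ 2 == s]| <= 2)%N.
  have [/existsP[x /eqP <-]|none] := boolP [exists x : F, x ^+ 2 == s].
    apply: leq_trans (_ : #|[set x; - x]| <= 2)%N; last by rewrite cards2; case: (_ != _).
    by apply/subset_leq_card/subsetP => y; rewrite !inE eqf_sqr.
  rewrite eq_card0 // => x; rewrite !inE; apply/negbTE; apply: contra none => xs.
  by apply/existsP; exists x.
have -> : #|F| = (\sum_(s in S) #|[pred x : F | x ^+ 2 == s]|)%N.
  rewrite -[LHS]sum1_card (partition_big (fun x => x ^+ 2) (mem S)) => [|x _]; last exact: imset_f.
  by apply: eq_bigr => s _; rewrite sum1_card; apply: eq_card => x; rewrite !inE.
rewrite (bigD1 0) //= fiber0 add1n [#|S|](cardD1 0) S0 add1n doubleS !ltnS -muln2 -sum_nat_const.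
rewrite [X in (_ <= X)%N](eq_bigl (fun s => (s \in S) && (s != 0))) => [|s]; last by rewrite !inE andbC.
by apply: leq_sum => s _; apply: fiber.
Qed.

(** Pigeonhole: the values a x^2 and the values t - c y^2 each fill more than half of the field. *)
Lemma diag_form_represents (a c t : F) : a != 0 -> c != 0 -> exists x y, a * x ^+ 2 + c * y ^+ 2 = t.
Proof.
move=> a0 c0; pose S := [set x ^+ 2 | x : F]%R.
pose S1 := [set a * s | s in S]; pose S2 := [set t - c * s | s in S].
have c1 : #|S1| = #|S| by apply: card_imset; apply: mulfI.
have c2 : #|S2| = #|S| by apply: card_imset => s s' /addrI /oppr_inj /(mulfI c0).
have /set0Pn[z] : S1 :&: S2 != set0.
  apply: contraTneq card_squares => S0; rewrite -leqNgt -addnn -{1}c1 -c2.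
  by rewrite -cardsUI S0 cards0 addn0 max_card.
case/setIP=> /imsetP[_ /imsetP[x _ ->] ->] /imsetP[_ /imsetP[y _ ->] E].
by exists x, y; rewrite E subrK.
Qed.

(** In characteristic 2 every element is a square and y = 0 works; otherwise completing the square
    gives a diagonal form. If b = 0, the variables are exchanged, or the form is e x y. *)
Lemma binary_form_represents1 (b e c : F) : e ^+ 2 + b * c *+ 4 != 0 ->
  exists x y, b * x ^+ 2 + e * x * y - c * y ^+ 2 = 1.
Proof.
wlog b0 : b c / b != 0 => [H disc|disc].
  have [b0|] := eqVneq b 0; last by move/H; apply.
  have [c0|c0] := eqVneq c 0.
    have e0 : e != 0 by apply: contraNneq disc => ->; rewrite b0 mul0r mul0rn expr0n addr0.
    by exists 1, e^-1; rewrite b0 c0 !mul0r mulr1 mulfV // add0r subr0.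
  have [||x [y E]] := H (- c) (- b); rewrite ?oppr_eq0 //; first by rewrite mulrNN mulrC.
  by exists y, x; rewrite -E; ring.
have [two0|two0] := eqVneq (2 : F) 0.
  have sq_inj : injective (fun x : F => x ^+ 2).
    move=> x y /= /eqP; rewrite eqf_sqr => /orP[/eqP//|/eqP->].
    by apply/eqP; rewrite -subr_eq0 -opprD oppr_eq0 -mulr2n -mulr_natr two0 mulr0.
  have /codomP[x Ex] : b^-1 \in codom (fun x : F => x ^+ 2).
    by have := injF_onto sq_inj (b^-1).
  by exists x, 0; rewrite -Ex mulfV // expr0n /=; ring.
have four0 : (4 : F) != 0 by rewrite (_ : 4 = 2 * 2) ?mulf_neq0 // -natrM.
have c0 : - (e ^+ 2 + b * c *+ 4) / (b * 4) != 0.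
  by rewrite mulf_neq0 ?oppr_eq0 ?invr_eq0 ?mulf_neq0.
have [x [y E]] := diag_form_represents 1 b0 c0.
exists (x - e * y / (b * 2)), y; apply: etrans E.
by field; rewrite ?b0 ?two0 ?four0.
Qed.

(* The rows of P are v and v A; det P is a quadratic form in v, of discriminant
   (tr A)^2 - 4, hence it represents 1. *)
Lemma companion_conj A : \det A = 1 -> \tr A ^+ 2 != 4 ->
  exists2 P, \det P = 1 & P *m A = pair_mx 0 1 (-1) (\tr A) *m P.
Proof.
move=> dA tA.
have [x [y E]] : exists x y, A 0 1 * x ^+ 2 + (A 1 1 - A 0 0) * x * y - A 1 0 * y ^+ 2 = 1.
  apply: binary_form_represents1; apply: contraNneq tA => E.
  rewrite -subr_eq0; apply/eqP; transitivity ((A 1 1 - A 0 0) ^+ 2 + A 0 1 * A 1 0 *+ 4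
    + 4 * (A 0 0 * A 1 1 - A 0 1 * A 1 0 - 1)); first by rewrite trace_mx2; ring.
  by rewrite E -det_mx2 dA subrr mulr0 addr0.
exists (pair_mx x y (x * A 0 0 + y * A 1 0) (x * A 0 1 + y * A 1 1)).
  by rewrite det_mx2 !mxE /=; apply: etrans E; ring.
apply: mx2P; rewrite !mulmx2E !mxE /= ?mul0r ?add0r ?mul1r ?mulN1r //.
  rewrite trace_mx2; transitivity (- x * (\det A) + (A 0 0 + A 1 1) * (x * A 0 0 + y * A 1 0)).
    by rewrite det_mx2; ring.
  by rewrite dA mulr1.
rewrite trace_mx2; transitivity (- y * (\det A) + (A 0 0 + A 1 1) * (x * A 0 1 + y * A 1 1)).
  by rewrite det_mx2; ring.
by rewrite dA mulr1.
Qed.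

(** Here tr A = 2c with c^2 = 1, so A = c + N with N^2 = 0, and A^n = c^n + n c^(n-1) N is scalar
    only for N = 0, as n is invertible. *)
Lemma scalar_of_trace2 A n : \det A = 1 -> \tr A ^+ 2 = 4 -> n%:R != 0 :> F ->
  A ^+ n = 1 \/ A ^+ n = - 1 -> A = 1%:M \/ A = - 1%:M.
Proof.
move=> dA tA n0 An; have [c [tc c2]] : exists c, \tr A = c *+ 2 /\ c ^+ 2 = 1.
  have : (\tr A - 1 *+ 2) * (\tr A + 1 *+ 2) = 0.
    by rewrite -subr_sqr tA; ring.
  move/eqP; rewrite mulf_eq0 subr_eq0 addr_eq0 => /orP[/eqP->|/eqP->].
    by exists 1; rewrite expr1n.
  by exists (-1); rewrite mulNrn sqrrN expr1n.
pose N := A - c%:M.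
have NN : N *m N = 0.
  rewrite /N mulmxBl !mulmxBr cayley_hamilton2 // tc -scalar_mxM -expr2 c2 mul_mx_scalar mul_scalar_mx.
  rewrite mulr2n scalerDl; move: (c *: A) (1%:M : 'M_2) => X Y.
  by apply/matrixP => i j; rewrite !mxE; ring.
have EA : A = c%:M + N by rewrite addrC subrK.
clearbody N.
have AX m : A ^+ m = (c ^+ m)%:M + (c ^+ m.-1 *+ m) *: N.
  elim: m => [|m IHm]; first by rewrite !expr0 mulr0n scale0r addr0.
  rewrite exprSr IHm {1}EA -mulmxE mulmxDl !mulmxDr -scalar_mxM -exprSr -!scalemxAl.  rewrite NN scaler0 addr0.
  rewrite mul_scalar_mx mul_mx_scalar scalerA -addrA -scalerDl; congr (_ + _ *: _).
  case: m {IHm} => [|m]; first by rewrite !mulr0n mul0r addr0.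
  by rewrite /= mulrnAl -exprSr -mulrS.
have k0 : c ^+ n.-1 *+ n != 0.
  rewrite -mulr_natr mulf_neq0 ?expf_neq0 //; apply: contra_eq_neq c2 => ->.
  by rewrite expr0n eq_sym oner_eq0.
have [d Ed] : exists d, (c ^+ n.-1 *+ n) *: N = d%:M.
  case: An; rewrite AX => E; [exists (1 - c ^+ n) | exists (- 1 - c ^+ n)];
    rewrite raddfB /= ?raddfN /=; by rewrite -[X in X - _]E addrC addKr.
have N0 : N = 0.
  have : d *: N = 0 by rewrite -mul_scalar_mx -Ed -scalemxAl NN scaler0.
  move/eqP; rewrite scaler_eq0 => /orP[/eqP d0|/eqP//].
  by move/eqP: Ed; rewrite d0 raddf0 scaler_eq0 (negbTE k0) => /eqP.
rewrite N0 addr0 in EA; move/eqP: c2; rewrite sqrf_eq1 => /orP[/eqP Ec|/eqP Ec].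
  by left; rewrite EA Ec.
by right; rewrite EA Ec raddfN.
Qed.

Lemma trivial_of_trace2 g n : n%:R != 0 :> F -> (g ^+ n = 1)%g ->
  \tr (sl_rep g) ^+ 2 = 4 -> g = 1%g.
Proof.
move=> n0 gn gt; apply: sl_rep_inj.
have : sl_rep g = 1%:M \/ sl_rep g = - 1%:M.
  suff En : sl_rep g ^+ n = 1 \/ sl_rep g ^+ n = - 1 by have := scalar_of_trace2 (det_sl_rep g) gt n0 En.
  have := expg_sl_rep g n; rewrite gn; case: (sl_rep1 F) => [] -> [] E.
  - by left; rewrite -E.
  - by right; apply: oppr_inj; rewrite opprK -E.
  - by right; rewrite -E.
  - by left; apply: oppr_inj; rewrite -E.
by case: (sl_rep1 F) => ->; case=> ->; rewrite ?opprK; [left|right|right|left].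
Qed.

(** Away from trace 2 and -2 both matrices reach one companion matrix through conjugators of
    determinant 1, so no conjugacy class splits on passing from GL_2 to SL_2; the excluded traces
    leave only the identity. *)
Lemma conj_same_trace g h n : n%:R != 0 :> F -> (g ^+ n = 1)%g -> (h ^+ n = 1)%g ->
  \tr (sl_rep g) = \tr (sl_rep h) \/ \tr (sl_rep g) = - \tr (sl_rep h) ->
  exists x, h = (g ^ x)%g.
Proof.
move=> n0 gn hn tgh; have [dg dh] := (det_sl_rep g, det_sl_rep h).
have t2 : \tr (sl_rep g) ^+ 2 = \tr (sl_rep h) ^+ 2 by case: tgh => ->; rewrite ?sqrrN.
have [t4|nt4] := eqVneq (\tr (sl_rep g) ^+ 2) 4.
  by exists 1%g; rewrite (trivial_of_trace2 n0 gn t4) (trivial_of_trace2 n0 hn) -?t2 // conj1g.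
have [B [dB tB EB]] : exists B, [/\ \det B = 1, \tr B = \tr (sl_rep g)
    & sl_rep h = B \/ sl_rep h = - B].
  case: tgh => tgh; first by exists (sl_rep h); split=> //; left.
  exists (- sl_rep h); rewrite opprK raddfN tgh; split=> //; last by right.
  by rewrite det_mx2 !mxE mulrNN mulrNN -det_mx2.
have [P dP EP] := companion_conj dg nt4; rewrite -tB in nt4.
have [Q dQ EQ] := companion_conj dB nt4; rewrite tB in EQ.
have Qu : Q \in unitmx by rewrite unitmxE dQ unitr1.
have dX : \det (invmx Q *m P) = 1 by rewrite det_mulmx det_inv dQ dP invr1 mulr1.
have QA : invmx Q *m pair_mx 0 1 (-1) (\tr (sl_rep g)) = B *m invmx Q.
  by apply: (can_inj (mulmxK Qu)); rewrite mulmxKV // -mulmxA -EQ mulKmx.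
have EX : invmx Q *m P *m sl_rep g = B *m (invmx Q *m P) by rewrite -mulmxA EP mulmxA QA mulmxA.
by apply: (sl_rep_conj dX); case: EB => ->; [left | right; rewrite mulNmx opprK].
Qed.

End ConjugacyInPSL2.

(** * Eigenvalues up to sign and inversion *)

Section TraceEigenvalue.
Variable L : fieldType.
Implicit Types (mu nu : L) (A B : 'M[L]_2).

Lemma addV_inj mu nu : mu != 0 -> nu != 0 -> mu + mu^-1 = nu + nu^-1 -> nu = mu \/ nu = mu^-1.
Proof.
move=> mu0 nu0 E; have : (nu - mu) * (nu - mu^-1) = 0.
  transitivity (nu * (nu + nu^-1 - (mu + mu^-1))); last by rewrite E subrr mulr0.
  by field; rewrite mu0 nu0.
by move/eqP; rewrite mulf_eq0 !subr_eq0 => /orP[]/eqP ->; [left | right].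
Qed.

Lemma mxtrace2X A mu m : \det A = 1 -> mu != 0 -> \tr A = mu + mu^-1 ->
  \tr (A ^+ m) = mu ^+ m + (mu ^+ m)^-1.
Proof.
move=> dA mu0 tA; have CH m' : A ^+ m'.+2 = \tr A *: A ^+ m'.+1 - A ^+ m'.
  rewrite !exprSr -mulmxE -mulmxA cayley_hamilton2 // mulmxBr mulmx1.
  by rewrite scalemxAr.
suff [] : \tr (A ^+ m) = mu ^+ m + (mu ^+ m)^-1 /\ \tr (A ^+ m.+1) = mu ^+ m.+1 + (mu ^+ m.+1)^-1 by [].
elim: m => [|m [IH1 IH2]]; first by rewrite !expr0 !expr1 mxtrace1 invr1.
split=> //; rewrite CH raddfB /= mxtraceZ IH1 IH2 tA !exprS.
by field; rewrite mu0 expf_neq0.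
Qed.

(** The second row of Q is a left eigenvector for mu^-1. A triangular form suffices for symmetric
    powers and includes the case mu = mu^-1. *)
Lemma trig_form2 A mu : \det A = 1 -> mu != 0 -> \tr A = mu + mu^-1 ->
  exists Q T, [/\ Q \in unitmx, A = invmx Q *m T *m Q, T 1 0 = 0, T 0 0 = mu & T 1 1 = mu^-1].
Proof.
move=> dA mu0 tA.
have /eqP/det0P[v v0 vA] : \det (A - mu^-1%:M) = 0.
  move: dA tA; rewrite !det_mx2 trace_mx2 !mxE /= !mulr1n !mulr0n !subr0 => dA tA.
  transitivity (A 0 0 * A 1 1 - A 0 1 * A 1 0 - mu^-1 * (A 0 0 + A 1 1) + mu^-1 ^+ 2); first by ring.
  by rewrite dA tA; field.
have EvA : v *m A = mu^-1 *: v.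
  by apply/eqP; rewrite -subr_eq0 -mul_mx_scalar -mulmxBr vA.
have [x dx] : exists x : 'rV[L]_2, x 0 0 * v 0 1 - x 0 1 * v 0 0 != 0.
  have [v00|v00] := eqVneq (v 0 0) 0; last first.
    by exists (\row_j (j == 1)%:R); rewrite !mxE /= mul0r mul1r sub0r oppr_eq0.
  exists (\row_j (j == 0)%:R); rewrite !mxE /= mul0r mul1r subr0.
  by apply: contraNneq v0 => v01; apply/eqP/rowP => j; rewrite mxE; case: (I2P j) => ->.
pose Q : 'M[L]_2 := pair_mx (x 0 0) (x 0 1) (v 0 0) (v 0 1).
have Qu : Q \in unitmx by rewrite unitmxE det_mx2 !mxE unitfE.
pose T := Q *m A *m invmx Q.
have TQ : T *m Q = Q *m A by rewrite mulmxKV.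
have Q1 : row 1 Q = v by apply/rowP => j; rewrite !mxE /=; case: (I2P j) => ->.
have T1 : row 1 T = mu^-1 *: delta_mx 0 1.
  rewrite /T !row_mul Q1 EvA -scalemxAl -Q1; congr (_ *: _).
  by rewrite -row_mul mulmxV // row1.
have T10 : T 1 0 = 0 by move/rowP/(_ 0): T1; rewrite !mxE /= mulr0.
have T11 : T 1 1 = mu^-1 by move/rowP/(_ 1): T1; rewrite !mxE /= mulr1.
have dT : \det T = 1 by rewrite !det_mulmx dA mulr1 -det_mulmx mulmxV ?det1.
exists Q, T; split=> //; first by rewrite -mulmxA TQ mulKmx.
by move: dT; rewrite det_mx2 T10 T11 mulr0 subr0 => /(congr1 ( *%R^~ mu)); rewrite mulfVK // mul1r.
Qed.

End TraceEigenvalue.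

Section EigenvaluesInPSL2.
Variables (F : finFieldType) (L : fieldType) (iota : {rmorphism F -> L}).
Hypothesis trL : forall t : F, exists2 mu : L, mu != 0 & iota t = mu + mu^-1.
Local Notation G := (PSL2 F).
Implicit Types (g h : G).

Lemma exists_eigenvalue g : exists mu : L, (mu != 0) && (iota (\tr (sl_rep g)) == mu + mu^-1).
Proof. by have [mu mu0 ->] := trL (\tr (sl_rep g)); exists mu; rewrite mu0 eqxx. Qed.

Definition eigenvalue_rep g : L := xchoose (exists_eigenvalue g).

(* The two eigenvalues of a matrix in SL_2 are inverse to each other and are
   known only up to sign in PSL_2; the square is thus defined up to inversion. *)
Definition eigen_sqr g : L := eigenvalue_rep g ^+ 2.

Lemma eigenvalue_rep_neq0 g : eigenvalue_rep g != 0.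
Proof. by have /andP[] := xchooseP (exists_eigenvalue g). Qed.

Lemma eigen_sqr_neq0 g : eigen_sqr g != 0.
Proof. by rewrite expf_neq0 ?eigenvalue_rep_neq0. Qed.

Lemma eigenvalue_repE g :
  \tr (map_mx iota (sl_rep g)) = eigenvalue_rep g + (eigenvalue_rep g)^-1.
Proof. by have /andP[_ /eqP <-] := xchooseP (exists_eigenvalue g); rewrite trace_map_mx. Qed.

Lemma eigen_sqr_unique g mu : mu != 0 ->
  \tr (map_mx iota (sl_rep g)) = mu + mu^-1 \/ \tr (map_mx iota (sl_rep g)) = - (mu + mu^-1) ->
  eigen_sqr g = mu ^+ 2 \/ eigen_sqr g = (mu ^+ 2)^-1.
Proof.
move=> mu0; rewrite eigenvalue_repE => E.
have [nu [nu0 Enu <-]] : exists nu, [/\ nu != 0, eigenvalue_rep g + (eigenvalue_rep g)^-1 = nu + nu^-1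
    & nu ^+ 2 = mu ^+ 2].
  case: E => E; first by exists mu.
  by exists (- mu); rewrite oppr_eq0 mu0 E opprD invrN sqrrN.
rewrite -exprVn /eigen_sqr.
case: (addV_inj (eigenvalue_rep_neq0 g) nu0 Enu) => ->; [left | right] => //; by rewrite invrK.
Qed.

Lemma eigen_sqrX g m : eigen_sqr (g ^+ m)%g = eigen_sqr g ^+ m \/
  eigen_sqr (g ^+ m)%g = (eigen_sqr g ^+ m)^-1.
Proof.
rewrite /eigen_sqr [X in X ^+ m]/= -!exprM mulnC exprM.
apply: eigen_sqr_unique; first by rewrite expf_neq0 ?eigenvalue_rep_neq0.
have dg : \det (map_mx iota (sl_rep g)) = 1 by rewrite det_map_mx det_sl_rep rmorph1.
have := mxtrace2X m dg (eigenvalue_rep_neq0 g) (eigenvalue_repE g).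
rewrite -rmorphXn /= => <-.
by case: (expg_sl_rep g m) => ->; [left | right]; rewrite // map_mxN raddfN.
Qed.

Lemma mxtrace_sl_repJ g h : \tr (sl_rep (g ^ h)%g) = \tr (sl_rep g) \/
  \tr (sl_rep (g ^ h)%g) = - \tr (sl_rep g).
Proof.
have : sl_rep (h * g ^ h)%g = sl_rep (g * h)%g by rewrite conjgE mulKVg.
have hu : sl_rep h \in unitmx by rewrite unitmxE det_sl_rep unitr1.
have cancel_h A B : sl_rep h *m A = B *m sl_rep h -> \tr A = \tr B.
  by move=> E; rewrite -[A](mulKmx hu) E mxtrace_mulC mulmxK.
case: (sl_repM h (g ^ h)%g) => ->; case: (sl_repM g h) => ->.
- by move/cancel_h; left.
- by rewrite -mulNmx => /cancel_h ->; right; rewrite raddfN.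
- by rewrite -mulmxN => /cancel_h; rewrite raddfN => <-; right; rewrite opprK.
- by move/oppr_inj/cancel_h; left.
Qed.

Lemma eigen_sqrJ g h : eigen_sqr (g ^ h)%g = eigen_sqr g \/ eigen_sqr (g ^ h)%g = (eigen_sqr g)^-1.
Proof.
apply: eigen_sqr_unique; first exact: eigenvalue_rep_neq0.
rewrite -eigenvalue_repE !trace_map_mx -rmorphN.
by case: (mxtrace_sl_repJ g h) => ->; [left | right].
Qed.

(** Equal squares up to inversion amount to equal traces up to sign, which is the ambiguity of
    [sl_rep]. *)
Lemma conj_eigen_sqr g h n : n%:R != 0 :> F -> (g ^+ n = 1)%g -> (h ^+ n = 1)%g ->
  eigen_sqr h = eigen_sqr g \/ eigen_sqr h = (eigen_sqr g)^-1 -> exists x, h = (g ^ x)%g.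
Proof.
move=> n0 gn hn E; apply: (conj_same_trace n0 gn hn).
suff : iota (\tr (sl_rep g)) = iota (\tr (sl_rep h)) \/ iota (\tr (sl_rep g)) = iota (- \tr (sl_rep h)).
  by case=> /fmorph_inj ->; [left | right].
rewrite rmorphN -!trace_map_mx !eigenvalue_repE.
have : eigenvalue_rep h ^+ 2 = eigenvalue_rep g ^+ 2 \/
    eigenvalue_rep h ^+ 2 = (eigenvalue_rep g)^-1 ^+ 2 by rewrite exprVn.
by case=> /eqP; rewrite eqf_sqr => /orP[]/eqP ->; rewrite ?invrN ?invrK -?opprD ?opprK;
  [left | right | left | right]; rewrite // addrC.
Qed.

Lemma eigen_sqr1 : eigen_sqr 1%g = 1.
Proof.
have [] := @eigen_sqr_unique 1%g 1 (oner_neq0 _); rewrite ?expr1n ?invr1 //.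
have t2 : iota (\tr (1%:M : 'M[F]_2)) = 1 + 1 by rewrite mxtrace1 rmorph_nat.
by rewrite trace_map_mx; case: (sl_rep1 F) => ->; [left | right]; rewrite ?raddfN /= ?rmorphN /= t2.
Qed.

End EigenvaluesInPSL2.

(** * Brauer characters of PSL(2, q) *)

Section PadicTraces.
Variables (L : finFieldType) (p : nat) (w : L) (omega : algC).
Hypothesis ch : p \in [pchar L].
Hypothesis prim_w : (#|L|.-1).-primitive_root w.
Local Notation I := (padic_filt p w).
Local Notation s := (teich w).
Let p_pr := pcharf_prime ch.

Lemma padic_filt_sum j (T : Type) (r : seq T) (P : pred T) (f : T -> {poly int}) :
  (forall t, P t -> I j (f t)) -> I j (\sum_(t <- r | P t) f t).
Proof.
exact: (filt_sum (@padic_filt_add L p w) (@padic_filt_top L p w) (@padic_filt_prod L p w)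
  (@padic_filt_p L p w)).
Qed.

Lemma padic_trace_power_trig n (A : 'M[{poly int}]_n) (P T Q : 'M[L]_n) N :
  map_mx (resid w) A = P *m T *m Q -> Q *m P = 1%:M -> is_trig_mx T ->
  I N.+1 (\tr (A ^+ (p ^ N)) - \sum_i s (T i i) ^+ (p ^ N)).
Proof.
exact: (trace_power_trig p_pr (@padic_filt_add L p w) (@padic_filt_top L p w)
  (@padic_filt_prod L p w) (@padic_filt_mono L p w) (@padic_filt_p L p w)
  (padic_filt_ker ch prim_w) (teichK prim_w) (teich0 prim_w)).
Qed.

Lemma padic_trace_power_group_ring (gT : finGroupType) n (D : gT -> 'M[L]_n)
    (beta : gT -> {poly int}) : D 1%g = 1 -> (forall g h, D (g * h)%g = D g *m D h) ->
  class_stable beta ->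
  (forall h N (A : 'M[{poly int}]_n), map_mx (resid w) A = D h ->
     I N.+1 (\tr (A ^+ (p ^ N)) - beta (h ^+ (p ^ N))%g)) ->
  forall (u : group_ring int gT) N,
  I N.+1 (\tr ((\sum_g map_mx s (D g) *~ coeff u g) ^+ (p ^ N)) -
          \sum_g beta g *~ coeff (u ^+ (p ^ N)) g).
Proof.
exact: (trace_power_group_ring p_pr (@padic_filt_add L p w) (@padic_filt_top L p w)
  (@padic_filt_prod L p w) (@padic_filt_p L p w) (teichK prim_w)).
Qed.

End PadicTraces.

Section RepresentationSum.
Variables (gT : finGroupType) (L : comNzRingType) (n : nat) (D : gT -> 'M[L]_n).
Hypotheses (D1 : D 1%g = 1) (DM : forall g h, D (g * h)%g = D g *m D h).
Implicit Types u v : group_ring int gT.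

Definition rep_sum u : 'M[L]_n := \sum_g D g *~ coeff u g.

Lemma rep_sumM u v : rep_sum (u * v) = rep_sum u *m rep_sum v.
Proof.
transitivity (\sum_h \sum_g D g *~ (coeff u h * coeff v (h^-1 * g)%g)).
  rewrite exchange_big; apply: eq_bigr => g _.
  by rewrite [coeff (u * v) g]coeffM -mulrz_sumr.
rewrite /rep_sum mulmx_suml; apply: eq_bigr => h _.
rewrite (reindex_inj (mulgI h)) /= mulmx_sumr; apply: eq_bigr => g _.
by rewrite mulKg DM mulmxE mulrzAl mulrzAr -mulrzA mulrC.
Qed.

Lemma rep_sumX u m : rep_sum (u ^+ m) = rep_sum u ^+ m.
Proof.
elim: m => [|m IHm].
  rewrite !expr0 /rep_sum (bigD1 1%g) //= big1 => [|g g1].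
    by rewrite coeff1 eqxx D1 addr0.
  by rewrite coeff1 (negbTE g1).
by rewrite !exprS rep_sumM IHm.
Qed.

End RepresentationSum.

Section BrauerCharactersOfPSL2.
Variables (F L : finFieldType) (iota : {rmorphism F -> L}).
Hypothesis trL : forall t : F, exists2 mu : L, mu != 0 & iota t = mu + mu^-1.
Local Notation G := (PSL2 F).
Implicit Types (g h : G).
Variables (p : nat) (w : L) (omega : algC).
Hypothesis ch : p \in [pchar L].
Let e := #|L|.-1.
Hypotheses (prim_w : e.-primitive_root w) (prim_om : e.-primitive_root omega).
Variable k : nat.
Local Notation z := (eigen_sqr trL).
Local Notation I := (padic_filt p w).
Local Notation s := (teich w).
Let p_pr := pcharf_prime ch.

Definition sym_rep g : 'M[L]_(k.*2.+1) := sym_mx k.*2 (map_mx iota (sl_rep g)).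

Lemma sym_rep1 : sym_rep 1%g = 1.
Proof.
by rewrite /sym_rep; case: (sl_rep1 F) => ->; rewrite ?map_mxN map_mx1 ?sym_mxN ?odd_double // sym_mx1.
Qed.

Lemma sym_repM g h : sym_rep (g * h)%g = sym_rep g *m sym_rep h.
Proof.
rewrite /sym_rep -sym_mxM -map_mxM.
by case: (sl_repM g h) => ->; rewrite ?map_mxN ?sym_mxN ?odd_double.
Qed.

(** With eigenvalues mu and mu^-1 of g, those on Sym^(2k) are mu^i mu^(i-2k) = z^(i-k) for 0 <= i <=
    2k; each is lifted. *)
Definition sym_brauer g : {poly int} := \sum_(i < (k.*2).+1) s (z g ^+ i / z g ^+ k).

Lemma sum_sym_inv (R : nmodType) (f : L -> R) (a : L) : a != 0 ->
  \sum_(i < (k.*2).+1) f (a^-1 ^+ i / a^-1 ^+ k) = \sum_(i < (k.*2).+1) f (a ^+ i / a ^+ k).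
Proof.
move=> a0; rewrite (reindex_inj rev_ord_inj) /=; apply: eq_bigr => i _; congr f.
rewrite subSS !exprVn invrK; have ik : (i <= k.*2)%N by rewrite -ltnS.
by apply/eqP; rewrite mulrC eqr_div ?expf_neq0 // -!exprD subnKC // addnn.
Qed.

Lemma sym_brauer_eq g h : z h = z g \/ z h = (z g)^-1 -> sym_brauer h = sym_brauer g.
Proof. by rewrite /sym_brauer; case=> -> //; apply: sum_sym_inv; apply: eigen_sqr_neq0. Qed.

Lemma sym_brauerJ : class_stable sym_brauer.
Proof. by move=> g h; apply/sym_brauer_eq/eigen_sqrJ. Qed.

Lemma trace_power_sym_rep h N (A : 'M[{poly int}]_(k.*2.+1)) :
  map_mx (resid w) A = sym_rep h -> I N.+1 (\tr (A ^+ (p ^ N)) - sym_brauer (h ^+ (p ^ N))%g).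
Proof.
move=> EA; set mu := eigenvalue_rep trL h; have mu0 : mu != 0 := eigenvalue_rep_neq0 trL h.
have dh : \det (map_mx iota (sl_rep h)) = 1 by rewrite det_map_mx det_sl_rep rmorph1.
have [Q [T [Qu Eh T10 T00 T11]]] := trig_form2 dh mu0 (eigenvalue_repE trL h).
have [trT dT] := sym_mx_trig k.*2 T10.
have QP : sym_mx k.*2 Q *m sym_mx k.*2 (invmx Q) = 1%:M by rewrite -sym_mxM mulmxV // sym_mx1.
have EA' : map_mx (resid w) A = sym_mx k.*2 (invmx Q) *m sym_mx k.*2 T *m sym_mx k.*2 Q.
  by rewrite EA /sym_rep Eh !sym_mxM.
have TP := padic_trace_power_trig ch prim_w N EA' QP trT.
apply: (filt_sub_trans (@padic_filt_add L p w) TP).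
have zh0 : z h != 0 := eigen_sqr_neq0 trL h.
have -> : sym_brauer (h ^+ (p ^ N))%g = \sum_(i < (k.*2).+1) s ((z h ^+ i / z h ^+ k) ^+ (p ^ N)).
  transitivity (\sum_(i < (k.*2).+1) s ((z h ^+ (p ^ N)) ^+ i / (z h ^+ (p ^ N)) ^+ k)).
    rewrite /sym_brauer; case: (eigen_sqrX trL h (p ^ N)) => -> //.
    by apply: sum_sym_inv; rewrite expf_neq0.
  apply: eq_bigr => i _; move: (z h) => x; by rewrite exprMn exprVn -!exprM ![(p ^ N * _)%N]mulnC.
rewrite -sumrB; apply: padic_filt_sum => i _.
have -> : sym_mx k.*2 T i i = z h ^+ i / z h ^+ k.
  have ik : (i <= k.*2)%N by rewrite -ltnS.
  rewrite dT T00 T11 /eigen_sqr -/mu exprVn; apply/eqP.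
  rewrite eqr_div ?expf_neq0 // -!exprM -!exprD; apply/eqP; congr (_ ^+ _); lia.
apply: (teich_expr p prim_w).
by rewrite mulf_neq0 ?invr_eq0 ?expf_neq0.
Qed.

(** The image of u on Sym^(2k) has order dividing n, prime to p, and is diagonalisable; [lam] lifts
    its eigenvalues. Both power sums agree with the trace of one p^N'-th power to precision
    p^(N'+1), for arbitrarily large N' with u^(p^N') = u, so [padic_filt_inter] makes them equal in
    algC. *)
Lemma brauer_eigenvalues (u : group_ring int G) n (zn : L) : n.-primitive_root zn -> u ^+ n = 1 ->
  exists2 lam : seq algC, (forall a, a \in lam -> a ^+ n = 1) &
  forall l, \sum_(a <- lam) a ^+ l = \sum_g (\sum_(i < k.*2.+1)
    teichC w omega (z g) ^+ i / teichC w omega (z g) ^+ k) *~ coeff (u ^+ l) g.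
Proof.
move=> prim_zn un; have n_gt0 := prim_order_gt0 prim_zn.
have zn0 : zn != 0 by have := primitive_root_expr_neq0 1 prim_zn.
have co_pn : coprime p n.
  rewrite prime_coprime //; apply: contra (card_pred_neq0 ch) => pn.
  rewrite -(dvdn_pcharf ch); apply: dvdn_trans pn _.
  by rewrite (prim_order_dvd prim_zn) expr_card_pred.
have un' : rep_sum sym_rep u ^+ n = 1 
  by rewrite -(rep_sumX sym_rep1 sym_repM) un -(expr0 u) (rep_sumX sym_rep1 sym_repM) expr0.
have [P Pu [d Ed dn]] := finite_order_diag prim_zn un'.
have d0 i : d 0 i != 0.
  by apply: contraTneq (oner_neq0 L) => di; rewrite -(dn i) di expr0n gtn_eqF // eqxx.
exists [seq teichC w omega (d 0 i) | i <- enum 'I_(k.*2.+1)].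
  by move=> a /mapP[i _ ->]; rewrite -teichCX ?dn ?(teichC1 prim_w prim_om).
move=> l; rewrite big_map big_enum /=.
have ZE : (map_poly intr (\sum_i s (d 0 i ^+ l) - \sum_g sym_brauer g *~ coeff (u ^+ l) g)).[omega] = 0.
  apply: (padic_filt_inter ch prim_w prim_om) => N.
  have pN : p ^ (totient n * N) = 1 %[mod n] by rewrite expnM -modnXm Euler_exp_totient // modnXm exp1n.
  have N_le : (N <= totient n * N)%N by rewrite leq_pmull // totient_gt0.
  exists (totient n * N).+1; split; first exact: leqW.
  move: (totient n * N)%N pN {N_le} => N' pN.
  have A1 := padic_trace_power_group_ring ch prim_w sym_rep1 sym_repM sym_brauerJ
    trace_power_sym_rep (u ^+ l) N'.
  set A := \sum_g _ in A1.
  have EA : map_mx (resid w) A = invmx P *m diag_mx (\row_j d 0 j ^+ l) *m P.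
    rewrite -mulmxA -(conj_diagX Ed) mulKmx // -(rep_sumX sym_rep1 sym_repM).
    rewrite raddf_sum; apply: eq_bigr => g _; rewrite raddfMz /=; congr (_ *~ _).
    by apply/matrixP => i j; rewrite !mxE teichK.
  have A2 := padic_trace_power_trig ch prim_w N' EA (mulmxV Pu) (diag_mx_is_trig _).
  have -> : \sum_g sym_brauer g *~ coeff (u ^+ l) g =
      \sum_g sym_brauer g *~ coeff ((u ^+ l) ^+ (p ^ N')) g.
    suff -> : (u ^+ l) ^+ (p ^ N') = u ^+ l by [].
    rewrite -exprM mulnC exprM; congr (_ ^+ _).
    by rewrite -(expr_mod _ un) pN (expr_mod _ un).
  apply: (filt_sub_trans (@padic_filt_add L p w) _ A1).
  apply: (filt_sub_sym (@padic_filt_top L p w) (@padic_filt_prod L p w)).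
  apply: (filt_sub_trans (@padic_filt_add L p w) A2).
  rewrite -sumrB; apply: padic_filt_sum => i _.
  rewrite !mxE eqxx mulr1n.
  have E : s (d 0 i ^+ l) = s ((d 0 i ^+ l) ^+ (p ^ N')).
    congr s; rewrite -exprM mulnC exprM; congr (_ ^+ _).
    by rewrite -(expr_mod _ (dn i)) pN (expr_mod _ (dn i)).
  by rewrite [X in _ - X]E; apply: (teich_expr p prim_w); rewrite expf_neq0.
move: ZE; rewrite rmorphB !rmorph_sum /= hornerD hornerN !horner_sum => /eqP.
rewrite subr_eq0 => /eqP E; transitivity (\sum_i teichC w omega (d 0 i ^+ l)).
  by apply: eq_bigr => i _; rewrite teichCX.
rewrite [LHS]E; apply: eq_bigr => g _; rewrite raddfMz /= hornerMz; congr (_ *~ _).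
rewrite rmorph_sum horner_sum; apply: eq_bigr => i _.
have := eigen_sqr_neq0 trL g; move: (z g) => x x0.
by rewrite -/(teichC _ _ _) (teichCM prim_w prim_om) ?invr_eq0 ?expf_neq0 // (teichCV prim_w prim_om) ?expf_neq0 //
  !(teichCX prim_w prim_om).
Qed.

End BrauerCharactersOfPSL2.

(** L splits X^n - 1 and every X^2 - tX + 1, the characteristic polynomials of the elements of
    SL_2. *)
Lemma exists_splitting_extension (F : finFieldType) n : n%:R != 0 :> F ->
  exists (L : finFieldType) (iota : {rmorphism F -> L}),
    (forall t, exists2 mu, mu != 0 & iota t = mu + mu^-1) /\ exists zn : L, n.-primitive_root zn.
Proof.
move=> n0; have n_gt0 : (0 < n)%N by case: n n0 => //; rewrite eqxx.
pose q (t : F) : {poly F} := 'X^2 - t *: 'X + 1.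
have size_q t : size (q t) = 3%N.
  rewrite /q -addrA size_polyDl ?size_polyXn // ltnS.
  apply: leq_trans (size_polyD _ _) _; rewrite geq_max size_polyN size_poly1 andbT.
  by apply: leq_trans (size_scale_leq _ _) _; rewrite size_polyX.
pose P := ('X^n - 1) * \prod_t q t.
have P0 : P != 0.
  rewrite mulf_neq0 //; first by rewrite -size_poly_gt0 size_Xn_sub_1.
  by apply/prodf_neq0 => t _; rewrite -size_poly_gt0 size_q.
have [L [rs Prs _]] := FinSplittingFieldFor P0.
have factor (Q : {poly F}) : Q %| P -> exists rs', map_poly (in_alg L) Q %= \prod_(x <- rs') ('X - x%:P).
  move=> QP; have : map_poly (in_alg L) Q %| \prod_(x <- rs) ('X - x%:P).
    by rewrite -(eqp_dvdr _ Prs) dvdp_map.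
  by case/dvdp_prod_XsubC => m Em; exists (mask m rs).
exists (finvect_type L), (in_alg L : {rmorphism F -> L}); split.
  move=> t; have [|rs' E] := factor (q t).
    by apply: dvdp_mull; rewrite (bigD1 t) //= dvdp_mulr.
  have : (1 < size rs')%N.
    by have := eqp_size E; rewrite size_map_poly size_q size_prod_XsubC => -[<-].
  case: rs' E => // mu rs' E _.
  have : root (map_poly (in_alg L) (q t)) mu by rewrite (eqp_root E) root_prod_XsubC mem_head.
  rewrite /q !rmorphD rmorphN /= map_polyZ map_polyXn map_polyX rmorph1 rootE !hornerE => /eqP Emu.
  have mu0 : mu != 0.
    by apply: contra_eq_neq Emu => ->; rewrite expr0n mulr0 subr0 add0r oner_neq0.
  exists mu => //; apply: (mulIf mu0); rewrite mulrDl mulVf //.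
  apply/eqP; rewrite -subr_eq0 -oppr_eq0; apply/eqP; rewrite -[RHS]Emu.
  by rewrite expr2 opprB [RHS]addrAC.
have [|rs' E] := factor ('X^n - 1); first exact: dvdp_mulr.
have {}E : ('X^n - 1 : {poly L}) %= \prod_(x <- rs') ('X - x%:P).
  by move: E; rewrite rmorphB /= map_polyXn rmorph1.
have /hasP[zn _ prim] : has n.-primitive_root rs'.
  apply: has_prim_root => //.
  - by apply/allP => x xrs; rewrite /root_of_unity (eqp_root E) root_prod_XsubC.
  - rewrite -separable_prod_XsubC -(eqp_separable E); apply: separable_Xn_sub_1.
    by rewrite -(rmorph_nat (in_alg L)) fmorph_eq0.
  - by have := eqp_size E; rewrite size_Xn_sub_1 // size_prod_XsubC => -[->].
by exists zn.
Qed.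

(** * Conjugacy in the rational group algebra *)

Lemma exists_nat_nonroot (R : numDomainType) (q : {poly R}) : q != 0 ->
  exists m : nat, q.[m%:R] != 0.
Proof.
move=> q0; have [/existsP[i qi]|none] := boolP [exists i : 'I_(size q), q.[(i : nat)%:R] != 0].
  by exists i.
pose rs : seq R := [seq (i : nat)%:R | i <- iota 0 (size q)].
have rsq : all (root q) rs.
  apply/allP => _ /mapP[i + ->]; rewrite mem_iota add0n => /= iq.
  by rewrite rootE; apply: contraNT none => qi; apply/existsP; exists (Ordinal iq).
have rs_uniq : uniq rs.
  by rewrite map_inj_in_uniq ?iota_uniq // => i j _ _ /eqP; rewrite eqr_nat => /eqP.
by have := max_poly_roots q0 rsq rs_uniq; rewrite size_map size_iota ltnn.
Qed.

(* The coefficients are replaced one at a time: the determinant is a nonzero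
   polynomial in each of them. *)
Lemma nonsingular_nat_combination (R : numFieldType) m d (A : 'I_m -> 'M[R]_d) (c : 'I_m -> R) :
  \det (\sum_i c i *: A i) != 0 -> exists c' : 'I_m -> nat, \det (\sum_i (c' i)%:R *: A i) != 0.
Proof.
move=> dc; suff /(_ m) [c' [c'n dc']] : forall j, exists c' : 'I_m -> R,
    (forall i : 'I_m, (i < j)%N -> exists k : nat, c' i = k%:R) /\ \det (\sum_i c' i *: A i) != 0.
  have cE (i : 'I_m) : exists k : nat, c' i == k%:R by have [k Ek] := c'n i (ltn_ord i); exists k; apply/eqP.
  exists (fun i => xchoose (cE i)).
  by rewrite (eq_bigr (fun i => c' i *: A i)) // => i _; rewrite -(eqP (xchooseP (cE i))).
elim=> [|j [c' [c'n dc']]]; first by exists c.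
have [jm|mj] := ltnP j m; last first.
  by exists c'; split=> // i _; apply: c'n; apply: leq_trans mj.
pose M : 'M[{poly R}]_d := \sum_(i < m) (if i == j :> nat then 'X else (c' i)%:P) *: map_mx polyC (A i).
have evalM x : (\det M).[x] = \det (\sum_(i < m) (if i == j :> nat then x else c' i) *: A i).
  rewrite -[LHS]/(horner_eval x (\det M)) -det_map_mx; congr (\det _).
  rewrite raddf_sum; apply: eq_bigr => i _; apply/matrixP => a b; rewrite !mxE.
  by rewrite /= /horner_eval hornerM hornerC; case: (_ == _); rewrite ?hornerX ?hornerC.
have /exists_nat_nonroot[k] : \det M != 0.
  apply: contraNneq dc' => M0; have := evalM (c' (Ordinal jm)); rewrite M0 horner0 => /esym E.
  rewrite (eq_bigr (fun i : 'I_m => (if i == j :> nat then c' (Ordinal jm) else c' i) *: A i)) ?E //.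
  move=> i _; case: eqP => // ij; congr (c' _ *: _); exact: val_inj.
rewrite evalM => dk; exists (fun i : 'I_m => if i == j :> nat then k%:R else c' i); split=> // i.
rewrite ltnS leq_eqVlt => /orP[->|ij]; first by exists k.
by rewrite (ltn_eqF ij); apply: c'n.
Qed.

Section RightMultiplication.
Variables (R : comNzRingType) (gT : finGroupType).
Implicit Types (u v w y : group_ring R gT) (g h k : gT).

Definition rmul_mx u : 'M[R]_#|gT| := \matrix_(a, b) coeff u ((enum_val a)^-1 * enum_val b)%g.

Lemma gr_vec_rmul u w : gr_vec w *m rmul_mx u = gr_vec (w * u).
Proof.
apply/rowP => b; rewrite !mxE coeffM (reindex (@enum_val gT predT)) /=; last first.
  by exists enum_rank => x _; rewrite ?enum_rankK ?enum_valK.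
by apply: eq_bigr => a _; rewrite !mxE.
Qed.

Definition vec_gr (v : 'rV[R]_#|gT|) : group_ring R gT := gr_of_fun (fun g => v 0 (enum_rank g)).

Lemma vec_grK : cancel vec_gr (@gr_vec R gT).
Proof. by move=> v; apply/rowP => a; rewrite mxE coeffE enum_valK. Qed.

Definition lmul_mx (v : 'rV[R]_#|gT|) : 'M[R]_#|gT| := act_mx (vec_gr v) 1%g.

Lemma lmul_mxE (v : 'rV[R]_#|gT|) a b : lmul_mx v a b = v 0 (enum_rank (enum_val b * (enum_val a)^-1)%g).
Proof. by rewrite mxE coeffE invg1 mulg1. Qed.

Lemma lmul_mx_sum m (c : 'I_m -> R) (v : 'I_m -> 'rV[R]_#|gT|) :
  lmul_mx (\sum_i c i *: v i) = \sum_i c i *: lmul_mx (v i).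
Proof.
apply/matrixP => a b; rewrite lmul_mxE !summxE; apply: eq_bigr => i _.
by rewrite [in RHS]mxE lmul_mxE mxE.
Qed.

(** Such a matrix is determined by the image of 1, since right translations carry 1 to every group
    element. *)
Lemma commute_right_mult (B : 'M[R]_#|gT|) : (forall h, act_mx 1 h *m B = B *m act_mx 1 h) ->
  B = lmul_mx (gr_vec 1 *m B).
Proof.
move=> HB; apply/row_matrixP => a; rewrite !rowE -gr_vec_elt gr_vec_act gr_elt1 mulr1.
have -> : gr_elt (enum_val a) = 1 * 1 * gr_elt (enum_val a) :> group_ring R gT by rewrite !mul1r.
rewrite -gr_vec_act -mulmxA HB mulmxA -{1}(vec_grK (gr_vec 1 *m B)) gr_vec_act.
by rewrite !mul1r.
Qed.

End RightMultiplication.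

Lemma lmul_unit_inverse (R : fieldType) (gT : finGroupType) (y : group_ring R gT) :
  \det (act_mx y 1%g) != 0 -> exists w, inverse_of w y.
Proof.
move=> dy; have yu : act_mx y 1%g \in unitmx by rewrite unitmxE unitfE.
pose w := vec_gr (gr_vec 1 *m invmx (act_mx y 1%g)).
have yw : y * w = 1.
  apply: gr_vec_inj; have := gr_vec_act y 1%g w; rewrite gr_elt1 mulr1 => <-.
  by rewrite vec_grK mulmxKV.
exists w; split; first exact: yw.
apply: gr_vec_inj; apply: (can_inj (mulmxK yu)).
by rewrite !gr_vec_act gr_elt1 !mulr1 mulrA yw mul1r.
Qed.

Section CyclicRepresentation.
Variables (gT : finGroupType) (u : group_ring int gT) (n : nat).
Hypothesis un : u ^+ n.+1 = 1.

(* The action w |-> u^i w h of C_(n+1) x G on the group algebra determines u up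
   to conjugacy, and its character is given by class sums of the powers of u. *)
Definition power_mx (s : 'I_n.+1 * gT) : 'M[algC]_#|gT| :=
  map_mx intr (act_mx (u ^+ s.1) s.2).

Lemma power_mx_repr : mx_repr [set: 'I_n.+1 * gT] power_mx.
Proof.
split=> [|[i g] [j h] _ _]; first by rewrite /power_mx /= expr0 act_mx1 map_mx1.
rewrite /power_mx /= -map_mxM act_mxM -exprD; congr (map_mx _ (act_mx _ _)).
by rewrite -(expr_mod (j + i) un) addnC.
Qed.

Definition power_repr := MxRepresentation power_mx_repr.

Lemma cfRepr_power s : cfRepr power_repr s = (\sum_g coeff (u ^+ s.1) (s.2^-1 ^ g)%g)%:~R.
Proof. by rewrite cfunE inE mulr1n trace_map_mx mxtrace_act. Qed.

End CyclicRepresentation.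

(** Equal characters of C_(n+1) x G give an intertwiner over algC. Commuting with right
    translations, it is left multiplication by some v with v u = x v. These equations are linear
    over Q, so v is a combination of rational solutions, and some rational combination still has
    nonzero determinant. *)
Theorem rationally_conjugate (gT : finGroupType) (u : group_ring int gT) (x : gT) n :
  u ^+ n.+1 = 1 -> (x ^+ n.+1 = 1)%g ->
  (forall i h, \sum_g coeff (u ^+ i) (h ^ g)%g = \sum_g ((h ^ g)%g == x ^+ i)%g%:R) ->
  exists y w : group_ring rat gT, inverse_of w y /\ y * ZG_to_QG u * w = gr_elt x.
Proof.
move=> un xn Etr; pose gx : group_ring int gT := gr_elt x.
have gxX i : gx ^+ i = gr_elt (x ^+ i)%g by rewrite gr_eltX.
have gxn : gx ^+ n.+1 = 1 by rewrite gxX xn gr_elt1.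
pose rho := power_repr un; pose sig := power_repr gxn.
have : mx_rsim rho sig.
  apply/cfRepr_rsimP/eqP/cfunP => s; rewrite !cfRepr_power Etr gxX; congr _%:~R.
  by apply: eq_bigr => g _; rewrite coeff_elt; case: eqP.
case/mx_rsim_def => B [B' B'B Brho].
have BB' : B *m B' = 1%:M by apply: mulmx1C.
have Bu : B \in unitmx by case/mulmx1_unit: BB'.
have HB s : rho s *m B = B *m sig s.
  by rewrite Brho ?inE // -!mulmxA B'B mulmx1.
have BR h : act_mx 1 h *m B = B *m act_mx 1 h.
  have := HB (0, h); rewrite /= /power_mx /= !expr0.
  suff -> : map_mx intr (act_mx (1 : group_ring int gT) h) = act_mx 1 h :> 'M[algC]_#|gT| by [].
  by apply/matrixP => a b; rewrite !mxE !coeff1; case: (_ == _).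
have Bact : map_mx intr (act_mx u 1%g) *m B = B *m map_mx intr (act_mx gx 1%g).
  have := HB (inZp 1, 1%g); rewrite /= /power_mx /=.
  (* [inZp 1] is 0 when [n] is 0, a case in which the hypothesis makes v equal to 1. *)
  have E1 (v : group_ring int gT) : v ^+ n.+1 = 1 -> v ^+ (1 %% n.+1) = v.
    by move=> vn; rewrite (expr_mod 1 vn) expr1.
  by rewrite !E1.
pose uC : group_ring algC gT := gr_of_fun (fun g => (coeff u g)%:~R).
have act_uC : map_mx intr (act_mx u 1%g) = act_mx uC 1%g.
  by apply/matrixP => a b; rewrite !mxE coeffE.
have act_gx (R : comNzRingType) : map_mx intr (act_mx gx 1%g) = act_mx (gr_elt x) 1%g :> 'M[R]_#|gT|.
  by apply/matrixP => a b; rewrite !mxE !coeff_elt; case: (_ == _).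
rewrite act_uC act_gx in Bact.
pose C : 'M[rat]_#|gT| := rmul_mx (ZG_to_QG u) - act_mx (gr_elt x) 1%g.
have mapC : map_mx ratr C = rmul_mx uC - act_mx (gr_elt x) 1%g.
  rewrite /C map_mxB; congr (_ - _).
    apply/matrixP => a b; by rewrite !mxE !coeffE /= ratr_int.
  by apply/matrixP => a b; rewrite !mxE !coeff_elt /= ratr_nat.
pose v := gr_vec 1 *m B; have Bv : B = lmul_mx v := commute_right_mult BR.
have vC : v *m map_mx ratr C = 0.
  apply/eqP; rewrite mapC mulmxBr subr_eq0; apply/eqP.
  have -> : v *m act_mx (gr_elt x) 1%g = gr_vec uC *m B.
    by rewrite /v -mulmxA -Bact mulmxA gr_vec_act gr_elt1 !mulr1.
  rewrite {}Bv; move: v => v'; rewrite -{1}(vec_grK v') gr_vec_rmul.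
  by rewrite /lmul_mx gr_vec_act gr_elt1 mulr1.
have /submxP[c Ev] : (v <= map_mx ratr (kermx C))%MS by rewrite map_kermx; apply/sub_kermxP.
pose A i := lmul_mx (row i (kermx C)).
have BA : B = \sum_i c 0 i *: map_mx ratr (A i).
  rewrite Bv Ev mulmx_sum_row lmul_mx_sum; apply: eq_bigr => i _; congr (_ *: _).
  by apply/matrixP => a b; rewrite [RHS]mxE !lmul_mxE !mxE.
have [c' dc'] : exists c' : 'I_#|gT| -> nat, \det (\sum_i (c' i)%:R *: map_mx ratr (A i) : 'M[algC]_#|gT|) != 0.
  by apply: (@nonsingular_nat_combination _ _ _ _ (c 0)); rewrite -BA -unitfE -unitmxE.
pose q := \sum_i (c' i)%:R *: row i (kermx C); pose y := vec_gr q.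
have dy : \det (act_mx y 1%g) != 0.
  have : ratr (\det (act_mx y 1%g)) != 0 :> algC.
    rewrite -det_map_mx -/(lmul_mx q) lmul_mx_sum raddf_sum /=.
    rewrite (eq_bigr (fun i => (c' i)%:R *: map_mx ratr (A i))) // => i _.
    by rewrite map_mxZ rmorph_nat.
  by rewrite fmorph_eq0.
have [w wy] := lmul_unit_inverse dy; exists y, w; split=> //.
have yC : y * ZG_to_QG u = gr_elt x * y.
  apply: gr_vec_inj; rewrite -gr_vec_rmul -[gr_elt x * y]mulr1 -gr_elt1 -gr_vec_act vec_grK.
  apply/eqP; rewrite -subr_eq0 -mulmxBr -/C; apply/eqP/sub_kermxP.
  by apply: summx_sub => i _; apply: scalemx_sub; apply: row_sub.
by rewrite yC -mulrA (proj1 wy) mulr1.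
Qed.

(** * Torsion units over PSL(2, q) *)

Lemma augmentationM (R : nzRingType) (gT : finGroupType) (u v : group_ring R gT) :
  augmentation (u * v) = augmentation u * augmentation v.
Proof.
rewrite /augmentation; under eq_bigr do rewrite coeffM.
rewrite exchange_big mulr_suml; apply: eq_bigr => h _.
by rewrite mulr_sumr (reindex_inj (mulgI h)); apply: eq_bigr => g _; rewrite mulKg.
Qed.

Lemma augmentationX (R : nzRingType) (gT : finGroupType) (u : group_ring R gT) m :
  augmentation (u ^+ m) = augmentation u ^+ m.
Proof.
elim: m => [|m IHm]; last by rewrite !exprS augmentationM IHm.
rewrite !expr0 /augmentation (bigD1 1%g) //= big1 => [|g g1]; first by rewrite coeff1 eqxx addr0.
by rewrite coeff1 (negbTE g1).
Qed.

Lemma pair_massV c z : pair_mass c^-1 z = pair_mass c z.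
Proof. by rewrite /pair_mass invrK addrC. Qed.

Lemma pair_mass_neq0 c z : (pair_mass c z != 0) = (z == c) || (z == c^-1).
Proof. by rewrite /pair_mass; do 2!case: (z == _). Qed.

Lemma pair_mass_refl c : pair_mass c c != 0.
Proof. by rewrite pair_mass_neq0 eqxx. Qed.

Lemma pair_mass_at1 c : pair_mass c 1 != 0 -> c = 1.
Proof. by rewrite pair_mass_neq0 => /orP[/eqP|/eqP/(canLR (@invrK _))]; rewrite ?invr1 => <-. Qed.

(** Passing from Sym^(2t-2) to Sym^(2t) adds exactly the eigenvalues a^t and a^-t, which is why
    increments isolate one Fourier coefficient. *)
Lemma sum_sym_powers (K : fieldType) (a : K) t : a != 0 ->
  \sum_(i < t.*2.+1) a ^+ i / a ^+ t = 1 + \sum_(1 <= s < t.+1) (a ^+ s + (a ^+ s)^-1).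
Proof.
move=> a0; elim: t => [|t IHt]; first by rewrite big_ord1 big_geq // !expr0 divr1 addr0.
rewrite big_nat_recr //= addrA -IHt doubleS big_ord_recr big_ord_recl /= expr0 mul1r.
have -> : a ^+ t.*2.+2 / a ^+ t.+1 = a ^+ t.+1.
  by rewrite -doubleS -addnn exprD mulfK ?expf_neq0.
rewrite (eq_bigr (fun i : 'I_t.*2.+1 => a ^+ i / a ^+ t)) => [|i _]; first by ring.
by rewrite /bump /= add1n !exprS invfM; field; rewrite a0 expf_neq0.
Qed.

Section Assembly.
Variables (F L : finFieldType) (iota : {rmorphism F -> L}).
Hypothesis trL : forall t : F, exists2 mu : L, mu != 0 & iota t = mu + mu^-1.
Local Notation G := (PSL2 F).
Implicit Types (g h x : G) (u v : group_ring int G).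
Variables (p : nat) (w : L) (omega : algC).
Hypothesis ch : p \in [pchar L].
Hypotheses (prim_w : (#|L|.-1).-primitive_root w) (prim_om : (#|L|.-1).-primitive_root omega).
Local Notation z := (eigen_sqr trL).

Definition eigen_root g : algC := teichC w omega (z g).
Local Notation Z := eigen_root.

Let z0 g : z g != 0 := eigen_sqr_neq0 trL g.

Lemma eigen_root_neq0 g : Z g != 0.
Proof. exact: teichC_neq0. Qed.

Lemma pair_mass_eigen_rootX g m y : pair_mass (Z (g ^+ m)%g) y = pair_mass (Z g ^+ m) y.
Proof.
rewrite /Z; case: (eigen_sqrX trL g m) => ->; move: (z g) (z0 g) => a a0.
  by rewrite (teichCX prim_w prim_om).
by rewrite (teichCV prim_w prim_om) ?expf_neq0 // pair_massV (teichCX prim_w prim_om).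
Qed.

Lemma pair_mass_eigen_rootJ g h y : pair_mass (Z (g ^ h)%g) y = pair_mass (Z g) y.
Proof.
rewrite /Z; case: (eigen_sqrJ trL g h) => -> //.
by rewrite (teichCV prim_w prim_om) ?pair_massV ?z0.
Qed.

Lemma eigen_root1 : Z 1%g = 1.
Proof. by rewrite /Z eigen_sqr1 (teichC1 prim_w prim_om). Qed.

Lemma eigen_root_expr g m : (g ^+ m = 1)%g -> Z g ^+ m = 1.
Proof.
move=> gm; apply: pair_mass_at1.
by rewrite -pair_mass_eigen_rootX gm eigen_root1 pair_mass_refl.
Qed.

Lemma conj_eigen_root g h n : n%:R != 0 :> F -> (g ^+ n = 1)%g -> (h ^+ n = 1)%g ->
  pair_mass (Z g) (Z h) != 0 -> exists x, h = (g ^ x)%g.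
Proof.
move=> n0 gn hn; rewrite pair_mass_neq0 => E; apply: (conj_eigen_sqr (trL := trL) n0 gn hn).
move: E; rewrite /Z -(teichCV prim_w prim_om) ?z0 // => /orP[]/eqP E; [left | right];
  by apply: (teichC_inj prim_w prim_om) E; rewrite ?invr_eq0 z0.
Qed.

Lemma eigen_root_eq1 g n : n%:R != 0 :> F -> (g ^+ n = 1)%g -> Z g = 1 -> g = 1%g.
Proof.
move=> n0 gn Zg; have [||x ->] := conj_eigen_root (g := 1%g) n0 _ gn; rewrite ?expg1n ?conj1g //.
by rewrite eigen_root1 Zg pair_mass_neq0 eqxx.
Qed.

(** For [u ^+ i] this is the function f_i: each coefficient is placed on both lifted eigenvalues,
    hence twice on a self-inverse one. *)
Definition eigen_mass u y : int := \sum_g coeff u g * pair_mass (Z g) y.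

Section TorsionSums.
Variables (r k : nat) (zeta : algC).
Local Notation n := (r ^ k)%N.
Hypotheses (r_pr : prime r) (n0 : n%:R != 0 :> F) (prim_zeta : n.-primitive_root zeta).
Local Notation mu := (roots1 n zeta).

Lemma eigen_mass_torsion u y : u ^+ n = 1 ->
  eigen_mass u y = \sum_(g | (g ^+ n == 1)%g) coeff u g * pair_mass (Z g) y.
Proof.
move=> un; apply: (@intr_inj algC); rewrite !rmorph_sum /=.
have stab : class_stable (fun g => (pair_mass (Z g) y)%:~R : algC).
  by move=> g h; rewrite pair_mass_eigen_rootJ.
have E := sum_class_fun_torsion r_pr un stab.
have psiE g : (coeff u g * pair_mass (Z g) y)%:~R = (pair_mass (Z g) y)%:~R *~ coeff u g :> algC.
  by rewrite mulrC intrM mulrzr.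
by rewrite (eq_bigr _ (fun g _ => psiE g)) [RHS](eq_bigr _ (fun g _ => psiE g)).
Qed.

Lemma eigen_mass_support u y : u ^+ n = 1 -> y \notin mu -> eigen_mass u y = 0.
Proof.
move=> un ymu; rewrite eigen_mass_torsion // big1 // => g /eqP gn.
have Zn := eigen_root_expr gn.
have [->|] := eqVneq (pair_mass (Z g) y) 0; first by rewrite mulr0.
rewrite pair_mass_neq0; case/orP => /eqP Ey; move: ymu; rewrite Ey ?roots1V // mem_roots1 // ?Zn ?eqxx //.
Qed.

Lemma sum_eigen_mass u (h : algC -> algC) : u ^+ n = 1 ->
  \sum_(y <- mu) (eigen_mass u y)%:~R * h y =
  \sum_(g | (g ^+ n == 1)%g) (h (Z g) + h (Z g)^-1) *~ coeff u g.
Proof.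
move=> un; under eq_bigr do rewrite eigen_mass_torsion // rmorph_sum mulr_suml.
rewrite exchange_big; apply: eq_bigr => g /eqP gn /=.
have Zmu : Z g \in mu by rewrite mem_roots1 // eigen_root_expr.
rewrite -mulrzl -(sum_delta_roots1 prim_zeta h Zmu).
rewrite -(sum_delta_roots1 prim_zeta h (_ : (Z g)^-1 \in mu)) ?roots1V //.
rewrite -big_split mulr_sumr; apply: eq_bigr => y _ /=.
by rewrite rmorphM -mulrA /pair_mass rmorphD /= !mulrz_nat mulrDl.
Qed.

Lemma sum_torsion_coeff u : u ^+ n = 1 -> augmentation u = 1 ->
  \sum_(g | (g ^+ n == 1)%g) (coeff u g)%:~R = 1 :> algC.
Proof.
move=> un au; have E := sum_class_fun_torsion r_pr un (psi := fun=> 1) (fun _ _ => erefl).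
transitivity ((augmentation u)%:~R : algC); last by rewrite au.
by rewrite rmorph_sum; apply: esym.
Qed.

Lemma brauer_lists u (zL : L) : n.-primitive_root zL -> u ^+ n = 1 -> augmentation u = 1 ->
  exists lam : nat -> seq algC, forall t, {subset lam t <= mu} /\ forall i,
    \sum_(a <- lam t) a ^+ i =
      1 + \sum_(1 <= s < t.+1) \sum_(y <- mu) (eigen_mass (u ^+ i) y)%:~R * y ^+ s.
Proof.
move=> prim_zL un au; have n_gt0 := prim_order_gt0 prim_zeta.
pose R t i : algC := 1 + \sum_(1 <= s < t.+1) \sum_(y <- mu) (eigen_mass (u ^+ i) y)%:~R * y ^+ s.
have uiX i : (u ^+ i) ^+ n = 1 by rewrite exprAC un expr1n.
(* Restricting to i < n makes the condition decidable, so that [xchoose] picks one list for each t;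
   periodicity restores all exponents. *)
have ex t : exists lam : seq algC, all (mem mu) lam &&
    [forall i : 'I_n, \sum_(a <- lam) a ^+ i == R t i].
  have [lam lam_n lamE] := brauer_eigenvalues trL ch prim_w prim_om t prim_zL un.
  exists lam; apply/andP; split.
    by apply/allP => a /lam_n an; rewrite /= mem_roots1 // an.
  apply/forallP => i; apply/eqP; rewrite lamE.
  have stab : class_stable (fun g => \sum_(j < t.*2.+1) Z g ^+ j / Z g ^+ t : algC).
    move=> g h; have := pair_mass_eigen_rootJ g h (Z (g ^ h)%g).
    have /eqP := pair_mass_neq0 (Z (g ^ h)%g) (Z (g ^ h)%g); rewrite eqxx /= => /eqP + E.
    rewrite E pair_mass_neq0 => /orP[]/eqP -> //.
    by rewrite !sum_sym_powers ?invr_eq0 ?eigen_root_neq0 //; congr (_ + _);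
      apply: eq_bigr => s _; rewrite !exprVn invrK addrC.
  rewrite (sum_class_fun_torsion r_pr (uiX i) stab) /R.
  under eq_bigr do rewrite sum_sym_powers ?eigen_root_neq0 // mulrzDl.
  rewrite big_split /= (sum_torsion_coeff (uiX i)) ?augmentationX ?au ?expr1n //; congr (_ + _).
  under eq_bigr do rewrite mulrz_suml.
  rewrite exchange_big; apply: eq_bigr => s _ /=.
  rewrite (sum_eigen_mass (fun y => y ^+ s) (uiX i)); apply: eq_bigr => g _.
  by rewrite exprVn.
exists (fun t => xchoose (ex t)) => t.
have /andP[/allP lam_mu /forallP lamE] := xchooseP (ex t); split=> // i.
have i_n : (i %% n < n)%N by rewrite ltn_mod.
have := lamE (Ordinal i_n); rewrite /R /= => /eqP; rewrite (expr_mod i un) => <-.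
rewrite !big_seq; apply: eq_bigr => a /lam_mu; rewrite /= mem_roots1 // => /eqP an.
by rewrite expr_mod.
Qed.

End TorsionSums.

Variable r : nat.
Hypotheses (r_pr : prime r) (r0 : r%:R != 0 :> F).

Let rk0 k : (r ^ k)%:R != 0 :> F. Proof. by rewrite natrX expf_neq0. Qed.

(** Induction on k through u^r, whose root is [eta]; most of the proof checks the hypotheses of
    [eigenvalue_combinatorics]. *)
Lemma eigen_mass_power k u (zL : L) : (r ^ k).-primitive_root zL -> (r ^ k).-primitive_root u ->
  augmentation u = 1 ->
  exists2 b : algC, (r ^ k).-primitive_root b &
    forall i y, eigen_mass (u ^+ i) y = pair_mass (b ^+ i) y.
Proof.
elim: k u zL => [|k IHk] u zL prim_zL prim_u au.
  exists 1; first by apply/andP; split=> //; apply/forallP => -[[|//] ?]; rewrite unity_rootE expr1n !eqxx.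
  have := prim_expr_order prim_u; rewrite expn0 expr1 => -> i y.
  rewrite /eigen_mass !expr1n (bigD1 1%g) //= big1 => [|g g1].
    by rewrite coeff1 eqxx mul1r addr0 eigen_root1.
  by rewrite coeff1 (negbTE g1) mul0r.
set n := (r ^ k.+1)%N in prim_u prim_zL *.
have n_gt0 : (0 < n)%N by rewrite expn_gt0 prime_gt0.
have divn_r : (n %/ r ^ k = r)%N by rewrite /n expnSr mulKn ?expn_gt0 ?prime_gt0.
have dvd_n : (r ^ k %| n)%N by rewrite dvdn_exp2l.
have prim_ur : (r ^ k).-primitive_root (u ^+ r).
  by have := dvdn_prim_root prim_u dvd_n; rewrite divn_r.
have prim_zLr : (r ^ k).-primitive_root (zL ^+ r).
  by have := dvdn_prim_root prim_zL dvd_n; rewrite divn_r.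
have aur : augmentation (u ^+ r) = 1 by rewrite augmentationX au expr1n.
have [eta prim_eta etaE] := IHk _ _ prim_zLr prim_ur aur.
have [zeta prim_zeta] := C_prim_root_exists n_gt0.
have un : u ^+ n = 1 := prim_expr_order prim_u.
have uiX i : (u ^+ i) ^+ n = 1 by rewrite exprAC un expr1n.
have aui i : augmentation (u ^+ i) = 1 by rewrite augmentationX au expr1n.
have [lam lamP] := brauer_lists r_pr prim_zeta prim_zL un au.
have [|||||||b prim_b bE] := @eigenvalue_combinatorics r k zeta eta r_pr prim_zeta prim_eta
  (fun i y => eigen_mass (u ^+ i) y) lam.
- by move=> i y _; rewrite /eigen_mass; under eq_bigr do rewrite pair_mass_inv.
- move=> i; apply: (@intr_inj algC); rewrite rmorph_sum /=.
  have /= E := sum_eigen_mass r_pr prim_zeta (fun=> 1) (uiX i).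
  rewrite (eq_bigr _ (fun y _ => esym (mulr1 (eigen_mass (u ^+ i) y)%:~R))) E.
  under eq_bigr do rewrite mulrzDl.
  by rewrite big_split /= !(sum_torsion_coeff r_pr (uiX i)).
(* Among torsion elements only 1 has lifted eigenvalue 1, and [berman_higman] kills the coefficient
   of u^i there unless u^i = 1. *)
- move=> i ni; rewrite (eigen_mass_torsion r_pr _ (uiX i)) big1 // => g /eqP gn.
  have [g1|g1] := eqVneq g 1%g.
    have [ui0|ui1] := eqVneq (coeff (u ^+ i) 1%g) 0; first by rewrite g1 ui0 mul0r.
    by have := berman_higman n_gt0 (uiX i) (aui i) ui1; move/eqP; rewrite -(prim_order_dvd prim_u) (negbTE ni).
  have [->|] := eqVneq (pair_mass (Z g) 1) 0; first by rewrite mulr0.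
  by move=> E; case/eqP: g1; apply: eigen_root_eq1 (rk0 k.+1) gn (pair_mass_at1 E).
(* The factor 2 comes from the pair of eigenvalues, the factor r from [sum_torsion_coeff_mod], as
   the coefficient of u^(r^j) at 1 is 0. *)
- move=> j jk; rewrite expr1.
  have -> : \sum_(y <- roots1 n zeta | y ^+ (r ^ j) == 1) eigen_mass u y =
      2 * \sum_(g | (g ^+ (r ^ j) == 1)%g) coeff u g.
    apply: (@intr_inj algC); rewrite intrM !rmorph_sum /=.
    have := sum_eigen_mass r_pr prim_zeta (fun y => (y ^+ (r ^ j) == 1)%:R) un.
    rewrite (bigID (fun y => y ^+ (r ^ j) == 1)) /= [X in _ + X]big1 ?addr0 => [|y /negbTE ->]; last first.
      by rewrite mulr0.
    rewrite (eq_bigr (fun y => (eigen_mass u y)%:~R)) => [->|y ->]; last by rewrite mulr1.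
    rewrite mulr_sumr (bigID (fun g => (g ^+ (r ^ j) == 1)%g)) /= [X in _ + X]big1 ?addr0.
      apply: eq_big => g; last first.
        case/andP=> _ /eqP gj; have Zj := eigen_root_expr gj.
        by rewrite exprVn Zj invr1 eqxx -mulrzr.
      rewrite andb_idl // => /eqP gj; apply/eqP.
      by rewrite /n -(subnKC (leqW jk)) expnD expgM gj expg1n.
    move=> g /andP[/eqP gn gj].
    have Zj : Z g ^+ (r ^ j) != 1.
      apply: contra gj => /eqP Zj; apply/eqP; apply: eigen_root_eq1 (rk0 k.+1) _ _.
        by rewrite -expgM mulnC expgM gn expg1n.
      have := pair_mass_eigen_rootX g (r ^ j) 1; rewrite Zj.
      by move=> E; apply: pair_mass_at1; rewrite E pair_mass_refl.
    by rewrite exprVn invr_eq1 (negbTE Zj) addr0 mul0rz.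
  rewrite PoszM; apply: dvdz_mul (dvdzz _) _.
  have := sum_torsion_coeff_mod u j r_pr.
  have [->|uj1] := eqVneq (coeff (u ^+ (r ^ j)) 1%g) 0; first by rewrite subr0.
  have := berman_higman n_gt0 (uiX _) (aui _) uj1; move/eqP.
  rewrite -(prim_order_dvd prim_u) => /dvdn_leq; rewrite expn_gt0 prime_gt0 // => /(_ isT).
  by rewrite leq_exp2l ?prime_gt1 // leqNgt ltnS jk.
- move=> i y _; rewrite exprM; exact: etaE.
- by move=> t; case: (lamP t).
- by move=> t i; case: (lamP t) => _ ->.
exists b => // i y; have [ymu|ymu] := boolP (y \in roots1 n zeta); first exact: bE.
rewrite (eigen_mass_support r_pr prim_zeta) //.
have [//|] := eqVneq (pair_mass (b ^+ i) y) 0.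
have bn : (b ^+ i) ^+ n = 1 by rewrite exprAC (prim_expr_order prim_b) expr1n.
rewrite pair_mass_neq0; case/orP => /eqP Ey; move: ymu; rewrite Ey ?roots1V // mem_roots1 // ?bn ?eqxx //.
Qed.

(** Lifted eigenvalues up to inversion separate the classes of torsion elements, so [eigen_mass u]
    at Z h sees only the class of h. The factor [pair_mass (Z h) (Z h)] is 2 if Z h is self-inverse
    and 1 otherwise; the cardinal is the order of the centraliser of h. *)
Lemma class_sum_eigen_mass u h k : u ^+ (r ^ k) = 1 -> (h ^+ (r ^ k) = 1)%g ->
  (\sum_g coeff u (h ^ g)%g) * pair_mass (Z h) (Z h) =
   #|[set g | (h ^ g)%g == h]|%:R * eigen_mass u (Z h).
Proof.
move=> un hn.
rewrite (eigen_mass_torsion r_pr _ un); pose N a := #|[set g | (h ^ g)%g == a]|.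
have -> : \sum_g coeff u (h ^ g)%g = \sum_a coeff u a * (N a)%:R.
  rewrite (partition_big (fun g => h ^ g)%g predT) //=; apply: eq_bigr => a _.
  rewrite (eq_bigr (fun=> coeff u a)) => [|g /eqP -> //].
  by rewrite mulr_natr -sumr_const; apply: eq_bigl => g; rewrite inE.
have NJ t : N (h ^ t)%g = N h.
  rewrite /N -(card_imset _ (mulIg t^-1%g)); apply: eq_card => g.
  apply/imsetP/idP => [[g']|]; rewrite !inE.
    by move=> /eqP gh ->; rewrite conjgM gh conjgK.
  by move=> /eqP gh; exists (g * t)%g; rewrite ?mulgK // inE conjgM gh.
rewrite mulr_suml mulr_sumr (bigID (fun a => (a ^+ (r ^ k) == 1)%g)) /= [X in _ + X]big1 ?addr0.
  apply: eq_bigr => a /eqP an; rewrite -mulrA [RHS]mulrCA; congr (_ * _).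
  have [/existsP[t /eqP ->]|none] := boolP [exists t, a == (h ^ t)%g].
    by rewrite NJ pair_mass_eigen_rootJ.
  have [->|] := eqVneq (pair_mass (Z a) (Z h)) 0; last first.
    case/(conj_eigen_root (rk0 k) an hn) => t Eh; case/existsP: none.
    by exists t^-1%g; rewrite Eh conjgK.
  rewrite [N a](_ : _ = 0%N) ?mul0r ?mulr0 //; apply/eqP; rewrite cards_eq0 -subset0.
  by apply/subsetP => g; rewrite inE => /eqP hg; case/existsP: none; exists g; rewrite hg.
move=> a an; rewrite [N a](_ : _ = 0%N) ?mulr0 ?mul0r //; apply/eqP; rewrite cards_eq0 -subset0.
by apply/subsetP => g; rewrite inE => /eqP hg; case/negP: an; rewrite -hg -conjXg hn conj1g.
Qed.

Lemma torsion_class_sums k u (zL : L) : (r ^ k).-primitive_root zL -> (r ^ k).-primitive_root u ->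
  augmentation u = 1 ->
  exists2 x : G, (x ^+ (r ^ k) = 1)%g & forall i h,
    \sum_g coeff (u ^+ i) (h ^ g)%g = \sum_g ((h ^ g)%g == x ^+ i)%g%:R.
Proof.
move=> prim_zL prim_u au; have un := prim_expr_order prim_u.
have [b prim_b bE] := eigen_mass_power prim_zL prim_u au.
(* [eigen_mass u] is nonzero at b, so some torsion element must have b or its inverse as lifted
   eigenvalue. *)
have [x xn xb] : exists2 x : G, (x ^+ (r ^ k) = 1)%g & (b == Z x) || (b == (Z x)^-1).
  have := pair_mass_refl b; rewrite -[X in pair_mass X]expr1 -bE expr1 (eigen_mass_torsion r_pr _ un).
  have [/existsP[x /andP[/eqP xn xb]] _|none] :=
    boolP [exists x : G, (x ^+ (r ^ k) == 1)%g && (pair_mass (Z x) b != 0)].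
    by exists x; rewrite // -pair_mass_neq0.
  rewrite big1 ?eqxx // => g gn; apply/eqP; rewrite mulf_eq0; apply/orP; right.
  by apply: contraNT none => gb; apply/existsP; exists g; rewrite gn.
exists x => // i h; have uin : (u ^+ i) ^+ (r ^ k) = 1 by rewrite exprAC un expr1n.
have xin : ((x ^+ i) ^+ (r ^ k) = 1)%g by rewrite -expgM mulnC expgM xn expg1n.
transitivity (\sum_g coeff (gr_elt (x ^+ i)%g : group_ring int G) (h ^ g)%g); last first.
  by apply: eq_bigr => g _; rewrite coeff_elt.
have xiN : (gr_elt (x ^+ i)%g : group_ring int G) ^+ (r ^ k) = 1 by rewrite -gr_eltX xin gr_elt1.
have [hn|hn] := eqVneq (h ^+ (r ^ k))%g 1%g; last first.
  by rewrite [LHS](class_coeff_vanish r_pr uin hn) [RHS](class_coeff_vanish r_pr xiN hn).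
apply: (mulIf (pair_mass_refl (Z h))).
rewrite (class_sum_eigen_mass uin hn) (class_sum_eigen_mass xiN hn); congr (_ * _).
rewrite bE [RHS](bigD1 (x ^+ i)%g) //= [X in _ + X]big1 => [|g /negbTE gx]; last by rewrite coeff_elt gx mul0r.
rewrite coeff_elt eqxx mul1r addr0 pair_mass_eigen_rootX.
by case/orP: xb => /eqP ->; rewrite // exprVn pair_massV.
Qed.

End Assembly.

Lemma exists_generator (L : finFieldType) : exists w : L, (#|L|.-1).-primitive_root w.
Proof.
have L_gt1 : (1 < #|L|)%N := finNzRing_gt1 L.
have L_gt0 : (0 < #|L|.-1)%N by rewrite -ltnS prednK // ltnW.
pose rs := enum (predC1 (0 : L)).
have /hasP[w _ prim_w] : has (#|L|.-1).-primitive_root rs.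
  apply: has_prim_root => //.
  - apply/allP => x; rewrite mem_enum unity_rootE => x0.
    by rewrite expr_card_pred.
  - exact: enum_uniq.
  - by rewrite -cardE cardC1.
by exists w.
Qed.

Theorem theorem1 (p f r : nat) (F : finFieldType)
    (u : group_ring int (PSL2 F)) :
  prime p -> (1 <= f)%N -> #|F| = (p ^ f)%N ->
  prime r -> r <> p ->
  normalized_unit u -> (exists k : nat, has_order u (r ^ k)) ->
  exists (x xinv : group_ring rat (PSL2 F)) (g : PSL2 F),
    inverse_of x xinv /\ xinv * ZG_to_QG u * x = gr_elt g.
Proof.
move=> p_pr f_gt0 cardF r_pr /eqP rp [_ au] [k prim_u].
have chF : p \in [pchar F] := card_finPcharP cardF p_pr.
have r0 : r%:R != 0 :> F.
  by rewrite -(dvdn_pcharf chF) dvdn_prime2 // eq_sym.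
have rk0 : (r ^ k)%:R != 0 :> F by rewrite natrX expf_neq0.
have [L [iota [trL [zL prim_zL]]]] := exists_splitting_extension rk0.
have chL : p \in [pchar L] by rewrite (fmorph_pchar iota).
have [w prim_w] := exists_generator L.
have [omega prim_om] := C_prim_root_exists (prim_order_gt0 prim_w).
have [x xn xE] := torsion_class_sums trL chL prim_w prim_om r_pr r0 prim_zL prim_u au.
have rk_gt0 : (0 < r ^ k)%N by rewrite expn_gt0 prime_gt0.
have un := prim_expr_order prim_u; rewrite -(prednK rk_gt0) in un xn.
have [y [w' [wy E]]] := rationally_conjugate un xn xE.
by exists w', y, x.
Qed.
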